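(* Let $g:\mathbb{R}\to\mathbb{R}$ be a differentiable function such that: (i) $g$ is nondecreasing and $g(0)=0$; (ii) $yg(y)>0$ for all $y\neq 0$; (iii) there is a constant $c_2>0$ with $|g(x+y)|\le c_2(|g(x)|+|g(y)|+1)$ for all $x,y\in\mathbb{R}$; (iv) there is a constant $c_3\ge 1$ with $|g'(y)|\le c_3\frac{1+|g(y)|}{1+|y|}$ for all $y\in\mathbb{R}$. Let $W$ be a real random variable, $\delta>0$ a constant, $\hat K(t)$, $|t|\le\delta$, a nonnegative random function, and $R(W)$ a random variable (a function of $W$) such that $$\mathrm{E}\bigl(f(W)g(W)\bigr)=\mathrm{E}\Bigl(\int_{|t|\le\delta}f'(W+t)\hat K(t)\,dt\Bigr)+\mathrm{E}\bigl(f(W)R(W)\bigr)$$ for all absolutely continuous $f$ for which the expectation of either side exists. Put $\hat K_1=\int_{|t|\le\delta}\hat K(t)\,dt$. Assume that there exist $\tau_1>0$, $\tau_2>0$, $\delta_1>0$, $\delta_2\ge 0$ such that $$|\mathrm{E}(\hat K_1\mid W)-1|\le\delta_1(|g(W)|^{\tau_1}+1),\qquad |R(W)|\le\delta_2(|g(W)|^{\tau_2}+1),$$ and constants $d_0\ge 1$, $d_1>0$, $0\le\alpha<1$ such that $$\mathrm{E}(\hat K_1\mid W)\le d_0,\qquad \delta|g(W)|\le d_1,\qquad |R(W)|\le\alpha(|g(W)|+1).$$ Let $Y$ be a random variable with density $p(y)=c_1e^{-G(y)}$, $y\in\mathbb{R}$. Then $$\frac{\mathrm{P}(W>z)}{\mathrm{P}(Y>z)}=1+O(1)\Bigl(\delta\bigl(1+zg^2(z)\bigr)+\delta_1\bigl(1+zg^{\tau_1+1}(z)\bigr)+\delta_2\bigl(1+zg^{\tau_2}(z)\bigr)\Bigr)$$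 for all $z\ge 0$ satisfying $\delta zg^2(z)+\delta_1zg^{\tau_1+1}(z)+\delta_2zg^{\tau_2}(z)\le 1$, where $O(1)$ denotes a quantity bounded in absolute value by a finite constant depending only on $d_0,d_1,c_1,c_2,c_3,\tau_1,\tau_2,\alpha$ and $\max(g(1),|g(-1)|)$.
   Context: $G(y)=\int_0^y g(t)\,dt$, and $c_1$ is the normalizing constant making $p(y)=c_1e^{-G(y)}$ a probability density on $\mathbb{R}$. $g^{\tau}(z)$ means $(g(z))^{\tau}$. Inequalities between random variables are understood almost surely. *)

(* Defs.v *)
From HB Require Import structures.
From mathcomp Require Import all_boot all_order all_algebra.
From mathcomp Require Import all_classical all_reals all_analysis measurable_realfun.
Set Implicit Arguments.
Unset Strict Implicit.
Unset Printing Implicit Defensive.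
Import Order.TTheory GRing.Theory Num.Theory.
Import numFieldNormedType.Exports.
Local Open Scope classical_set_scope.
Local Open Scope ring_scope.

(* The oriented integral from 0 to y, negative orientation when y < 0. *)
Definition primitive0 (R : realType) (g : R -> R) (y : R) : R :=
  if 0 <= y then \int[@lebesgue_measure R]_(t in `[0, y]) g t
  else - \int[@lebesgue_measure R]_(t in `[y, 0]) g t.

Definition has_density (d : measure_display) (T : measurableType d)
    (R : realType) (P : probability T R) (Y : {RV P >-> R}) (p : R -> R) : Prop :=
  [/\ measurable_fun setT p, forall y, 0 <= p y
    & forall A : set R, measurable A ->
        distribution P Y A = (\int[@lebesgue_measure R]_(y in A) (p y)%:E)%E].

(* Absolute continuity on every compact interval, which is the usual meaning
   of "absolutely continuous" for a function on the whole real line. *)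
Definition absolutely_continuous (R : realType) (f : R -> R) : Prop :=
  forall a b : R, forall e : R, 0 < e -> exists2 eta : R, 0 < eta &
    forall (n : nat) (u v : 'I_n -> R),
      (forall i, [/\ a <= u i, u i <= v i & v i <= b]) ->
      trivIset [set: 'I_n] (fun i => `]u i, v i[%classic) ->
      \sum_(i < n) (v i - u i) < eta ->
      \sum_(i < n) `|f (v i) - f (u i)| < e.

(* Z is a version of E(X | W), for an extended-real random variable X whose
   integral is defined (X >= 0 almost surely in the use made of it below).
   preimage_set_system setT W measurable is the sigma-algebra generated by W. *)
Definition is_cond_expectation (d : measure_display) (T : measurableType d)
    (R : realType) (P : probability T R) (W : {RV P >-> R})
    (X Z : T -> \bar R) : Prop :=
  (forall B : set (\bar R), measurable B ->
     preimage_set_system setT W measurable (Z @^-1` B)) /\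
  (forall A : set T, preimage_set_system setT W measurable A ->
     \int[P]_(w in A) Z w = \int[P]_(w in A) X w)%E.

Section stein_identity.
Context (d : measure_display) (T : measurableType d) (R : realType).
Variables (P : probability T R) (W : {RV P >-> R}).
Variables (delta : R) (K : T -> R -> R).

Definition khat1 (w : T) : \bar R :=
  (\int[@lebesgue_measure R]_(t in `[(- delta)%R, delta]) (K w t)%:E)%E.

(* f^`() is a total function; for absolutely continuous f it is the
   almost-everywhere derivative, and its values on the exceptional Lebesgue-null
   set do not affect the integral over t. *)
Definition khat_term (f : R -> R) (w : T) : R :=
  \int[@lebesgue_measure R]_(t in `[- delta, delta]) (f^`()%classic (W w + t) * K w t).

(* Existence of an expectation is existence as a finite Lebesgue integral. *)
Definition stein_lhs_exists (g f : R -> R) : Prop :=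
  P.-integrable setT (fun w => (f (W w) * g (W w))%:E).

Definition stein_rhs_exists (r f : R -> R) : Prop :=
  [/\ {ae P, forall w, (@lebesgue_measure R).-integrable `[- delta, delta]
               (fun t => (f^`()%classic (W w + t) * K w t)%:E)},
      P.-integrable setT (fun w => (khat_term f w)%:E)
    & P.-integrable setT (fun w => (f (W w) * r (W w))%:E)].

Definition stein_identity (g r : R -> R) : Prop :=
  forall f : R -> R, absolutely_continuous f ->
    stein_lhs_exists g f \/ stein_rhs_exists r f ->
    [/\ stein_lhs_exists g f, stein_rhs_exists r f
      & ('E_P[fun w => (f (W w) * g (W w))%R]
         = 'E_P[khat_term f] + 'E_P[fun w => (f (W w) * r (W w))%R])%E].

End stein_identity.

(* Main.v *)
Require Import Defs.
From HB Require Import structures.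
From mathcomp Require Import all_boot all_order all_algebra.
From mathcomp Require Import all_classical all_reals all_analysis measurable_realfun.
From mathcomp Require Import ring lra.
Set Implicit Arguments.
Unset Strict Implicit.
Unset Printing Implicit Defensive.
Import Order.TTheory GRing.Theory Num.Theory.
Import numFieldNormedType.Exports.
Local Open Scope classical_set_scope.
Local Open Scope ring_scope.

(** Write p = c1 e^(-G) for the density, A for its distribution function and
    b = 1 - A(z).  Since p' = - g p, the equation
      f'(w) - g(w) f(w) = 1_(w <= z) - A(z)
    has an explicit nonnegative solution f.  Taking expectations at W and
    replacing E f(W) g(W) by the hypothesis on W, the difference
    P(W > z) - b becomes a sum of three errors: E f'(W) (E(K1 | W) - 1), the
    variation of f' over distances delta, and E f(W) R(W).  Both f and
    f' / (1 + |g|) are bounded by a multiple of b L, where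
    L(w) = e^(G(w)) is frozen outside [0, z], so the theorem follows once
      E L(W) (1 + |g(W)|^k) = O(1 + z g(z)^k)
    is known for the exponents tau1 + 1, 2, tau2 and 1
    ([gibbs_weighted_moment], used in [tail_comparison]).

    Those moments say that W has tails no heavier than those of Y, up to
    constants, and they come from the same identity applied to other test
    functions.  In [exponential_bound] the test function is e^(G(w) - lam w),
    with lam = C / z, frozen below a fixed point and above z.  Its derivative is
    (g - lam) f, so f g - f' leaves the gain lam f, while the three errors are
    f times at most a multiple of
    delta g(z)^2 + delta1 g(z)^(tau1 + 1) + delta2 g(z)^tau2.  The assumption
    on z bounds this sum by 1 / z, so the gain absorbs it; and e^(lam w) is
    bounded on [0, z], so the tilt costs only a constant.  Beyond z the test
    function is constant and the term f g itself controls e^(G(z)) times the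
    expectation of g(W) over W > z + delta.  A test function g^m, frozen below
    z, then raises the power of g there ([tail_power_bound]).

    Two difficulties shape the details.  First, f' jumps by 1 at z, so its
    variation is not small there; subtracting from f (or from -f) a ramp of
    slope 1 and height 6 delta around z dominates the jump at a cost
    proportional to delta ([one_sided_certificate]).  Second, all constants
    must be chosen before g.  A point M = max(e / c1, 1) satisfies
    g(M) >= 1 / M ([drift_crossover]), which makes constants comparable with
    g beyond M, and g is bounded on bounded sets in terms of c2 and gmax alone
    ([drift_bounded]).  When delta or delta2 is not small, these facts confine
    z to a bounded range and the estimate is trivial
    ([large_error_comparison]).

    All that is used of W is one inequality, [stein_certificate]: pointwise
    bounds on f and f' imply a bound on an expectation. *)

(** * Calculus on the line *)

Section calculus.
Context (R : realType).
Implicit Types (f df : R -> R) (a b x y L : R).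

Lemma mvt_le f df a b L : a <= b ->
  {in `[a, b], continuous f} ->
  (forall x, a < x < b -> is_derive x 1 f (df x)) ->
  (forall x, a < x < b -> df x <= L) ->
  f b - f a <= L * (b - a).
Proof.
move=> ab cf dfE dfL; have [->|anb] := eqVneq a b; first by rewrite !subrr mulr0.
have altb : a < b by rewrite lt_neqAle anb.
have [c cab ->] : exists2 c, c \in `]a, b[%R & f b - f a = df c * (b - a).
  have cf' : {within `[a, b], continuous f}.
    by apply: continuous_in_subspaceT => x; rewrite inE => xab; exact: cf.
  by apply: (MVT altb _ cf') => c; rewrite in_itv /= => /dfE.
apply: ler_wpM2r; first by rewrite subr_ge0.
by apply: dfL; move: cab; rewrite in_itv.
Qed.

Lemma mvt_ge f df a b L : a <= b ->
  {in `[a, b], continuous f} ->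
  (forall x, a < x < b -> is_derive x 1 f (df x)) ->
  (forall x, a < x < b -> L <= df x) ->
  L * (b - a) <= f b - f a.
Proof.
move=> ab cf dfE dfL; have [->|anb] := eqVneq a b; first by rewrite !subrr mulr0.
have altb : a < b by rewrite lt_neqAle anb.
have [c cab ->] : exists2 c, c \in `]a, b[%R & f b - f a = df c * (b - a).
  have cf' : {within `[a, b], continuous f}.
    by apply: continuous_in_subspaceT => x; rewrite inE => xab; exact: cf.
  by apply: (MVT altb _ cf') => c; rewrite in_itv /= => /dfE.
apply: ler_wpM2r; first by rewrite subr_ge0.
by apply: dfL; move: cab; rewrite in_itv.
Qed.

Lemma is_derive_continuous f x d : is_derive x 1 f d -> {for x, continuous f}.
Proof.
by move=> [fx _]; apply: differentiable_continuous; exact/derivable1_diffP.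
Qed.

Lemma mvt_norm_le f df a b L : a <= b ->
  {in `[a, b], continuous f} ->
  (forall x, a < x < b -> is_derive x 1 f (df x)) ->
  (forall x, a < x < b -> `|df x| <= L) ->
  `|f b - f a| <= L * (b - a).
Proof.
move=> ab cf dfE dfL; rewrite ler_norml -mulNr (mvt_le ab cf dfE) ?andbT.
  by apply: (mvt_ge ab cf dfE) => x /dfL; rewrite ler_norml => /andP[].
by move=> x /dfL; rewrite ler_norml => /andP[].
Qed.

Lemma is_derive_eqf f h x d : f =1 h -> is_derive x 1 f d -> is_derive x 1 h d.
Proof. by move=> /funext ->. Qed.

Lemma is_derive_mul f h x d e : is_derive x 1 f d -> is_derive x 1 h e ->
  is_derive x 1 (fun t => f t * h t) (d * h x + f x * e).
Proof.
move=> fx hx; have := is_deriveM fx hx; rewrite /GRing.scale /=.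
by rewrite addrC (mulrC (h x)).
Qed.

Lemma is_derive_sub f h x d e : is_derive x 1 f d -> is_derive x 1 h e ->
  is_derive x 1 (fun t => f t - h t) (d - e).
Proof. by move=> fx hx; exact: is_deriveB. Qed.

Lemma is_derive_const (c x : R) : is_derive x 1 (fun=> c) 0.
Proof. exact: is_derive_cst. Qed.

Lemma is_derive_mulc f x d c : is_derive x 1 f d ->
  is_derive x 1 (fun t => c * f t) (c * d).
Proof.
by move=> fx; have := is_derive_mul (is_derive_const c x) fx; rewrite mul0r add0r.
Qed.

Lemma is_derive_expR_comp f x d : is_derive x 1 f d ->
  is_derive x 1 (fun t => expR (f t)) (d * expR (f x)).
Proof.
move=> fx; rewrite mulrC.
exact: (is_derive1_comp (is_derive_expR (f x)) fx).
Qed.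

(** The test functions below are defined piecewise, and differentiated on each
    piece through the smooth expression that they coincide with there. *)
Lemma near_derive1 f h x d : (\forall y \near x, f y = h y) ->
  is_derive x 1 h d -> f^`()%classic x = d.
Proof.
move=> fh dh; rewrite derive1E.
have hf : \forall y \near x, h y = f y by apply: filterS fh.
by have [_ ->] := near_eq_is_derive hf dh.
Qed.

(** ** Lipschitz functions on compact intervals *)

(** A class of absolutely continuous functions that is closed under the
    operations from which the test functions are built, composition
    included. *)
Definition locally_lipschitz f := forall a b, exists2 L : R, 0 <= L &
  forall x y, x \in `[a, b] -> y \in `[a, b] -> `|f x - f y| <= L * `|x - y|.

Lemma locally_lipschitz_ac f : locally_lipschitz f -> absolutely_continuous f.
Proof.
move=> lf a b e e0; have [L L0 fL] := lf a b.
exists (e / (L + 1)); first by rewrite divr_gt0 // ltr_wpDl.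
move=> n u v uv _ suv.
have L1 : 0 < L + 1 by rewrite ltr_wpDl.
apply: (@le_lt_trans _ _ ((L + 1) * \sum_(i < n) (v i - u i))).
  rewrite mulr_sumr; apply: ler_sum => i _.
  have [au uv' vb] := uv i.
  have uI : u i \in `[a, b] by rewrite in_itv /= au (le_trans uv').
  have vI : v i \in `[a, b] by rewrite in_itv /= vb (le_trans au).
  apply: (le_trans (fL _ _ vI uI)); rewrite [`|v i - u i|]ger0_norm ?subr_ge0 //.
  by apply: ler_wpM2r; rewrite ?subr_ge0// lerDl.
by rewrite mulrC -ltr_pdivlMr.
Qed.

Lemma locally_lipschitz_bounded f a b : locally_lipschitz f ->
  exists2 B : R, 0 <= B & forall x, x \in `[a, b] -> `|f x| <= B.
Proof.
move=> lf; have [L L0 fL] := lf a b.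
exists (`|f a| + L * `|b - a|); first by rewrite addr_ge0 // mulr_ge0.
move=> x xab; have := xab; rewrite in_itv /= => /andP[ax xb].
have aI : a \in `[a, b] by rewrite in_itv /= lexx (le_trans ax).
rewrite -[f x](subrK (f a)) addrC (le_trans (ler_normD _ _)) // lerD2l.
apply: (le_trans (fL _ _ xab aI)); apply: ler_wpM2l => //.
by rewrite !ger0_norm ?subr_ge0 // ?lerB// (le_trans ax).
Qed.

Lemma locally_lipschitz_continuous f : locally_lipschitz f -> continuous f.
Proof.
move=> lf x; have [L L0 fL] := lf (x - 1) (x + 1).
apply/cvgrPdist_le => e e0; near=> y.
have yx : `|x - y| <= 1 by near: y; apply: cvgr_dist_le.
have yxe : `|x - y| <= e / (L + 1).
  by near: y; apply: cvgr_dist_le => //; rewrite divr_gt0 // ltr_wpDl.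
move: (yx); rewrite ler_norml => /andP[y1 y2].
have xI : x \in `[x - 1, x + 1] by rewrite in_itv /=; apply/andP; split; lra.
have yI : y \in `[x - 1, x + 1] by rewrite in_itv /=; apply/andP; split; lra.
apply: (le_trans (fL _ _ xI yI)).
apply: (@le_trans _ _ ((L + 1) * (e / (L + 1)))).
  by apply: ler_pM => //; rewrite lerDl.
by rewrite mulrC divfK // gt_eqF // ltr_wpDl.
Unshelve. all: by end_near. Qed.

Lemma locally_lipschitz_derive f df : (forall x, is_derive x 1 f (df x)) ->
  (forall a b, exists L, forall x, x \in `[a, b] -> `|df x| <= L) ->
  locally_lipschitz f.
Proof.
move=> fdf dfb a b; have [L dfL] := dfb a b.
exists (Num.max 0 L) => [|x y]; first by rewrite le_max lexx.
have cf : continuous f by move=> t; apply: is_derive_continuous (fdf t).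
wlog xy : x y / x <= y => [hw|xab yab].
  case: (leP x y) => [xy|/ltW yx] xab yab; first exact: hw.
  by rewrite distrC [`|x - y|]distrC; apply: hw.
rewrite distrC [`|x - y|]distrC [`|y - x|]ger0_norm ?subr_ge0 //.
apply: (mvt_norm_le (df := df)) => // t /andP[xt ty].
move: xab yab; rewrite !in_itv /= => /andP[ax _] /andP[_ yb].
apply: (@le_trans _ _ L); last by rewrite le_max lexx orbT.
by apply: dfL; rewrite in_itv /= (le_trans ax (ltW xt)) (le_trans (ltW ty) yb).
Qed.

Lemma locally_lipschitz_comp f h : locally_lipschitz f -> locally_lipschitz h ->
  locally_lipschitz (fun x => f (h x)).
Proof.
move=> lf lh a b; have [L L0 hL] := lh a b.
have [B B0 hB] := locally_lipschitz_bounded a b lh.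
have [L' L'0 fL'] := lf (- B) B.
exists (L' * L) => [|x y xab yab]; first exact: mulr_ge0.
have hx := hB _ xab; have hy := hB _ yab.
apply: (le_trans (fL' _ _ _ _)); rewrite ?in_itv /= -?ler_norml //.
by rewrite -mulrA; apply: ler_wpM2l => //; exact: hL.
Qed.

Lemma locally_lipschitz_add f h : locally_lipschitz f -> locally_lipschitz h ->
  locally_lipschitz (fun x => f x + h x).
Proof.
move=> lf lh a b; have [L L0 fL] := lf a b; have [K K0 hK] := lh a b.
exists (L + K) => [|x y xab yab]; first exact: addr_ge0.
rewrite opprD addrACA (le_trans (ler_normD _ _))// mulrDl.
by apply: lerD; [exact: fL|exact: hK].
Qed.

Lemma locally_lipschitz_mul f h : locally_lipschitz f -> locally_lipschitz h ->
  locally_lipschitz (fun x => f x * h x).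
Proof.
move=> lf lh a b; have [L L0 fL] := lf a b; have [K K0 hK] := lh a b.
have [B B0 fB] := locally_lipschitz_bounded a b lf.
have [D D0 hD] := locally_lipschitz_bounded a b lh.
exists (L * D + B * K) => [|x y xab yab]; first by rewrite addr_ge0 // mulr_ge0.
have -> : f x * h x - f y * h y = (f x - f y) * h x + f y * (h x - h y) by ring.
rewrite (le_trans (ler_normD _ _))// !normrM mulrDl; apply: lerD.
  by rewrite mulrAC; apply: ler_pM => //; [exact: fL|exact: hD].
by rewrite -mulrA; apply: ler_pM => //; [exact: fB|exact: hK].
Qed.

Lemma locally_lipschitz_cst (c : R) : locally_lipschitz (fun=> c).
Proof. by move=> a b; exists 0 => // x y _ _; rewrite subrr normr0 mul0r. Qed.

Lemma locally_lipschitz_id : locally_lipschitz (fun x => x).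
Proof. by move=> a b; exists 1 => // x y _ _; rewrite mul1r. Qed.

Lemma locally_lipschitz_opp f : locally_lipschitz f ->
  locally_lipschitz (fun x => - f x).
Proof.
move=> lf a b; have [L L0 fL] := lf a b; exists L => // x y xab yab.
by rewrite -opprD normrN; exact: fL.
Qed.

Lemma locally_lipschitz_max (c : R) : locally_lipschitz (fun x => Num.max x c).
Proof.
move=> a b; exists 1 => // x y _ _; rewrite mul1r.
by case: (leP x c) => h1; case: (leP y c) => h2;
  rewrite ler_norml; apply/andP; split; case: (ger0P (x - y)) => ?; lra.
Qed.

Lemma locally_lipschitz_min (c : R) : locally_lipschitz (fun x => Num.min x c).
Proof.
move=> a b; exists 1 => // x y _ _; rewrite mul1r.
by case: (leP x c) => h1; case: (leP y c) => h2;
  rewrite ler_norml; apply/andP; split; case: (ger0P (x - y)) => ?; lra.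
Qed.

Lemma locally_lipschitz_expr f n : locally_lipschitz f ->
  locally_lipschitz (fun x => f x ^+ n).
Proof.
move=> lf; elim: n => [|n ih].
  by have -> : (fun x => f x ^+ 0) = (fun=> 1) by []; exact: locally_lipschitz_cst.
under eq_fun do rewrite exprS; exact: locally_lipschitz_mul.
Qed.

Lemma locally_lipschitz_expR : locally_lipschitz (@expR R).
Proof.
apply: (@locally_lipschitz_derive _ (@expR R)) => a b.
exists (expR b) => x; rewrite in_itv /= => /andP[_ xb].
by rewrite ger0_norm ?expR_ge0 // ler_expR.
Qed.

Lemma is_derive_expr f x d n : is_derive x 1 f d ->
  is_derive x 1 (fun t => f t ^+ n) (n%:R * f x ^+ n.-1 * d).
Proof.
move=> fx; case: n => [|n].
  by rewrite !mul0r; apply: is_derive_eqf (is_derive_const 1 x) => t; rewrite expr0.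
elim: n => [|n ih]; first by rewrite /= expr0 !mul1r.
have := is_derive_mul fx ih => /= h.
have e : (fun t => f t * f t ^+ n.+1) =1 (fun t => f t ^+ n.+2).
  by move=> t; rewrite -exprS.
have := is_derive_eqf e h.
suff -> : d * f x ^+ n.+1 + f x * (n.+1%:R * f x ^+ n * d) = n.+2%:R * f x ^+ n.+1 * d by [].
by rewrite exprS -[n.+2]addn1 natrD; ring.
Qed.

(** ** Truncation to an interval *)

(** Composing with [clamp a b] freezes a function outside [a, b]: it makes
    test functions bounded without destroying Lipschitz continuity. *)
Definition clamp a b x := Num.min (Num.max x a) b.

Lemma clamp_id a b x : a <= x <= b -> clamp a b x = x.
Proof. by move=> /andP[ax xb]; rewrite /clamp max_l // min_l. Qed.

Lemma clamp_lo a b x : a <= b -> x <= a -> clamp a b x = a.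
Proof. by move=> ab xa; rewrite /clamp max_r // min_l. Qed.

Lemma clamp_hi a b x : a <= b -> b <= x -> clamp a b x = b.
Proof. by move=> ab bx; rewrite /clamp max_l ?(le_trans ab) // min_r. Qed.

Lemma clamp_ge a b x : a <= b -> a <= clamp a b x.
Proof. by move=> ab; rewrite /clamp le_min le_max lexx orbT. Qed.

Lemma clamp_le a b x : clamp a b x <= b.
Proof. by rewrite /clamp ge_min lexx orbT. Qed.

Lemma clamp_homo a b x y : x <= y -> clamp a b x <= clamp a b y.
Proof.
move=> xy; rewrite /clamp le_min ge_min ge_min lexx orbT andbT.
by rewrite ge_max !le_max xy lexx orbT.
Qed.

Lemma locally_lipschitz_clamp a b : locally_lipschitz (clamp a b).
Proof.
exact: (locally_lipschitz_comp (@locally_lipschitz_min b) (@locally_lipschitz_max a)).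
Qed.

Lemma derive1_comp_clamp_in f a b x (d : R) : a < x < b -> is_derive x 1 f d ->
  (fun t => f (clamp a b t))^`()%classic x = d.
Proof.
move=> /andP[ax xb]; apply: near_derive1; near=> t.
rewrite clamp_id //; apply/andP; split; apply/ltW; near: t.
  exact: lt_nbhsr.
exact: lt_nbhsl.
Unshelve. all: by end_near. Qed.

Lemma derive1_comp_clamp_out f a b x : a <= b -> (x < a) || (b < x) ->
  (fun t => f (clamp a b t))^`()%classic x = 0.
Proof.
move=> ab /orP[xa|bx].
  apply: (near_derive1 _ (is_derive_const (f a) x)).
  by near=> t; rewrite clamp_lo //; apply/ltW; near: t; exact: lt_nbhsl.
apply: (near_derive1 _ (is_derive_const (f b) x)).
by near=> t; rewrite clamp_hi //; apply/ltW; near: t; exact: lt_nbhsr.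
Unshelve. all: by end_near. Qed.

Lemma is_derive_near f h x d : (\forall y \near x, f y = h y) ->
  is_derive x 1 h d -> is_derive x 1 f d.
Proof. by move=> fh; apply: near_eq_is_derive; apply: filterS fh. Qed.

(** The exceptional point c is the one where the Stein solution has a corner. *)
Lemma mvt_norm_le_except f df a b c L : a <= b -> continuous f ->
  (forall x, a < x < b -> x != c -> is_derive x 1 f (df x)) ->
  (forall x, a < x < b -> x != c -> `|df x| <= L) ->
  `|f b - f a| <= L * (b - a).
Proof.
move=> ab cf dfE dfL.
have [/andP[ac cb]|out] := boolP (a < c < b); last first.
  apply: (mvt_norm_le ab (df := df)) => [x _|x axb|x axb]; first exact: cf.
    by apply: dfE => //; apply: contraNneq out => <-.
  by apply: dfL => //; apply: contraNneq out => <-.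
have h1 : `|f c - f a| <= L * (c - a).
  apply: (mvt_norm_le (ltW ac) (df := df)) => [x _|x /andP[ax xc]|x /andP[ax xc]]; first exact: cf.
    by apply: dfE; [rewrite ax (lt_trans xc)|rewrite lt_eqF].
  by apply: dfL; [rewrite ax (lt_trans xc)|rewrite lt_eqF].
have h2 : `|f b - f c| <= L * (b - c).
  apply: (mvt_norm_le (ltW cb) (df := df)) => [x _|x /andP[cx xb]|x /andP[cx xb]]; first exact: cf.
    by apply: dfE; [rewrite xb (lt_trans ac)|rewrite gt_eqF].
  by apply: dfL; [rewrite xb (lt_trans ac)|rewrite gt_eqF].
have -> : f b - f a = (f b - f c) + (f c - f a) by rewrite addrA subrK.
by apply: (le_trans (ler_normD _ _)); lra.
Qed.

Lemma is_derive_clamp a b (x : R) : a <= b -> x != a -> x != b ->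
  is_derive x 1 (clamp a b) (a < x < b)%R%:R.
Proof.
move=> ab; rewrite !neq_lt => /orP[xa _|ax].
  rewrite ltNge (ltW xa) /=; apply: is_derive_near (is_derive_const a x).
  by near=> t; rewrite clamp_lo //; apply/ltW; near: t; exact: lt_nbhsl.
move=> /orP[xb|bx].
  rewrite ax xb /=; apply: is_derive_near (is_derive_id x (1 : R)).
  near=> t; rewrite clamp_id //; apply/andP; split; apply/ltW; near: t.
    exact: lt_nbhsr.
  exact: lt_nbhsl.
rewrite [x < b]ltNge (ltW bx) andbF /=; apply: is_derive_near (is_derive_const b x).
by near=> t; rewrite clamp_hi //; apply/ltW; near: t; exact: lt_nbhsr.
Unshelve. all: by end_near. Qed.

End calculus.

(** * The drift g, its primitive G and the density p *)

Section primitive.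
Context (R : realType).
Notation mu := (@lebesgue_measure R).
Implicit Types (f g : R -> R).

Lemma continuous_integrable_itv f a b (sa sb : bool) : continuous f ->
  mu.-integrable [set` Interval (BSide sa a) (BSide sb b)] (EFin \o f).
Proof.
move=> cf; apply: (@integrableS _ _ R mu `[a, b]) => //.
  by apply: subset_itv; [case: sa|case: sb]; rewrite bnd_simp.
apply: continuous_compact_integrable; first exact: segment_compact.
by apply: continuous_subspaceT.
Qed.

Lemma primitive0_shift f a y : continuous f -> a <= 0 -> a <= y ->
  primitive0 f y = \int[mu]_(t in `[a, y]) f t - \int[mu]_(t in `[a, 0]) f t.
Proof.
move=> cf a0 ay; rewrite /primitive0; case: ifPn => [y0|]; last rewrite -ltNge => y0.
- rewrite -Rintegral_itv_obnd_cbnd; last exact: continuous_integrable_itv.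
  by rewrite -(@Rintegral_itvB R f (BLeft a)) ?bnd_simp //; exact: continuous_integrable_itv.
- rewrite -Rintegral_itv_obnd_cbnd; last exact: continuous_integrable_itv.
  rewrite -(@Rintegral_itvB R f (BLeft a)) ?bnd_simp ?(ltW y0) //.
    by rewrite opprB.
  exact: continuous_integrable_itv.
Qed.

Lemma is_derive_primitive0 f (y : R) : continuous f -> is_derive y 1 (primitive0 f) (f y).
Proof.
move=> cf; pose a := Num.min 0 y - 1.
have a0 : a < 0 by rewrite /a; case: (leP 0 y) => ?; lra.
have ay : a < y by rewrite /a; case: (leP 0 y) => ?; lra.
pose F x := \int[mu]_(t in `[a, x]) f t.
have [dF FE] : derivable F y 1 /\ F^`()%classic y = f y.
  apply: (@continuous_FTC1_closed R f a y (y + 1)) => //; first by lra.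
    exact: continuous_integrable_itv.
  exact: cf.
have Fd : is_derive y 1 F (f y) by split; [exact: dF|rewrite -derive1E; exact: FE].
have FdB : is_derive y 1 (fun x => F x - \int[mu]_(t in `[a, 0]) f t) (f y).
  by have := is_derive_sub Fd (is_derive_const (\int[mu]_(t in `[a, 0]) f t) y); rewrite subr0.
apply: near_eq_is_derive FdB; near=> x.
apply/esym/primitive0_shift => //; first exact: ltW.
by apply/ltW; near: x; apply: lt_nbhsr.
Unshelve. all: by end_near. Qed.

Lemma primitive0_0 f : primitive0 f 0 = 0.
Proof. by rewrite /primitive0 lexx set_itv1 Rintegral_set1. Qed.

End primitive.

(* Otherwise unification compares these integrals by unfolding them. *)
#[local] Opaque primitive0.

(** The assumptions on g.  The constants are parameters, so that the order of
    quantifiers expresses which constants a bound may depend on. *)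
Record drift (R : realType) (c1 c2 c3 gmax : R) (g : R -> R) : Prop := Drift {
  drift_derivable : forall y : R, derivable g y 1 ;
  drift_homo : {homo g : x y / x <= y} ;
  drift0 : g 0 = 0 ;
  drift_quasi_add : forall x y, `|g (x + y)| <= c2 * (`|g x| + `|g y| + 1) ;
  drift_derive_le : forall y, `|g^`()%classic y| <= c3 * ((1 + `|g y|) / (1 + `|y|)) ;
  drift_max : Num.max (g 1) `|g (- 1)| = gmax ;
  drift_normalized :
    (\int[@lebesgue_measure R]_y (c1 * expR (- primitive0 g y))%:E = 1)%E }.

Section drift_theory.
Context (R : realType) (c1 c2 c3 gmax : R).
Hypotheses (c1_gt0 : 0 < c1) (c2_gt0 : 0 < c2) (c3_ge1 : 1 <= c3).
Variables (g : R -> R) (dg : drift c1 c2 c3 gmax g).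
Notation mu := (@lebesgue_measure R).
Implicit Types x y a b z : R.

Local Notation G := (primitive0 g).

Lemma drift_is_derive y : is_derive y 1 g (g^`()%classic y).
Proof. by apply: DeriveDef; [exact: (drift_derivable dg)|rewrite derive1E]. Qed.

Lemma drift_continuous : continuous g.
Proof. by move=> y; apply: is_derive_continuous (drift_is_derive y). Qed.

Lemma drift_ge0 y : 0 <= y -> 0 <= g y.
Proof. by move=> /(drift_homo dg); rewrite (drift0 dg). Qed.

Lemma drift_le0 y : y <= 0 -> g y <= 0.
Proof. by move=> /(drift_homo dg); rewrite (drift0 dg). Qed.

Lemma drift_max_ge0 : 0 <= gmax.
Proof. by rewrite -(drift_max dg) le_max normr_ge0 orbT. Qed.

Lemma drift_le_max t : `|t| <= 1 -> `|g t| <= gmax.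
Proof.
rewrite ler_norml => /andP[t1 t2]; rewrite -(drift_max dg) le_max.
have m0 : (-1 : R) <= 0 by lra.
have := drift_homo dg t1; have := drift_homo dg t2 => h1 h2.
rewrite (ler0_norm (drift_le0 m0)).
have [t0|/ltW t0] := leP 0 t.
  by apply/orP; left; rewrite (ger0_norm (drift_ge0 t0)).
by apply/orP; right; rewrite (ler0_norm (drift_le0 t0)) lerN2.
Qed.

(** Steps of length at most 1 preserve g up to constants that depend on c2 and
    gmax only. *)
Lemma drift_shift_le x t : `|t| <= 1 -> `|g (x + t)| <= c2 * (`|g x| + gmax + 1).
Proof.
move=> /drift_le_max gt; apply: (le_trans (drift_quasi_add dg _ _)).
by rewrite ler_pM2l // lerD2r lerD2l.
Qed.

Lemma is_derive_potential y : is_derive y 1 G (g y).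
Proof. exact: is_derive_primitive0 drift_continuous. Qed.

Lemma potential_continuous : continuous G.
Proof. by move=> y; apply: is_derive_continuous (is_derive_potential y). Qed.

Lemma potential0 : G 0 = 0. Proof. exact: primitive0_0. Qed.

Lemma potential_increment_le a b : a <= b -> G b - G a <= g b * (b - a).
Proof.
move=> ab; apply: (mvt_le (f := G) (df := g)) => // [x _|x _|x /andP[_ /ltW xb]].
- exact: potential_continuous.
- exact: is_derive_potential.
- exact: (drift_homo dg).
Qed.

Lemma potential_increment_ge a b : a <= b -> g a * (b - a) <= G b - G a.
Proof.
move=> ab; apply: (mvt_ge (f := G) (df := g)) => // [x _|x _|x /andP[/ltW xb _]].
- exact: potential_continuous.
- exact: is_derive_potential.
- exact: (drift_homo dg).
Qed.

Lemma potential_ge0 y : 0 <= G y.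
Proof.
have [y0|/ltW y0] := leP 0 y.
  by have := potential_increment_ge y0; rewrite potential0 (drift0 dg) mul0r subr0.
by have := potential_increment_le y0; rewrite potential0 (drift0 dg) mul0r sub0r oppr_le0.
Qed.

Lemma potential_homo a b : 0 <= a -> a <= b -> G a <= G b.
Proof.
move=> a0 ab; rewrite -subr_ge0; apply: le_trans (potential_increment_ge ab).
by rewrite mulr_ge0 ?drift_ge0 // subr_ge0.
Qed.

Lemma drift_norm_le a b x : x \in `[a, b] -> `|g x| <= `|g a| + `|g b|.
Proof.
rewrite in_itv /= => /andP[ax xb].
have := drift_homo dg ax; have := drift_homo dg xb.
have := ler_norm (g b); have := ler_norm (- g a); rewrite normrN.
have := normr_ge0 (g a); have := normr_ge0 (g b).
by move=> *; rewrite ler_norml; apply/andP; split; lra.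
Qed.

Lemma drift_derive_norm_le y : `|g^`()%classic y| <= c3 * (1 + `|g y|).
Proof.
apply: (le_trans (drift_derive_le dg y)).
rewrite ler_pM2l; last exact: lt_le_trans c3_ge1.
by rewrite ler_pdivrMr ?ltr_pwDl // ler_peMr ?addr_ge0 // lerDl.
Qed.

Lemma drift_lipschitz : locally_lipschitz g.
Proof.
apply: locally_lipschitz_derive; first exact: drift_is_derive.
move=> a b; exists (c3 * (1 + (`|g a| + `|g b|))) => x xab.
apply: (le_trans (drift_derive_norm_le x)).
rewrite ler_pM2l ?lerD2l; first exact: drift_norm_le.
exact: lt_le_trans c3_ge1.
Qed.

Lemma potential_lipschitz : locally_lipschitz G.
Proof.
apply: locally_lipschitz_derive; first exact: is_derive_potential.
by move=> a b; exists (`|g a| + `|g b|) => x; exact: drift_norm_le.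
Qed.

Definition density y := c1 * expR (- G y).
Local Notation p := density.

Lemma density_gt0 y : 0 < p y. Proof. by rewrite mulr_gt0 // expR_gt0. Qed.
Lemma density_ge0 y : 0 <= p y. Proof. exact/ltW/density_gt0. Qed.
Lemma is_derive_density y : is_derive y 1 p (- g y * p y).
Proof.
have h : is_derive y 1 (fun t => - G t) (- g y).
  by apply: is_deriveN; exact: is_derive_potential.
have := is_derive_mulc c1 (is_derive_expR_comp h).
by rewrite /p mulrCA.
Qed.

Lemma density_continuous : continuous p.
Proof. by move=> y; apply: is_derive_continuous (is_derive_density y). Qed.

Lemma density_anti a b : 0 <= a -> a <= b -> p b <= p a.
Proof. by move=> b0 ab; rewrite /p (ler_pM2l c1_gt0) ler_expR lerN2; exact: potential_homo. Qed.

Lemma measurable_density D : measurable_fun D p.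
Proof.
apply: (measurable_funS measurableT) => //.
exact: continuous_measurable_fun density_continuous.
Qed.

Lemma integrable_density D : measurable D -> mu.-integrable D (EFin \o p).
Proof.
move=> mD; apply: (@integrableS _ _ R mu setT) => //.
apply/integrableP; split; first by apply/measurable_EFinP; exact: measurable_density.
have -> : (\int[mu]_x `|(EFin \o p) x| = \int[mu]_x (p x)%:E)%E.
  by apply: eq_integral => x _; rewrite /= ger0_norm // density_ge0.
by rewrite (drift_normalized dg) ltry.
Qed.

Definition lower_mass y := \int[mu]_(t in `]-oo, y]) p t.
Local Notation A := lower_mass.

Lemma is_derive_lower_mass y : is_derive y 1 A (p y).
Proof.
have [dA AE] : derivable A y 1 /\ A^`()%classic y = p y.
  apply: (@continuous_FTC1 R p -oo%O y (y + 1)) => //; first by lra.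
    exact: integrable_density.
    by rewrite ltNyr.
  exact: density_continuous.
by split; [exact: dA|rewrite -derive1E; exact: AE].
Qed.

Lemma lower_mass_continuous : continuous A.
Proof. by move=> y; apply: is_derive_continuous (is_derive_lower_mass y). Qed.

Lemma lower_mass_homo a b : a <= b -> A a <= A b.
Proof.
move=> ab; rewrite -subr_ge0 -[leLHS](mul0r (b - a)).
apply: (mvt_ge (f := A) (df := p)) => // [x _|x _|x _].
- exact: lower_mass_continuous.
- exact: is_derive_lower_mass.
- exact: density_ge0.
Qed.

Lemma lower_mass_ge0 y : 0 <= A y.
Proof. by apply: Rintegral_ge0 => x _; exact: density_ge0. Qed.

Lemma upper_massE y :
  (\int[mu]_(t in `]y, +oo[) (p t)%:E = (1 - A y)%:E)%E.
Proof.
rewrite EFinB -(drift_normalized dg) /A /Rintegral fineK; last first.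
  by apply: integrable_fin_num => //; exact: integrable_density.
have -> : [set: R] = `]-oo, y] `|` `]y, +oo[.
  by rewrite -setCitvr setvU.
rewrite ge0_integral_setU //=.
- rewrite addeAC subee ?add0e //.
  by apply: integrable_fin_num => //; exact: integrable_density.
- by apply/measurable_EFinP; exact: measurable_density.
- by move=> x _; rewrite lee_fin density_ge0.
- rewrite disj_set2E; apply/eqP; rewrite -setCitvr setICl //.
Qed.

Lemma lower_mass_le1 y : A y <= 1.
Proof.
rewrite -subr_ge0 -lee_fin -upper_massE.
by apply: integral_ge0 => x _; rewrite lee_fin density_ge0.
Qed.

(** The behaviour of A at infinity, which gives the boundary values for the two
    comparisons that follow. *)
Lemma mass_tails e : 0 < e -> exists2 y, 0 <= y & A (- y) <= e /\ 1 - e <= A y.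
Proof.
move=> e0; pose F (n : nat) : set R := `](- n%:R), n%:R]%classic.
have nF : nondecreasing_seq F.
  move=> m n mn; apply/subsetPset; apply: subset_itv; rewrite bnd_simp.
    by rewrite lerN2 ler_nat.
  by rewrite ler_nat.
have mF n : measurable (F n) by exact: measurable_itv.
have mp n : measurable_fun (F n) (EFin \o p).
  by apply/measurable_EFinP; exact: measurable_density.
have p0 n x : F n x -> (0 <= (EFin \o p) x)%E by rewrite lee_fin density_ge0.
have := ge0_nondecreasing_set_cvg_integral (mu := mu) nF mF mp p0.
have -> : \bigcup_i F i = setT by exact: bigcup_itvT.
rewrite (drift_normalized dg).
have -> : (fun i : nat => \int[mu]_(x in F i) (p x)%:E)%E =
    EFin \o (fun i : nat => A i%:R - A (- i%:R)).
  apply/funext => n /=; rewrite /A Rintegral_itvB ?bnd_simp.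
  - by rewrite fineK //; apply: integrable_fin_num => //; exact: integrable_density.
  - exact: integrable_density.
  - by [].
  - by rewrite (@le_trans _ _ 0) // oppr_le0.
move=> /fine_cvgP[_] /cvgrPdist_le /(_ e e0) [n _ /(_ n (leqnn _))] /=.
rewrite ler_norml => /andP[_ h]; exists n%:R => //.
have := lower_mass_ge0 (- n%:R); have := lower_mass_le1 n%:R; split; lra.
Qed.

#[local] Opaque lower_mass.

(** For fixed w <= 0 the function - g(w) A - p is nonincreasing on (-oo, w],
    its derivative at t being (g(t) - g(w)) p(t), and its limit at -oo is
    nonpositive.  The next lemma is the mirror image. *)
Lemma lower_mass_drift_le w : w <= 0 -> A w * `|g w| <= p w.
Proof.
move=> w0; rewrite ler0_norm ?drift_le0 //.
suff h x : x <= w -> A w * - g w - p w <= A x * - g w - p x.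
  rewrite -subr_le0; apply/ler_addgt0Pr => e e0; rewrite add0r.
  have g1 : 0 < 1 - g w by have := drift_le0 w0; lra.
  have [y y0 [yA _]] := mass_tails (divr_gt0 e0 g1).
  have yw : Num.min (- y) w <= w by rewrite ge_min lexx orbT.
  apply: (le_trans (h _ yw)).
  have := density_ge0 (Num.min (- y) w) => p0.
  have A1 : A (Num.min (- y) w) <= e / (1 - g w).
    by apply: le_trans yA; apply: lower_mass_homo; rewrite ge_min lexx.
  have A2 : A (Num.min (- y) w) * (1 - g w) <= e.
    by rewrite -ler_pdivlMr.
  have := lower_mass_ge0 (Num.min (- y) w); nra.
move=> xw; rewrite -subr_le0.
have -> : A w * - g w - p w - (A x * - g w - p x) =
  (fun t => A t * - g w - p t) w - (fun t => A t * - g w - p t) x by [].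
rewrite -[leRHS](mul0r (w - x)).
have D (t : R) : is_derive t 1 (fun t => A t * - g w - p t) (p t * - g w - - g t * p t).
  apply: is_derive_sub; last exact: is_derive_density.
  have := is_derive_mul (is_derive_lower_mass t) (is_derive_const (- g w) t).
  by rewrite mulr0 addr0.
apply: (mvt_le (f := fun t => A t * - g w - p t) (df := fun t => p t * - g w - - g t * p t)) => // [t _|t /andP[_ /ltW tw]].
  exact: is_derive_continuous (D t).
have := drift_homo dg tw; have := density_ge0 t; nra.
Qed.

Lemma upper_mass_drift_le w : 0 <= w -> (1 - A w) * g w <= p w.
Proof.
move=> w0.
suff h x : w <= x -> (1 - A w) * g w - p w <= (1 - A x) * g w - p x.
  rewrite -subr_le0; apply/ler_addgt0Pr => e e0; rewrite add0r.
  have g1 : 0 < 1 + g w by have := drift_ge0 w0; lra.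
  have [y y0 [_ yA]] := mass_tails (divr_gt0 e0 g1).
  have yw : w <= Num.max y w by rewrite le_max lexx orbT.
  apply: (le_trans (h _ yw)).
  have := density_ge0 (Num.max y w) => p0.
  have A1 : 1 - A (Num.max y w) <= e / (1 + g w).
    suff : A y <= A (Num.max y w) by lra.
    by apply: lower_mass_homo; rewrite le_max lexx.
  have A2 : (1 - A (Num.max y w)) * (1 + g w) <= e.
    by rewrite -ler_pdivlMr.
  have := lower_mass_le1 (Num.max y w); nra.
move=> xw; rewrite -subr_ge0.
have -> : (1 - A x) * g w - p x - ((1 - A w) * g w - p w) =
  (fun t => (1 - A t) * g w - p t) x - (fun t => (1 - A t) * g w - p t) w by [].
rewrite -[leLHS](mul0r (x - w)).
have D (t : R) : is_derive t 1 (fun t => (1 - A t) * g w - p t) (- p t * g w - - g t * p t).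
  apply: is_derive_sub; last exact: is_derive_density.
  have h : is_derive t 1 (fun t => 1 - A t) (- p t).
    by have := is_derive_sub (is_derive_const 1 t) (is_derive_lower_mass t); rewrite sub0r.
  have := is_derive_mul h (is_derive_const (g w) t).
  by rewrite mulr0 addr0.
apply: (mvt_ge (f := fun t => (1 - A t) * g w - p t) (df := fun t => - p t * g w - - g t * p t)) => // [t _|t /andP[/ltW tw _]].
  exact: is_derive_continuous (D t).
have := drift_homo dg tw; have := density_ge0 t; nra.
Qed.

Lemma drift_step_le w t : 0 <= w -> 0 <= t ->
  g (w + t) <= g w + t * (c3 * (1 + g (w + t))).
Proof.
move=> w0 t0; have wt : w <= w + t by rewrite lerDl.
rewrite -lerBlDl [t * _]mulrC -[X in _ <= _ * X](addKr w t) [- w + _]addrC.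
apply: (mvt_le (f := g) (df := fun x => g^`()%classic x)) => // [x _|x _|x /andP[/ltW wx /ltW xt]].
- exact: drift_continuous.
- exact: drift_is_derive.
apply: (le_trans (ler_norm _)); apply: (le_trans (drift_derive_le dg _)).
have x0 : 0 <= x by apply: le_trans wx.
rewrite ler_pM2l; last by apply: lt_le_trans c3_ge1.
rewrite !ger0_norm ?drift_ge0 // ler_pdivrMr; last by lra.
have := drift_homo dg xt; have := drift_ge0 x0; nra.
Qed.

(** A point M, depending on c1 only, from which on g is bounded below by
    1 / M; the factor e is what the argument of [drift_crossover] asks for. *)
Definition crossover := Num.max (expR 1 / c1) 1.
Local Notation M := crossover.

Lemma crossover_ge1 : 1 <= M. Proof. by rewrite le_max lexx orbT. Qed.

Lemma crossover_ge : expR 1 / c1 <= M. Proof. by rewrite le_max lexx. Qed.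

#[local] Opaque crossover.

(** As p decreases on [0, M] and has mass at most 1 there, M p(M) <= 1.  But
    G(M) <= M g(M), so M p(M) >= c1 M e^(- M g(M)) >= e^(1 - M g(M)). *)
Lemma drift_crossover : M^-1 <= g M.
Proof.
have M1 := crossover_ge1.
have M0 : 0 < M by apply: lt_le_trans M1.
rewrite -[leLHS]mul1r ler_pdivrMr //.
have h1 : p M * M <= 1.
  have : p M * (M - 0) <= A M - A 0.
    apply: (mvt_ge (f := A) (df := p) (ltW M0)).
    - by move=> x _; exact: lower_mass_continuous.
    - by move=> x _; exact: is_derive_lower_mass.
    - by move=> x /andP[/ltW x0 /ltW xM]; exact: density_anti.
  have := lower_mass_le1 M; have := lower_mass_ge0 0; rewrite subr0; lra.
have h2 : expR (- (g M * M)) <= expR (- G M).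
  have := potential_increment_le (ltW M0).
  by rewrite potential0 !subr0 ler_expR lerN2.
have h3 : expR 1 <= c1 * M.
  by rewrite mulrC -ler_pdivrMr //; exact: crossover_ge.
have h4 : expR 1 * expR (- (g M * M)) <= 1.
  apply: le_trans h1; rewrite /p mulrAC; apply: ler_pM => //; exact: expR_ge0.
by move: h4; rewrite -expRD -[X in _ <= X]expR0 ler_expR subr_le0.
Qed.

Lemma drift_ge_crossover w : M <= w -> M^-1 <= g w.
Proof. by move=> /(drift_homo dg); apply: le_trans; exact: drift_crossover. Qed.

(** The lower half of Mills' ratio: over an interval of length 1 / (1 + g(z))
    to the right of z, G increases by at most a constant. *)
Lemma upper_mass_ge z : 0 <= z ->
  c1 * expR (- (c2 * (gmax + 1))) * (expR (- G z) / (1 + g z)) <= 1 - A z.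
Proof.
move=> z0; have gz := drift_ge0 z0; have gm := drift_max_ge0.
have g1 : 0 < 1 + g z by lra.
pose h := (1 + g z)^-1.
have h0 : 0 < h by rewrite invr_gt0.
have h1 : h <= 1 by rewrite invf_le1 //; lra.
have zh : z <= z + h by lra.
have : p (z + h) * (z + h - z) <= A (z + h) - A z.
  apply: (mvt_ge (f := A) (df := p) zh).
  - by move=> x _; exact: lower_mass_continuous.
  - by move=> x _; exact: is_derive_lower_mass.
  - by move=> x /andP[/ltW zx /ltW xM]; apply: density_anti => //; exact: le_trans zx.
have := lower_mass_le1 (z + h).
suff : c1 * expR (- (c2 * (gmax + 1))) * (expR (- G z) / (1 + g z)) <= p (z + h) * (z + h - z) by lra.
have -> : z + h - z = h by rewrite addrAC subrr add0r.
rewrite mulrA -/h; apply: ler_wpM2r; first exact: ltW.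
rewrite /p -mulrA -expRD (ler_pM2l c1_gt0) ler_expR.
have := potential_increment_le zh; rewrite [z + h - z]addrAC subrr add0r => hG.
suff : g (z + h) * h <= c2 * (gmax + 1) by lra.
have := @drift_shift_le z h; rewrite (ger0_norm (ltW h0)) (ger0_norm gz) => /(_ h1) hh.
have hle : g (z + h) <= c2 * (g z + gmax + 1) by apply: le_trans hh; exact: ler_norm.
apply: (@le_trans _ _ (c2 * (g z + gmax + 1) * h)); first by rewrite ler_pM2r.
rewrite -mulrA ler_pM2l // ler_pdivrMr //; nra.
Qed.

End drift_theory.

Lemma drift_bounded (R : realType) (c2 gmax : R) (hc2 : 0 < c2) (X : R) :
  exists2 C, 0 <= C & forall c1 c3 g, drift c1 c2 c3 gmax g ->
  forall y, y <= X -> g y <= C.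
Proof.
suff h (n : nat) : exists2 C, 0 <= C & forall c1 c3 g, drift c1 c2 c3 gmax g ->
    g n%:R <= C.
  have [C C0 gC] := h (Num.truncn X).+1; exists C => // c1 c3 g dg y yX.
  apply: le_trans (gC _ _ _ dg); apply: (drift_homo dg); apply: (le_trans yX).
  exact/ltW/truncnS_gt.
elim: n => [|n [C C0 gC]].
  by exists 0 => // c1 c3 g dg; rewrite (drift0 dg).
exists (c2 * (C + Num.max gmax 0 + 1)).
  by rewrite mulr_ge0 ?addr_ge0 ?le_max ?lexx ?orbT // ltW.
move=> c1 c3 g dg; rewrite -natr1.
have := @drift_shift_le _ _ _ _ _ hc2 _ dg n%:R 1.
rewrite normr1 => /(_ (lexx _)) h; apply: (le_trans (ler_norm _)); apply: (le_trans h).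
rewrite ler_pM2l // lerD2r; apply: lerD; last by rewrite le_max lexx.
by rewrite ger0_norm; [exact: gC dg|exact: (drift_ge0 dg)].
Qed.

(** * Expectations of functions of W *)

Section conditioning.
Context (d : measure_display) (T : measurableType d) (R : realType).
Variables (P : probability T R) (W : {RV P >-> R}).
Local Open Scope ereal_scope.
Import HBNNSimple.

(** Integrating the approximations of h by simple functions reduces
    E h(W) X to the expectations of X over events in the sigma-algebra of W. *)
Lemma integral_comp_mul_lim (k : T -> R) (h : R -> R)
    (mh : measurable_fun setT (EFin \o h)) :
  measurable_fun setT k -> (forall x, 0 <= k x)%R -> (forall x, 0 <= h x)%R ->
  let h_ := nnsfun_approx measurableT mh in
  \int[P]_x (h (W x) * k x)%:E =
  limn (fun n => \sum_(y \in range (h_ n))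
    (y%:E * \int[P]_(x in W @^-1` (h_ n @^-1` [set y])) (k x)%:E)).
Proof.
move=> mk k0 h0 h_.
have mW : measurable_fun setT W by exact: measurable_funPT.
have -> : \int[P]_x (h (W x) * k x)%:E =
    limn (fun n => \int[P]_x (h_ n (W x) * k x)%:E).
  have fE x : (h (W x) * k x)%:E = limn (fun n => (h_ n (W x) * k x)%:E).
    apply/esym/cvg_lim => //.
    have -> : (fun n => (h_ n (W x) * k x)%:E) = (fun n => (h_ n (W x))%:E * (k x)%:E).
      by apply/funext => n; rewrite EFinM.
    rewrite EFinM; apply: cvgeZr => //.
    by apply: (@cvg_nnsfun_approx _ _ _ setT _ (EFin \o h) mh) => // y _; rewrite lee_fin h0.
  rewrite (eq_integral (fun x => limn (fun n => (h_ n (W x) * k x)%:E))); last first.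
    by move=> x _; exact: fE.
  apply: monotone_convergence => //.
  - move=> n; apply/measurable_EFinP; apply: measurable_funM => //.
    by apply: measurableT_comp => //.
  - by move=> n x _ /=; rewrite lee_fin mulr_ge0.
  - move=> x _ a b ab; rewrite lee_fin ler_wpM2r //.
    by exact/lefP/(@nd_nnsfun_approx _ _ _ setT measurableT _ mh).
congr (limn _); apply/funext => n.
have E x : (h_ n (W x) * k x)%:E = \sum_(y \in range (h_ n))
    (y * \1_(h_ n @^-1` [set y]) (W x))%:E * (k x)%:E.
  rewrite -ge0_mule_fsuml => [|y]; last exact: nnfun_muleindic_ge0.
  by rewrite fsumEFin // -(fimfunE _ (W x)) EFinM.
rewrite (eq_integral (fun x => \sum_(y \in range (h_ n))
    (y * \1_(h_ n @^-1` [set y]) (W x))%:E * (k x)%:E)); last first.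
  by move=> x _; exact: E.
have mi y : measurable_fun setT (fun x => (y * \1_(h_ n @^-1` [set y]) (W x))%R).
  apply: measurable_funM => //; apply: measurableT_comp => //.
rewrite ge0_integral_fsum//; last 2 first.
  - move=> y; apply: emeasurable_funM => //; exact/measurable_EFinP.
  - by move=> y x _; rewrite mule_ge0 ?lee_fin// ; have := nnfun_muleindic_ge0 (h_ n) y (W x); rewrite lee_fin.
apply: eq_fsbigr => y /set_mem/= [r _ yE]; rewrite -{}yE.
set S := W @^-1` _.
have mS : measurable S by apply: measurable_funPTI; exact: measurable_funPTI.
have mk' : measurable_fun setT ((fun x => (k x)%:E) \_ S).
  apply/(measurable_restrictT _ mS).1.
  by apply/measurable_EFinP; exact: measurable_funTS.
have k'0 x : 0 <= ((fun x => (k x)%:E) \_ S) x.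
  by apply: erestrict_ge0 => t _; rewrite lee_fin.
rewrite [X in _ = _ * X]integral_mkcond -ge0_integralZl_EFin //.
apply: eq_integral => x _.
rewrite EFinM -muleA; congr (_ * _); rewrite patchE indicE.
have -> : (x \in S) = (W x \in h_ n @^-1` [set h_ n r]).
  by apply/idP/idP; rewrite !inE.
by case: (_ \in _); rewrite ?mul1e ?mul0e.
Qed.

Lemma integral_comp_mul_eq (k1 k2 : T -> R) (h : R -> R) :
  measurable_fun setT h -> (forall x, 0 <= h x)%R ->
  measurable_fun setT k1 -> (forall x, 0 <= k1 x)%R ->
  measurable_fun setT k2 -> (forall x, 0 <= k2 x)%R ->
  (forall B, measurable B ->
    \int[P]_(x in W @^-1` B) (k1 x)%:E = \int[P]_(x in W @^-1` B) (k2 x)%:E) ->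
  \int[P]_x (h (W x) * k1 x)%:E = \int[P]_x (h (W x) * k2 x)%:E.
Proof.
move=> mh h0 mk1 k10 mk2 k20 kk.
have mEh : measurable_fun setT (EFin \o h) by exact/measurable_EFinP.
rewrite (integral_comp_mul_lim mEh) // (integral_comp_mul_lim mEh) //.
congr (limn _); apply/funext => n; apply: eq_fsbigr => y _; rewrite kk //.
Qed.

End conditioning.

Section almost_everywhere.
Context (d : measure_display) (T : measurableType d) (R : realType).
Variable (mu : {measure set T -> \bar R}).
Implicit Types (D : set T) (X Y : T -> R).

Lemma ae_and (A B : T -> Prop) :
  {ae mu, forall x, A x} -> {ae mu, forall x, B x} ->
  {ae mu, forall x, A x /\ B x}.
Proof. by move=> hA hB; apply: filterS2 hA hB => x. Qed.

Lemma ae_imp (A B : T -> Prop) : (forall x, A x -> B x) ->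
  {ae mu, forall x, A x} -> {ae mu, forall x, B x}.
Proof. by move=> AB; apply: filterS. Qed.

Lemma ae_le_integrable D X Y : measurable D -> measurable_fun D X ->
  mu.-integrable D (EFin \o Y) ->
  {ae mu, forall x, D x -> `|X x| <= Y x} -> mu.-integrable D (EFin \o X).
Proof.
move=> mD mX iY XY; apply/integrableP; split; first exact/measurable_EFinP.
have [mY lY] := integrableP _ _ _ iY.
apply: le_lt_trans lY; apply: ae_ge0_le_integral => //.
- apply: measurableT_comp => //; exact/measurable_EFinP.
- exact: measurableT_comp.
- apply: filterS XY => x h Dx; have {}h := h Dx.
  by rewrite /= lee_fin (le_trans h)// ler_norm.
Qed.

Lemma integrable_mulc D X (c : R) : measurable D -> mu.-integrable D (EFin \o X) ->
  mu.-integrable D (EFin \o (fun x => c * X x)).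
Proof. by move=> mD iX; have := integrableZl mD c iX; exact. Qed.

Lemma Rintegral_ae_eq D X Y : measurable D ->
  measurable_fun D X -> measurable_fun D Y ->
  {ae mu, forall x, D x -> X x = Y x} ->
  \int[mu]_(x in D) X x = \int[mu]_(x in D) Y x.
Proof.
move=> mD mX mY XY; congr fine; apply: ae_eq_integral => //.
- exact/measurable_EFinP.
- exact/measurable_EFinP.
- by apply: filterS XY => x h Dx; rewrite h.
Qed.

Lemma ae_le_Rintegral D X Y : measurable D ->
  mu.-integrable D (EFin \o X) -> mu.-integrable D (EFin \o Y) ->
  {ae mu, forall x, D x -> X x <= Y x} ->
  \int[mu]_(x in D) X x <= \int[mu]_(x in D) Y x.
Proof.
move=> mD iX iY XY; rewrite -subr_ge0 -RintegralB //.
have mX := measurable_int _ iX; have mY := measurable_int _ iY.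
have mYX : measurable_fun D (fun x => Y x - X x).
  by apply: measurable_funB; exact/measurable_EFinP.
rewrite (@Rintegral_ae_eq _ _ (fun x => Num.max (Y x - X x) 0)) //.
- by apply: Rintegral_ge0 => x _; rewrite le_max lexx orbT.
- by apply: measurable_maxr.
- by apply: filterS XY => x h Dx; rewrite max_l // subr_ge0 h.
Qed.

End almost_everywhere.

Section bounded_observables.
Context (R : realType) (g : R -> R) (delta d1 : R).

(** Since delta |g(W)| <= d1 almost surely, boundedness on this set is enough
    for h(W) to be integrable; g itself is an observable, although
    unbounded. *)
Definition observable (h : R -> R) := measurable_fun setT h /\
  exists B, forall w, delta * `|g w| <= d1 -> `|h w| <= B.

Lemma observable_cst c : observable (fun=> c).
Proof. by split => //; exists `|c|. Qed.

Lemma observableD h k : observable h -> observable k ->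
  observable (fun w => h w + k w).
Proof.
move=> [mh [B hB]] [mk [C kC]]; split; first exact: measurable_funD.
exists (B + C) => w sw; rewrite (le_trans (ler_normD _ _)) // lerD //.
  exact: hB.
exact: kC.
Qed.

Lemma observableM h k : observable h -> observable k ->
  observable (fun w => h w * k w).
Proof.
move=> [mh [B hB]] [mk [C kC]]; split; first exact: measurable_funM.
exists (B * C) => w sw; rewrite normrM ler_pM //.
  exact: hB.
exact: kC.
Qed.

Lemma observableN h : observable h -> observable (fun w => - h w).
Proof.
move=> [mh [B hB]]; split; first exact: measurable_funN.
by exists B => w sw; rewrite normrN; exact: hB.
Qed.

Lemma observableB h k : observable h -> observable k ->
  observable (fun w => h w - k w).
Proof. by move=> oh ok; apply: observableD => //; exact: observableN. Qed.

Lemma observable_norm h : observable h -> observable (fun w => `|h w|).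
Proof.
move=> [mh [B hB]]; split; first exact: measurableT_comp.
by exists B => w sw; rewrite normr_id; exact: hB.
Qed.

Lemma observable_max h k : observable h -> observable k ->
  observable (fun w => Num.max (h w) (k w)).
Proof.
move=> oh ok.
have -> : (fun w => Num.max (h w) (k w)) =
    (fun w => 2^-1 * (h w + k w + `|h w - k w|)).
  apply/funext => w; case: (leP (h w) (k w)) => hk.
    by rewrite ler0_norm ?subr_le0 //; lra.
  by rewrite ger0_norm ?subr_ge0 1?ltW //; lra.
apply: observableM; first exact: observable_cst.
by apply: observableD; [exact: observableD|apply/observable_norm/observableB].
Qed.

End bounded_observables.

Section certificate.
Context (d : measure_display) (T : measurableType d) (R : realType).
Variables (P : probability T R) (W : {RV P >-> R}) (delta : R).
Variables (K : T -> R -> R) (g r : R -> R) (EK1 : T -> \bar R).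
Variables (d0 d1 tau1 tau2 alpha delta1 delta2 : R).
Hypothesis cg : continuous g.
Hypothesis K_measurable :
  measurable_fun ([set: T] `*` `[- delta, delta]) (fun x : T * R => K x.1 x.2).
Hypothesis K_ge0 :
  {ae P, forall w, forall t, t \in `[- delta, delta] -> 0 <= K w t}.
Hypothesis W_identity : stein_identity W delta K g r.
Hypothesis EK1_cond : is_cond_expectation W (khat1 delta K) EK1.
Hypothesis EK1_near1 : {ae P, forall w,
  (`|EK1 w - 1| <= (delta1 * (`|g (W w)| `^ tau1 + 1))%:E)%E}.
Hypothesis r_small : {ae P, forall w,
  `|r (W w)| <= delta2 * (`|g (W w)| `^ tau2 + 1)}.
Hypothesis EK1_bound : {ae P, forall w, (EK1 w <= d0%:E)%E}.
Hypothesis delta_g_bound : {ae P, forall w, delta * `|g (W w)| <= d1}.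
Hypothesis r_bound : {ae P, forall w, `|r (W w)| <= alpha * (`|g (W w)| + 1)}.

Local Notation mu := (@lebesgue_measure R).
Let I : set R := `[- delta, delta]%classic.

Let mW : measurable_fun setT W. Proof. exact: measurable_funPT. Qed.

Lemma measurable_khat1 : measurable_fun setT (khat1 delta K).
Proof.
have mI : measurable I by exact: measurable_itv.
have mD : measurable ([set: T] `*` I) by exact: measurableX.
pose f (x : T * R) : \bar R := (K x.1 x.2)%:E.
have mf : measurable_fun ([set: T] `*` I) f by exact/measurable_EFinP.
have pos (h : T * R -> \bar R) : measurable_fun ([set: T] `*` I) h ->
    (forall x, (0 <= h x)%E) ->
    measurable_fun setT (fun w => \int[mu]_(t in I) h (w, t))%E.
  move=> mh h0.
  have -> : (fun w => \int[mu]_(t in I) h (w, t))%E =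
      fubini_F mu (h \_ ([set: T] `*` I)).
    apply/funext => w; rewrite /fubini_F [LHS]integral_mkcond; apply: eq_integral => t _.
    rewrite !patchE; have -> // : ((w, t) \in [set: T] `*` I) = (t \in I).
    by apply/idP/idP; rewrite !inE //= => -[].
  apply: measurable_fun_fubini_tonelli_F.
  - have := (measurable_restrictT h mD).1 mh; apply.
  - by move=> x; apply: erestrict_ge0 => t _.
have -> : khat1 delta K = (fun w => (\int[mu]_(t in I) (f^\+ (w, t))) -
    (\int[mu]_(t in I) (f^\- (w, t))))%E.
  apply/funext => w; rewrite /khat1 integralE; congr (_ - _)%E.
  - by apply: eq_integral => t _; rewrite !funeposE.
  - by apply: eq_integral => t _; rewrite !funenegE.
by apply: emeasurable_funB; apply: pos => //; [exact: measurable_funepos|exact: measurable_funeneg].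
Qed.

Lemma khat1_ge0 : {ae P, forall w, (0 <= khat1 delta K w)%E}.
Proof.
apply: filterS K_ge0 => w Kw; apply: integral_ge0 => t tI.
by rewrite lee_fin; apply: Kw; rewrite inE in tI *.
Qed.

Lemma measurable_EK1 : measurable_fun setT EK1.
Proof.
move=> _ B mB; rewrite setTI; have [] := EK1_cond.1 _ mB => C mC <-.
by rewrite setTI; exact: measurable_funPTI.
Qed.

Let mg : measurable_fun setT g. Proof. exact: continuous_measurable_fun. Qed.

Lemma observable_drift : 0 < delta -> observable g delta d1 g.
Proof.
move=> dl; split => //; exists (d1 / delta) => w.
by rewrite ler_pdivlMr // mulrC.
Qed.

Let mPow tau : measurable_fun setT (fun w => `|g w| `^ tau).
Proof. by apply: (measurableT_comp (measurable_powR tau)); exact: measurableT_comp. Qed.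

Lemma observable_powR tau : 0 < delta -> 0 <= tau ->
  observable g delta d1 (fun w => `|g w| `^ tau).
Proof.
move=> dl tau0; split => //; exists ((d1 / delta) `^ tau) => w h.
have d10 : 0 <= d1 by apply: le_trans h; rewrite mulr_ge0 // ltW.
rewrite ger0_norm ?powR_ge0 // ge0_ler_powR // ?nnegrE //.
  by rewrite divr_ge0 // ltW.
by rewrite ler_pdivlMr // mulrC.
Qed.

Definition expect (h : R -> R) : R := \int[P]_w h (W w).

Lemma observable_ae (h : R -> R) : observable g delta d1 h ->
  exists B, {ae P, forall w, `|h (W w)| <= B}.
Proof. by move=> [mh [B hB]]; exists B; apply: filterS delta_g_bound => w /hB. Qed.

Lemma observable_integrable (h : R -> R) : observable g delta d1 h ->
  P.-integrable setT (EFin \o (fun w => h (W w))).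
Proof.
move=> oh; have [B hB] := observable_ae oh.
apply: (@ae_le_integrable _ _ _ _ _ _ (fun=> B)) => //.
- by apply: measurableT_comp => //; case: oh.
- exact: finite_measure_integrable_cst.
- by apply: filterS hB => w hw _.
Qed.

Let k2 w := fine (EK1 w).

Lemma fine_EK1_measurable : measurable_fun setT k2.
Proof. by apply: measurableT_comp => //; exact: measurable_EK1. Qed.

Lemma fine_EK1_ae : 0 < delta -> 0 <= tau1 -> exists2 B, 0 <= B & {ae P, forall w,
  [/\ EK1 w = (k2 w)%:E, `|k2 w| <= B, k2 w <= d0 &
      `|k2 w - 1| <= delta1 * (`|g (W w)| `^ tau1 + 1)]}.
Proof.
move=> dl t1.
have [B hB] := observable_ae (observableM (observable_cst g delta d1 delta1)
  (observableD (observable_powR dl t1) (observable_cst g delta d1 1))).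
exists (1 + `|B|); first by rewrite addr_ge0.
apply: ae_imp (ae_and hB (ae_and EK1_near1 EK1_bound)) => w [{}hB [h1 h2]].
have fk : EK1 w = (k2 w)%:E.
  rewrite /k2 fineK //; move: h1 h2; case: (EK1 w) => //=.
have h1' : `|k2 w - 1| <= delta1 * (`|g (W w)| `^ tau1 + 1).
  by move: h1; rewrite fk -EFinB /= lee_fin.
split => //; last by move: h2; rewrite fk lee_fin.
rewrite -[k2 w](subrK 1) addrC (le_trans (ler_normD _ _)) // normr1 lerD2l.
by apply: (le_trans h1'); apply: le_trans (ler_norm _) _; apply: (le_trans hB); exact: ler_norm.
Qed.

Let k1 w := fine (khat1 delta K w).

Hypotheses (dl : 0 < delta) (t1 : 0 <= tau1).

Let mEK1 := measurable_EK1.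
Let mK1 := measurable_khat1.

Lemma EK1_integrable : P.-integrable setT EK1.
Proof.
have [B B0 hB] := fine_EK1_ae dl t1.
apply/integrableP; split => //.
apply: (@le_lt_trans _ _ (\int[P]_w B%:E)%E); last first.
  by rewrite integral_cst //= probability_setT mule1 ltry.
apply: ae_ge0_le_integral => //; first exact: measurableT_comp.
by apply: ae_imp hB => w [-> kB _ _] _; rewrite /= lee_fin.
Qed.

Lemma khat1_integrable : P.-integrable setT (khat1 delta K).
Proof.
apply/integrableP; split => //.
have E : (\int[P]_w `|khat1 delta K w| = \int[P]_w khat1 delta K w)%E.
  apply: ae_eq_integral => //; first exact: measurableT_comp.
  by apply: ae_imp khat1_ge0 => w h _; rewrite gee0_abs.
rewrite E -EK1_cond.2; last by exists setT => //; rewrite setTI preimage_setT.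
have := integrable_fin_num measurableT EK1_integrable.
by rewrite fin_numE => /andP[_ ?]; rewrite ltey.
Qed.

Lemma fine_khat1_measurable : measurable_fun setT k1.
Proof. exact: measurableT_comp. Qed.

Lemma fine_khat1_ae : {ae P, forall w, khat1 delta K w = (k1 w)%:E /\ 0 <= k1 w}.
Proof.
apply: ae_imp (ae_and khat1_ge0 (integrable_ae measurableT khat1_integrable)) => w [h0 hf].
by rewrite /k1 fineK ?hf //; split => //; apply: fine_ge0.
Qed.

Lemma fine_khat1_integrable : P.-integrable setT (EFin \o k1).
Proof.
apply/integrableP; split; first exact/measurable_EFinP/fine_khat1_measurable.
have [_] := integrableP _ _ _ khat1_integrable.
apply: le_lt_trans; apply: ae_ge0_le_integral => //.
- apply: measurableT_comp => //; exact/measurable_EFinP/fine_khat1_measurable.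
- exact: measurableT_comp.
- by apply: ae_imp fine_khat1_ae => w [-> _] _.
Qed.

Lemma fine_EK1_integrable : P.-integrable setT (EFin \o k2).
Proof.
have [B B0 hB] := fine_EK1_ae dl t1.
apply: (@ae_le_integrable _ _ _ _ _ _ (fun=> B)) => //.
- exact: fine_EK1_measurable.
- exact: finite_measure_integrable_cst.
- by apply: ae_imp hB => w [_ ? _ _] _.
Qed.

Lemma observable_mul_integrable (h : R -> R) (k : T -> R) :
  observable g delta d1 h -> P.-integrable setT (EFin \o k) ->
  P.-integrable setT (EFin \o (fun w => h (W w) * k w)).
Proof.
move=> oh ik; have [B hB] := observable_ae oh; have [mh _] := oh.
have mk : measurable_fun setT k by apply/measurable_EFinP/(measurable_int _ ik).
apply: (@ae_le_integrable _ _ _ _ _ _ (fun w => `|B| * `|k w|)) => //.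
- by apply: measurable_funM => //; exact: measurableT_comp.
- by have := integrableZl measurableT `|B| (integrable_norm ik); exact.
- apply: ae_imp hB => w hw _; rewrite normrM ler_wpM2r //.
  exact: le_trans hw (ler_norm _).
Qed.

(** Conditional expectations are compared through nonnegative integrands, so
    both variables are shifted by a bound B of E(K1 | W) and truncated at 0,
    which changes them on a null set only. *)
Lemma expect_mul_khat1_ge0 (h : R -> R) : observable g delta d1 h ->
  (forall x, 0 <= h x) ->
  \int[P]_w (h (W w) * k1 w) = \int[P]_w (h (W w) * k2 w).
Proof.
move=> oh h0; have [B B0 hB] := fine_EK1_ae dl t1; have [mh _] := oh.
pose k1' w := Num.max (k1 w + B) 0; pose k2' w := Num.max (k2 w + B) 0.
have mk1 := fine_khat1_measurable; have mk2 := fine_EK1_measurable.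
have mk1' : measurable_fun setT k1'.
  by apply: measurable_maxr => //; exact: measurable_funD.
have mk2' : measurable_fun setT k2'.
  by apply: measurable_maxr => //; exact: measurable_funD.
have e1 : {ae P, forall w, khat1 delta K w = (k1 w)%:E /\ k1' w = k1 w + B}.
  apply: ae_imp fine_khat1_ae => w [-> k0]; split => //.
  by rewrite /k1' max_l // addr_ge0.
have e2 : {ae P, forall w, EK1 w = (k2 w)%:E /\ k2' w = k2 w + B}.
  apply: ae_imp hB => w [-> k0 _ _]; split => //.
  by rewrite /k2' max_l // -lerBlDr sub0r; move: k0; rewrite ler_norml => /andP[].
have ib C : measurable C -> P.-integrable C (EFin \o (fun=> B)).
  by move=> mC; exact: finite_measure_integrable_cst.
have AI C (X Y : T -> \bar R) (x y : T -> R) : measurable C ->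
    measurable_fun setT y -> P.-integrable setT X ->
    {ae P, forall w, X w = (x w)%:E /\ y w = x w + B} ->
    (\int[P]_(w in C) (y w)%:E = \int[P]_(w in C) X w + \int[P]_(w in C) B%:E)%E.
  move=> mC my iX xy; have mX := measurable_int _ iX.
  rewrite -integralD //=; last 2 first.
  - exact: integrableS iX.
  - exact: ib.
  apply: ae_eq_integral => //.
  - by apply/measurable_EFinP; exact: measurable_funTS.
  - by apply: emeasurable_funD => //; exact: measurable_funTS.
  - by apply: ae_imp xy => w [-> ->] _.
have H : (\int[P]_w (h (W w) * k1' w)%:E = \int[P]_w (h (W w) * k2' w)%:E)%E.
  apply: integral_comp_mul_eq => //.
  - by move=> w; rewrite le_max lexx orbT.
  - by move=> w; rewrite le_max lexx orbT.
  move=> C mC; have mWC : measurable (W @^-1` C) by exact: measurable_funPTI.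
  rewrite (AI _ (khat1 delta K) _ k1 k1') //; last exact: khat1_integrable.
  rewrite (AI _ EK1 _ k2 k2') //; last exact: EK1_integrable.
  by rewrite EK1_cond.2 //; exists C => //; rewrite setTI.
have ih := observable_integrable oh.
have F (x y : T -> R) : measurable_fun setT y -> measurable_fun setT x ->
    P.-integrable setT (EFin \o x) -> {ae P, forall w, y w = x w + B} ->
    \int[P]_w (h (W w) * y w) = \int[P]_w (h (W w) * x w) + \int[P]_w (h (W w) * B).
  move=> my mx ix xy; rewrite -RintegralD //; last 2 first.
  - exact: observable_mul_integrable.
  - by apply: observable_mul_integrable => //; exact: ib.
  apply: Rintegral_ae_eq => //.
  - by apply: measurable_funM => //; exact: measurableT_comp.
  - by apply: measurable_funD; apply: measurable_funM => //; exact: measurableT_comp.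
  - by apply: ae_imp xy => w -> _; rewrite mulrDr.
have F1 := F k1 k1' mk1' mk1 fine_khat1_integrable.
have F2 := F k2 k2' mk2' mk2 fine_EK1_integrable.
move: F1 F2; rewrite /Rintegral H.
have -> : (\int[P]_w (h (W w) * k2' w)%:E)%E = (\int[P]_w (h (W w) * k2' w)%:E)%E by [].
move=> -> //; last by apply: ae_imp e1 => w [].
move=> F2; have := F2 _; rewrite -/(Rintegral _ _ _) => /(_ _)/addIr; apply.
by apply: ae_imp e2 => w [].
Qed.

Lemma expect_mul_khat1 (h : R -> R) : observable g delta d1 h ->
  \int[P]_w (h (W w) * k1 w) = \int[P]_w (h (W w) * k2 w).
Proof.
move=> oh; have o0 := observable_cst g delta d1 0.
pose hp w := Num.max (h w) 0; pose hn w := Num.max (- h w) 0.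
have op : observable g delta d1 hp by exact: observable_max.
have on : observable g delta d1 hn by apply: observable_max => //; exact: observableN.
have hE w : h w = hp w - hn w.
  by rewrite /hp /hn; case: (leP (h w) 0) => h1; case: (leP (- h w) 0) => h2; lra.
have F k : P.-integrable setT (EFin \o k) -> \int[P]_w (h (W w) * k w) =
    \int[P]_w (hp (W w) * k w) - \int[P]_w (hn (W w) * k w).
  move=> ik; rewrite -RintegralB //; last 2 first.
  - exact: observable_mul_integrable.
  - exact: observable_mul_integrable.
  by apply: eq_Rintegral => w _; rewrite -mulrBl -hE.
rewrite F ?F; [|exact: fine_EK1_integrable|exact: fine_khat1_integrable].
by rewrite !expect_mul_khat1_ge0 // => w; rewrite le_max lexx orbT.
Qed.

Lemma section_measurable w : measurable_fun I (K w).
Proof.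
have mI : measurable I by exact: measurable_itv.
apply: (measurable_comp (F := [set: T] `*` I) (f := fun x : T * R => K x.1 x.2)
  (g := fun t => (w, t))) => //.
- exact: measurableX.
- by move=> x [t tI <-].
- by apply: measurable_funTS; exact: pair1_measurable.
Qed.

Lemma ae_notin (s : seq R) x : {ae mu, forall t, x + t \notin s}.
Proof.
elim: s => [|y s ih]; first by apply: aeW => t; rewrite in_nil.
have hy : {ae mu, forall t, t <> y - x}.
  exists [set y - x]; split => //; first exact: lebesgue_measure_set1.
  by move=> t /= /contrapT ->.
apply: ae_imp (ae_and ih hy) => t [ts ty].
by rewrite in_cons negb_or ts andbT; apply/eqP => xt; apply: ty; rewrite -xt addrC addKr.
Qed.

(** The bound on f' may fail at finitely many points s: they are null for the
    integral over t. *)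
Lemma khat_term_le (f H : R -> R) (s : seq R) w :
  (forall t, t \in `[- delta, delta] -> 0 <= K w t) ->
  khat1 delta K w = (k1 w)%:E ->
  mu.-integrable I (fun t => (f^`()%classic (W w + t) * K w t)%:E) ->
  (forall t, `|t| <= delta -> W w + t \notin s ->
     f^`()%classic (W w + t) <= H (W w)) ->
  khat_term W delta K f w <= H (W w) * k1 w.
Proof.
move=> K0 fk fi fH; have mI : measurable I by exact: measurable_itv.
have iK : mu.-integrable I (EFin \o K w).
  apply/integrableP; split; first by apply/measurable_EFinP; exact: section_measurable.
  have -> : (\int[mu]_(t in I) `|(EFin \o K w) t|)%E = khat1 delta K w.
    by apply: eq_integral => t tI; rewrite gee0_abs // lee_fin K0 //; rewrite inE in tI.
  by rewrite fk ltry.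
have -> : k1 w = \int[mu]_(t in I) K w t by [].
rewrite /khat_term -RintegralZl //.
apply: ae_le_Rintegral => //.
  exact: integrable_mulc.
apply: ae_imp (ae_notin s (W w)) => t ts tI.
have tI' : t \in `[- delta, delta] by [].
apply: ler_wpM2r; first exact: K0.
by apply: fH => //; rewrite ler_norml; move: tI'; rewrite in_itv.
Qed.

(** How the identity for W is used: h is meant to be f'(w), or an approximation
    of it, and e bounds the variation of f' over distances at most delta.
    Replacing E h(W) K1 by E h(W) costs delta1 |h| (|g|^tau1 + 1), replacing
    E e(W) K1 costs the factor d0, and E f(W) R(W) costs the last term.  The
    two bounds on R are both needed: the first has a factor alpha < 1, the
    second is small. *)
Theorem stein_certificate (f h e q : R -> R) (s : seq R) :
  locally_lipschitz f -> observable g delta d1 f ->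
  observable g delta d1 h -> observable g delta d1 e ->
  observable g delta d1 q ->
  (forall w, delta * `|g w| <= d1 -> 0 <= e w) ->
  (forall w t, delta * `|g w| <= d1 -> `|t| <= delta -> w + t \notin s ->
    f^`()%classic (w + t) <= h w + e w) ->
  (forall w, delta * `|g w| <= d1 ->
    q w <= f w * g w - h w - delta1 * `|h w| * (`|g w| `^ tau1 + 1) - d0 * e w
      - `|f w| * Num.min (alpha * (`|g w| + 1)) (delta2 * (`|g w| `^ tau2 + 1))) ->
  expect q <= 0.
Proof.
move=> lf of_ oh oe oq e0 fhe qle.
have og := observable_drift dl.
have ofg := observableM of_ og.
have oH := observableD oh oe.
have [ilhs [iae ikh ifr] EE] := W_identity (locally_lipschitz_ac lf)
  (or_introl (observable_integrable ofg)).
have iH1 := observable_mul_integrable oH fine_khat1_integrable.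
have iH2 := observable_mul_integrable oH fine_EK1_integrable.
have [B B0 hB] := fine_EK1_ae dl t1.
have khat_le : \int[P]_w khat_term W delta K f w <= \int[P]_w ((h (W w) + e (W w)) * k1 w).
  apply: ae_le_Rintegral => //.
  apply: ae_imp (ae_and delta_g_bound (ae_and K_ge0 (ae_and iae fine_khat1_ae))).
  move=> w [sw [K0 [fi [fk _]]]] _.
  apply: (khat_term_le (s := s) (H := fun x => h x + e x)) => // t td ts.
  exact: fhe.
have idE : \int[P]_w (f (W w) * g (W w)) =
    \int[P]_w khat_term W delta K f w + \int[P]_w (f (W w) * r (W w)).
  move: EE; rewrite unlock => EE; rewrite {1}/Rintegral EE fineD //.
  - exact: integrable_fin_num ikh.
  - exact: integrable_fin_num ifr.
have ifg : P.-integrable setT (EFin \o (fun w => f (W w) * g (W w))) by exact: ilhs.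
have ifr' : P.-integrable setT (EFin \o (fun w => f (W w) * r (W w))) by exact: ifr.
have iD : P.-integrable setT (EFin \o (fun w => f (W w) * g (W w) - f (W w) * r (W w))).
  by have := integrableB measurableT ifg ifr'; exact.
apply: (@le_trans _ _ (\int[P]_w (f (W w) * g (W w) - f (W w) * r (W w)
    - (h (W w) + e (W w)) * k2 w))); last first.
  rewrite RintegralB // RintegralB // idE -(expect_mul_khat1 oH).
  by rewrite -addrA addrC; lra.
apply: ae_le_Rintegral => //.
- exact: observable_integrable.
- by have := integrableB measurableT iD iH2; exact.
apply: ae_imp (ae_and delta_g_bound (ae_and hB (ae_and r_small r_bound))).
move=> w [sw [[_ _ kd0 k1d] [rs rb]]] _.
apply: (le_trans (qle _ sw)).
have hk : h (W w) * (k2 w - 1) <= delta1 * `|h (W w)| * (`|g (W w)| `^ tau1 + 1).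
  apply: (le_trans (ler_norm _)).
  by rewrite normrM (mulrC delta1) -mulrA ler_wpM2l.
have ek : e (W w) * k2 w <= d0 * e (W w).
  by rewrite mulrC; apply: ler_wpM2r => //; exact: e0.
have fr : f (W w) * r (W w) <= `|f (W w)| * Num.min (alpha * (`|g (W w)| + 1))
    (delta2 * (`|g (W w)| `^ tau2 + 1)).
  apply: (le_trans (ler_norm _)); rewrite normrM ler_wpM2l //.
  by rewrite le_min rs rb.
move: hk ek fr; rewrite mulrBr mulr1 mulrDl; lra.
Qed.

End certificate.

(** * Functionals obeying the Stein inequality *)

Section elementary.
Context (R : realType).
Implicit Types x y k e : R.

Lemma powR_le_1_expr y k (n : nat) : 0 <= y -> 0 <= k -> k <= n%:R ->
  y `^ k <= 1 + y ^+ n.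
Proof.
move=> y0 k0 kn; have [y1|/ltW y1] := leP 1 y.
  apply: le_trans (_ : y ^+ n <= _); last by rewrite lerDr.
  by rewrite -powR_mulrn // ler_powR.
apply: (@le_trans _ _ (1 `^ k)).
  by apply: ge0_ler_powR; rewrite ?nnegrE.
by rewrite powR1 lerDl exprn_ge0.
Qed.

Lemma absorb_lower_power k e (n : nat) : 0 <= k -> 0 < e ->
  exists2 C, 0 <= C & forall y, 0 <= y -> k * (1 + y) ^+ n <= e * y ^+ n.+1 + C.
Proof.
move=> k0 e0; pose Y := Num.max 1 (k * 2 ^+ n / e).
have Y1 : 1 <= Y by rewrite le_max lexx.
exists (k * (1 + Y) ^+ n); first by rewrite mulr_ge0 // exprn_ge0 //; lra.
move=> y y0; have [yY|/ltW yY] := leP y Y.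
  rewrite -[leLHS]add0r lerD //; first by rewrite mulr_ge0 ?exprn_ge0 // ltW.
  by rewrite ler_wpM2l // lerXn2r ?nnegrE //; lra.
rewrite -[leLHS]addr0 lerD //; last by rewrite mulr_ge0 // exprn_ge0 //; lra.
apply: (@le_trans _ _ (k * (2 * y) ^+ n)).
  rewrite ler_wpM2l // lerXn2r ?nnegrE //; lra.
rewrite exprMn mulrA exprSr mulrA [e * _ * y]mulrAC ler_wpM2r ?exprn_ge0 //.
have : k * 2 ^+ n / e <= y by apply: le_trans yY; rewrite le_max lexx orbT.
by rewrite ler_pdivrMr // [y * e]mulrC.
Qed.

Lemma expR_le_linear x y : 0 <= x -> x <= y -> expR x <= 1 + expR y * x.
Proof.
move=> x0 xy.
have : expR x - expR 0 <= expR y * (x - 0).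
  apply: (mvt_le (df := @expR R)) => // t.
  - by move=> _; exact: continuous_expR.
  - by move=> /andP[_ /ltW tx]; rewrite ler_expR (le_trans tx).
by rewrite expR0 subr0; lra.
Qed.

End elementary.

(** The functionals h |-> E h(W), freed from the probability space: bounds
    proved for all such functionals have constants that cannot depend on W. *)
Record stein_expectation (R : realType) (d0 d1 tau1 tau2 alpha delta delta1 delta2 : R)
    (g : R -> R) (E : (R -> R) -> R) : Prop := SteinExpectation {
  expect_le : forall h k, observable g delta d1 h -> observable g delta d1 k ->
    (forall w, delta * `|g w| <= d1 -> h w <= k w) -> E h <= E k ;
  expectD : forall h k, observable g delta d1 h -> observable g delta d1 k ->
    E (fun w => h w + k w) = E h + E k ;
  expectZ : forall c h, observable g delta d1 h -> E (fun w => c * h w) = c * E h ;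
  expect_cst : forall c, E (fun=> c) = c ;
  expect_certificate : forall (f h e q : R -> R) (s : seq R),
    locally_lipschitz f -> observable g delta d1 f ->
    observable g delta d1 h -> observable g delta d1 e ->
    observable g delta d1 q ->
    (forall w, delta * `|g w| <= d1 -> 0 <= e w) ->
    (forall w t, delta * `|g w| <= d1 -> `|t| <= delta -> w + t \notin s ->
      f^`()%classic (w + t) <= h w + e w) ->
    (forall w, delta * `|g w| <= d1 ->
      q w <= f w * g w - h w - delta1 * `|h w| * (`|g w| `^ tau1 + 1) - d0 * e w
        - `|f w| * Num.min (alpha * (`|g w| + 1)) (delta2 * (`|g w| `^ tau2 + 1))) ->
    E q <= 0 }.

Section observables.
Context (R : realType) (g : R -> R) (delta d1 : R).
Hypotheses (cg : continuous g) (delta_gt0 : 0 < delta).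
Local Notation obs := (observable g delta d1).

Lemma observable_itv a b (sa sb : bool) :
  obs (fun w => (w \in Interval (BSide sa a) (BSide sb b))%:R).
Proof.
split; last by exists 1 => w _; case: (_ \in _); rewrite ?normr1 ?normr0.
rewrite (_ : (fun _ => _) = \1_[set` Interval (BSide sa a) (BSide sb b)]).
  exact: measurable_indic.
by apply/funext => w; rewrite indicE mem_setE.
Qed.

Lemma observable_gt (a : R) : obs (fun w => (a < w)%R%:R).
Proof.
split; last by exists 1 => w _; case: (a < w); rewrite ?normr1 ?normr0.
rewrite (_ : (fun _ => _) = \1_[set` `]a, +oo[]); first exact: measurable_indic.
by apply/funext => w; rewrite indicE mem_setE in_itv /= andbT.
Qed.

Lemma observable_le (a : R) : obs (fun w => (w <= a)%R%:R).
Proof.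
split; last by exists 1 => w _; case: (w <= a); rewrite ?normr1 ?normr0.
rewrite (_ : (fun _ => _) = \1_[set` `]-oo, a]]); first exact: measurable_indic.
by apply/funext => w; rewrite indicE mem_setE in_itv /=.
Qed.

Lemma observable_expr h n : obs h -> obs (fun w => h w ^+ n).
Proof.
move=> oh; elim: n => [|n ih].
  by have -> : (fun w => h w ^+ 0) = (fun=> 1) by []; exact: observable_cst.
have -> : (fun w => h w ^+ n.+1) = (fun w => h w * h w ^+ n).
  by apply/funext => w; rewrite exprS.
exact: observableM.
Qed.

Lemma observable_bounded f B : continuous f -> (forall w, `|f w| <= B) -> obs f.
Proof.
by move=> cf fB; split; [exact: continuous_measurable_fun|exists B].
Qed.

End observables.

(** * Moments of g(W) and the tilted exponential *)

Section tails.
Context (R : realType) (d0 d1 c1 c2 c3 tau1 tau2 alpha gmax : R).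
Hypotheses (d0_ge1 : 1 <= d0) (d1_gt0 : 0 < d1) (c1_gt0 : 0 < c1).
Hypotheses (c2_gt0 : 0 < c2) (c3_ge1 : 1 <= c3).
Hypotheses (tau2_gt0 : 0 < tau2) (alpha01 : 0 <= alpha < 1).
Local Notation M := (crossover c1).

(** The threshold for delta2 below which the remainder R is dominated by a
    fraction (1 + alpha) / 2 < 1 of g on [M, +oo): where g is large the bound
    alpha (g + 1) suffices, and on the remaining bounded range of g the bound
    delta2 (g^tau2 + 1) does. *)
Definition small_error := Num.min 1
  ((1 + alpha) / 2 / M / ((2 * alpha / (1 - alpha)) `^ tau2 + 1)).

Record setting (g : R -> R) (delta delta1 delta2 : R) (E : (R -> R) -> R) : Prop :=
  Setting {
  setting_drift : drift c1 c2 c3 gmax g ;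
  setting_delta_gt0 : 0 < delta ;
  setting_delta_le1 : delta <= 1 ;
  setting_delta1_ge0 : 0 <= delta1 ;
  setting_delta2_ge0 : 0 <= delta2 ;
  setting_delta2_le : delta2 <= small_error ;
  setting_expect : stein_expectation d0 d1 tau1 tau2 alpha delta delta1 delta2 g E }.

(** Beyond M constants are at most M g, so a step of length at most 1 multiplies
    g by at most this factor. *)
Definition step_growth := 1 + c2 * (1 + (gmax + 1) * M).

Lemma crossover_gt0 : 0 < M.
Proof. by apply: lt_le_trans (crossover_ge1 c1). Qed.

Section setting_theory.
Variables (g : R -> R) (delta delta1 delta2 : R) (E : (R -> R) -> R).
Hypothesis S : setting g delta delta1 delta2 E.
Let dg := setting_drift S.
Let dl0 := setting_delta_gt0 S.
Let sE := setting_expect S.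
Local Notation obs := (observable g delta d1).
Local Notation rho w := (Num.min (alpha * (`|g w| + 1)) (delta2 * (`|g w| `^ tau2 + 1))).

Lemma setting_observable_drift : obs g.
Proof. exact: (observable_drift d1 (drift_continuous dg) dl0). Qed.

Lemma setting_observable_powR k : 0 <= k -> obs (fun w => `|g w| `^ k).
Proof. exact: (observable_powR d1 (drift_continuous dg) dl0). Qed.

Lemma setting_drift_gt0 w : M <= w -> 0 < g w.
Proof.
move=> /(drift_ge_crossover c1_gt0 dg); apply: lt_le_trans.
by rewrite invr_gt0 crossover_gt0.
Qed.

Lemma setting_drift_ge1 w : M <= w -> 1 <= M * g w.
Proof.
move=> /(drift_ge_crossover c1_gt0 dg) h.
by rewrite mulrC -ler_pdivrMr ?crossover_gt0 // mul1r.
Qed.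

Lemma remainder_lt_drift w : M <= w -> rho w <= (1 + alpha) / 2 * g w.
Proof.
move=> Mw; have g0 := setting_drift_gt0 Mw; have [a0 a1] := andP alpha01.
rewrite gtr0_norm // ge_min.
have [gA|/ltW gA] := leP (2 * alpha / (1 - alpha)) (g w).
  apply/orP; left.
  have : 2 * alpha <= g w * (1 - alpha) by rewrite -ler_pdivrMr // subr_gt0.
  by lra.
apply/orP; right.
set A := (2 * alpha / (1 - alpha)) `^ tau2 + 1.
have A0 : 0 < A by rewrite ltr_wpDl // powR_ge0.
have gA' : g w `^ tau2 + 1 <= A.
  rewrite lerD2r; apply: ge0_ler_powR; rewrite ?nnegrE ?(ltW tau2_gt0) ?(ltW g0) //.
  exact: le_trans (ltW g0) gA.
apply: (@le_trans _ _ (small_error * A)).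
  apply: ler_pM => //; first exact: (setting_delta2_ge0 S).
    by rewrite addr_ge0 // powR_ge0.
  exact: (setting_delta2_le S).
apply: (@le_trans _ _ ((1 + alpha) / 2 / M)).
  by rewrite -ler_pdivlMr // /small_error ge_min lexx orbT.
rewrite ler_pM2l; last by lra.
exact: (drift_ge_crossover c1_gt0 dg Mw).
Qed.

Lemma step_growth_ge1 : 1 <= step_growth.
Proof.
have := drift_max_ge0 dg; have := crossover_gt0 => M0 gm.
by rewrite lerDl mulr_ge0 ?ltW // ltr_wpDr // mulr_ge0 ?ltW //; lra.
Qed.

Lemma drift_step_growth w t : M <= w -> t <= 1 -> g (w + t) <= step_growth * g w.
Proof.
move=> Mw t1; have g0 := setting_drift_gt0 Mw; have g1 := setting_drift_ge1 Mw.
have gm := drift_max_ge0 dg.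
have [t0|/ltW t0] := leP 0 t; last first.
  apply: (@le_trans _ _ (g w)); first by apply: (drift_homo dg); lra.
  by rewrite ler_peMl ?step_growth_ge1 // ltW.
have := drift_shift_le c2_gt0 dg w (t := t).
rewrite (ger0_norm t0) (gtr0_norm g0) => /(_ t1).
move=> /(le_trans (ler_norm _)) h; apply: (le_trans h).
have h2 : c2 * (gmax + 1) <= c2 * ((gmax + 1) * (M * g w)).
  by rewrite ler_pM2l // -[leLHS]mulr1; apply: ler_wpM2l => //; lra.
by rewrite /step_growth; lra.
Qed.

End setting_theory.

(** The test function g^(2m+1) turns f g into |g|^(2m+2).  Of this R takes at
    most the fraction alpha up to lower powers, and f' = O((1 + |g|)^(2m+1)) is
    also of lower order. *)
Lemma drift_moment (m : nat) : exists2 C, 0 <= C &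
  forall g delta delta1 delta2 E, setting g delta delta1 delta2 E ->
  E (fun w => `|g w| ^+ (2 * m).+2) <= C.
Proof.
have [a0 a1] := andP alpha01; have hd0 := d0_ge1; have hc3 := c3_ge1; have hc2 := c2_gt0.
pose N := (2 * m).+1.
have [gm gm0 gmE] : exists2 gm, 0 <= gm & gmax <= gm.
  by exists (Num.max gmax 0); rewrite le_max lexx ?orbT.
pose Kc := 1 + c2 * (gm + 1).
have Kc0 : 0 <= Kc by rewrite /Kc addr_ge0 // mulr_ge0 ?(ltW c2_gt0) // addr_ge0.
pose k := d0 * (N%:R * c3 * Kc ^+ N).
have k0 : 0 <= k.
  by rewrite /k !mulr_ge0 ?exprn_ge0 //; lra.
have e0 : 0 < (1 - alpha) / 2 by lra.
have [C C0 HC] := absorb_lower_power N (addr_ge0 k0 a0) e0.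
exists (2 * C / (1 - alpha)); first by apply: divr_ge0; lra.
move=> g delta delta1 delta2 E S.
have dg := setting_drift S; have dl0 := setting_delta_gt0 S; have sE := setting_expect S.
have og := setting_observable_drift S.
have on := observable_norm og.
have obs_e : observable g delta d1 (fun w => N%:R * c3 * (Kc * (1 + `|g w|)) ^+ N).
  apply: observableM; first exact: observable_cst.
  apply/observable_expr/observableM; first exact: observable_cst.
  by apply: observableD => //; exact: observable_cst.
have obs_q : observable g delta d1 (fun w => (1 - alpha) / 2 * `|g w| ^+ N.+1 + (- C)).
  apply: observableD; last exact: observable_cst.
  by apply: observableM; [exact: observable_cst|exact: observable_expr].
have h : E (fun w => (1 - alpha) / 2 * `|g w| ^+ N.+1 + (- C)) <= 0.
  apply: (expect_certificate sE (f := fun w => g w ^+ N) (h := fun=> 0)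
     (e := fun w => N%:R * c3 * (Kc * (1 + `|g w|)) ^+ N) (s := [::])) => //.
  - by apply: locally_lipschitz_expr; exact: (drift_lipschitz c3_ge1 dg).
  - exact: observable_expr.
  - exact: observable_cst.
  - by move=> w _; rewrite !mulr_ge0 ?exprn_ge0 ?mulr_ge0 // ?addr_ge0 //; lra.
  - move=> w t _ td _; rewrite add0r.
    rewrite derive1E.
    have D := is_derive_expr N (drift_is_derive dg (w + t)).
    have [_ ->] := D; rewrite -!mulrA ler_pM2l // [N.-1]/=.
    apply: (le_trans (ler_norm _)); rewrite normrM.
    have t1 : `|t| <= 1 by apply: (le_trans td); exact: setting_delta_le1 S.
    have gx : 1 + `|g (w + t)| <= Kc * (1 + `|g w|).
      have := drift_shift_le c2_gt0 dg w t1.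
      have := normr_ge0 (g w).
      have : c2 * (`|g w| + gmax + 1) <= c2 * (`|g w| + gm + 1) by rewrite ler_pM2l //; lra.
      have : 0 <= c2 * gm * `|g w| by rewrite !mulr_ge0 // ltW.
      by rewrite /Kc; lra.
    have gp := drift_derive_norm_le c3_ge1 dg (w + t).
    apply: (@le_trans _ _ ((Kc * (1 + `|g w|)) ^+ (2 * m) * (c3 * (Kc * (1 + `|g w|))))).
      apply: ler_pM => //.
        have gK : 0 <= Kc * (1 + `|g w|) by apply: mulr_ge0 => //; rewrite addr_ge0.
        rewrite normrX lerXn2r ?nnegrE //.
        by apply: le_trans gx; rewrite lerDr.
      by apply: (le_trans gp); rewrite ler_pM2l //; lra.
    by rewrite mulrCA -exprSr.
  - move=> w _.
    have -> : g w ^+ N * g w = `|g w| ^+ N.+1.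
      by rewrite -exprSr -normrX ger0_norm // -[N.+1]/((2 * m).+2)  -[(2 * m).+2]/(2 + 2 * m)%N -mulnS exprM exprn_ge0 // sqr_ge0.
    rewrite normr0 mulr0 mul0r !subr0 normrX.
    have y0 := normr_ge0 (g w); move: y0; set y := `|g w| => y0.
    have := HC _ y0.
    have -> : d0 * (N%:R * c3 * (Kc * (1 + y)) ^+ N) = k * (1 + y) ^+ N.
      by rewrite exprMn /k; ring.
    have hm : y ^+ N * Num.min (alpha * (y + 1)) (delta2 * (y `^ tau2 + 1)) <= alpha * (y ^+ N.+1 + y ^+ N).
      apply: (@le_trans _ _ (y ^+ N * (alpha * (y + 1)))).
        by rewrite ler_wpM2l ?exprn_ge0 // ge_min lexx.
      by rewrite exprSr; lra.
    have : alpha * y ^+ N <= alpha * (1 + y) ^+ N.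
      by rewrite ler_wpM2l // lerXn2r ?nnegrE //; lra.
    by move: hm; rewrite !mulrDl !mulrDr; lra.
move: h; rewrite (expectD sE) ?(expectZ sE) ?(expect_cst sE) //; last 3 first.
- exact: observable_expr.
- by apply: observableM; [exact: observable_cst|exact: observable_expr].
- exact: observable_cst.
by rewrite ler_pdivlMr; lra.
Qed.

(** The range of z in the theorem. *)
Definition moderate g delta delta1 delta2 z := delta * z * g z ^+ 2 +
  delta1 * z * g z `^ (tau1 + 1) + delta2 * z * g z `^ tau2 <= 1.

Section tilted_test_function.
Variables (g : R -> R) (delta delta1 delta2 : R) (E : (R -> R) -> R).
Hypothesis S : setting g delta delta1 delta2 E.
Variables (lam z : R).
Hypotheses (lam_ge0 : 0 <= lam) (lam_le : lam <= M^-1) (Mz : M <= z).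
Let dg := setting_drift S.
Local Notation G := (primitive0 g).

(** Normalized to be 1 at M, where it will be frozen. *)
Definition tilt w := expR (G w - lam * w - (G M - lam * M)).

Lemma tilt_gt0 w : 0 < tilt w. Proof. exact: expR_gt0. Qed.

Lemma is_derive_tilt (w : R) : is_derive w 1 tilt ((g w - lam) * tilt w).
Proof.
apply: is_derive_expR_comp.
have h1 := is_derive_potential dg w.
have h2 : is_derive w 1 (fun x => lam * x) lam.
  by have := is_derive_mulc lam (is_derive_id w (1 : R)); rewrite mulr1.
have := is_derive_sub (is_derive_sub h1 h2) (is_derive_const (G M - lam * M) w).
by rewrite subr0.
Qed.

Lemma tilt_continuous : continuous tilt.
Proof. by move=> w; exact: is_derive_continuous (is_derive_tilt w). Qed.

Lemma tilt_rate_ge0 w : M <= w -> 0 <= g w - lam.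
Proof.
by move=> /(drift_ge_crossover c1_gt0 dg) h; rewrite subr_ge0 (le_trans lam_le).
Qed.

Lemma tilt_homo a b : M <= a -> a <= b -> tilt a <= tilt b.
Proof.
move=> Ma ab; rewrite -subr_ge0 -[leLHS](mul0r (b - a)).
apply: (mvt_ge (f := tilt) (df := fun w => (g w - lam) * tilt w) ab).
- by move=> x _; exact: tilt_continuous.
- by move=> x _; exact: is_derive_tilt.
- move=> x /andP[/ltW ax _]; apply: mulr_ge0; last exact/ltW/tilt_gt0.
  by apply: tilt_rate_ge0; exact: le_trans ax.
Qed.

Lemma tilt_crossover : tilt M = 1.
Proof. by rewrite /tilt subrr expR0. Qed.

Lemma tilt_lipschitz : locally_lipschitz tilt.
Proof.
apply: (locally_lipschitz_comp (@locally_lipschitz_expR R)).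
apply: locally_lipschitz_add; last exact: locally_lipschitz_cst.
apply: locally_lipschitz_add; first exact: (potential_lipschitz dg).
apply/locally_lipschitz_opp/locally_lipschitz_mul.
  exact: locally_lipschitz_cst.
exact: locally_lipschitz_id.
Qed.

Definition tilt_step_cst :=
  c3 * (M + step_growth) * M + expR (step_growth * d1) * step_growth * (1 + c3 * (M + step_growth)).

(** The variation of the derivative over a step t <= delta: g grows by
    O(delta g) by the bound on g', and the exponential by a factor
    e^(O(delta g)) = 1 + O(delta g), because delta g <= d1.  With the leading
    factor g this gives the error delta g^2. *)
Lemma tilt_step w t : M <= w -> 0 <= t -> t <= delta -> delta * g w <= d1 ->
  (g (w + t) - lam) * tilt (w + t) <=
  (g w - lam) * tilt w + tilt_step_cst * delta * g w ^+ 2 * tilt w.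
Proof.
move=> Mw t0 td gd; have dl1 := setting_delta_le1 S; have dl0 := setting_delta_gt0 S.
have M0 := crossover_gt0; have hc3 := c3_ge1; have hd1 := d1_gt0.
have k1_ge1 := step_growth_ge1 S.
have w0 : 0 <= w by apply: le_trans Mw; exact: ltW.
have gw0 := setting_drift_gt0 S Mw; have gw1 := setting_drift_ge1 S Mw.
have gx := drift_step_growth S Mw (le_trans td dl1).
have wx : w <= w + t by rewrite lerDl.
have gwx := drift_homo dg wx.
have T0 := tilt_gt0 w; have T0' := tilt_gt0 (w + t).
rewrite /tilt_step_cst; move: k1_ge1 gx; set k1 := step_growth => k1_ge1 gx.
set k2 := c3 * (M + k1); set E0 := expR (k1 * d1).
have k2_ge0 : 0 <= k2 by rewrite mulr_ge0 //; lra.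
have E0_ge0 : 0 <= E0 by exact: expR_ge0.
have gstep : g (w + t) <= g w + k2 * (delta * g w).
  apply: (le_trans (drift_step_le c3_ge1 dg w0 t0)); rewrite lerD2l.
  have -> : k2 * (delta * g w) = delta * (c3 * (M * g w + k1 * g w)) by rewrite /k2; ring.
  by apply: ler_pM => //; rewrite ?mulr_ge0 // ?ler_pM2l ?lerD //; lra.
have dgx : t * g (w + t) <= k1 * (delta * g w).
  by rewrite mulrCA; apply: ler_pM => //; lra.
have Tstep : tilt (w + t) <= tilt w * (1 + E0 * (k1 * (delta * g w))).
  have -> : tilt (w + t) = tilt w * expR (G (w + t) - G w - lam * t).
    by rewrite /tilt -expRD; congr expR; ring.
  rewrite (ler_pM2l T0).
  apply: (@le_trans _ _ (expR (k1 * (delta * g w)))).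
    rewrite ler_expR; apply: le_trans dgx.
    have := potential_increment_le dg wx; rewrite [w + t - w]addrAC subrr add0r mulrC.
    have := mulr_ge0 lam_ge0 t0; lra.
  apply: expR_le_linear; first by rewrite !mulr_ge0 //; lra.
  by rewrite ler_pM2l //; lra.
have r0 := tilt_rate_ge0 Mw.
have r0' : 0 <= g (w + t) - lam by lra.
apply: (@le_trans _ _ ((g w - lam + k2 * (delta * g w)) * (tilt w * (1 + E0 * (k1 * (delta * g w)))))).
  by apply: ler_pM => //; [exact: ltW|lra].
rewrite -subr_ge0.
have -> : (g w - lam) * tilt w + (k2 * M + E0 * k1 * (1 + k2)) * delta * g w ^+ 2 * tilt w -
  (g w - lam + k2 * (delta * g w)) * (tilt w * (1 + E0 * (k1 * (delta * g w)))) =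
  tilt w * (delta * (k2 * (g w * (M * g w - 1)) + E0 * k1 * (g w * lam)
    + E0 * k1 * k2 * (g w ^+ 2 * (1 - delta)))) by ring.
apply: mulr_ge0; first exact: ltW.
apply: mulr_ge0; first exact: ltW.
apply: addr_ge0; [apply: addr_ge0|]; apply: mulr_ge0; rewrite ?mulr_ge0 //; lra.
Qed.

Local Notation ft := (fun w => tilt (clamp M z w)).

Lemma tilt_clamp_lipschitz : locally_lipschitz ft.
Proof. exact: (locally_lipschitz_comp tilt_lipschitz (@locally_lipschitz_clamp R M z)). Qed.

Lemma tilt_clamp_ge1 w : 1 <= ft w.
Proof. by rewrite -tilt_crossover; apply: tilt_homo => //; exact: clamp_ge. Qed.

Lemma tilt_clamp_le w : ft w <= tilt z.
Proof. by apply: tilt_homo; [exact: clamp_ge|exact: clamp_le]. Qed.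

Lemma tilt_clamp_homo a b : a <= b -> ft a <= ft b.
Proof. by move=> ab; apply: tilt_homo; [exact: clamp_ge|exact: clamp_homo]. Qed.

Lemma observable_tilt_clamp : observable g delta d1 ft.
Proof.
apply: (@observable_bounded _ _ _ _ _ (tilt z)).
  exact/locally_lipschitz_continuous/tilt_clamp_lipschitz.
move=> w; rewrite ger0_norm ?tilt_clamp_le //.
exact/ltW/tilt_gt0.
Qed.

End tilted_test_function.

End tails.

(** * Exponential bound for the tail of W *)

Section exponential_bound.
Context (R : realType) (d0 d1 c1 c2 c3 tau1 tau2 alpha gmax : R).
Hypotheses (d0_ge1 : 1 <= d0) (d1_gt0 : 0 < d1) (c1_gt0 : 0 < c1).
Hypotheses (c2_gt0 : 0 < c2) (c3_ge1 : 1 <= c3).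
Hypotheses (tau1_gt0 : 0 < tau1) (tau2_gt0 : 0 < tau2) (alpha01 : 0 <= alpha < 1).
Hypothesis gmax_ge0 : 0 <= gmax.
Local Notation M := (crossover c1).
Local Notation setting := (setting d0 d1 c1 c2 c3 tau1 tau2 alpha gmax).
Local Notation moderate := (moderate tau1 tau2).
Local Notation k1 := (step_growth c1 c2 gmax).
Local Notation k3 := (tilt_step_cst d1 c1 c2 c3 gmax).

Lemma powR_add1_le (m x y k : R) : 0 <= k -> 0 < x -> 1 <= M * x -> 0 <= m -> 0 <= y -> x <= m * y ->
  x `^ k + 1 <= (1 + M `^ k) * m `^ k * y `^ k.
Proof.
move=> k0 x0 Mx m0 y0 xy; have M0 := crossover_gt0 c1.
have h1 : 1 <= M `^ k * x `^ k.
  rewrite -powRM ?(ltW M0) ?(ltW x0) // -[leLHS](_ : 1 `^ k = 1); last by rewrite powR1.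
  by apply: ge0_ler_powR; rewrite ?nnegrE //; lra.
have h2 : x `^ k <= m `^ k * y `^ k.
  by rewrite -powRM //; apply: ge0_ler_powR; rewrite ?nnegrE ?mulr_ge0 ?(ltW x0).
apply: (@le_trans _ _ ((1 + M `^ k) * x `^ k)); first by lra.
by rewrite -mulrA ler_wpM2l // addr_ge0 // powR_ge0.
Qed.

Lemma step_growth_gt0 : 0 < k1.
Proof.
have M0 := crossover_gt0 c1; have hc2 := c2_gt0; have gm := gmax_ge0.
by rewrite /step_growth ltr_wpDr // mulr_ge0 ?(ltW c2_gt0) // addr_ge0 // mulr_ge0 ?(ltW M0) // addr_ge0.
Qed.

Lemma tilt_step_cst_ge0 : 0 <= k3.
Proof.
have M0 := crossover_gt0 c1; have hc3 : 0 <= c3 by apply: le_trans c3_ge1.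
have k0 := ltW step_growth_gt0; have E0 := expR_ge0 (k1 * d1).
have kk : 0 <= c3 * (M + k1) by apply: mulr_ge0 => //; rewrite addr_ge0 // ltW.
rewrite /tilt_step_cst; apply: addr_ge0; first by apply: mulr_ge0 => //; exact: ltW.
by apply: mulr_ge0; [exact: mulr_ge0|rewrite addr_ge0].
Qed.

Definition error_cst := (1 + M `^ tau1) * k1 `^ tau1 * k1 + d0 * k3 * k1 ^+ 2 +
  (1 + M `^ tau2) * k1 `^ tau2.

Lemma growth_cst_gt0 k : 0 < (1 + M `^ k) * k1 `^ k.
Proof.
apply: mulr_gt0; first by rewrite ltr_pwDl // powR_ge0.
exact: powR_gt0 step_growth_gt0.
Qed.

Lemma quadratic_cst_ge0 : 0 <= d0 * k3 * k1 ^+ 2.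
Proof.
have hd0 : 0 <= d0 by apply: le_trans d0_ge1.
by apply: mulr_ge0 (sqr_ge0 _); exact: mulr_ge0 tilt_step_cst_ge0.
Qed.

Lemma error_cst_gt0 : 0 < error_cst.
Proof.
have h1 := mulr_gt0 (growth_cst_gt0 tau1) step_growth_gt0.
have h2 := growth_cst_gt0 tau2; have h3 := quadratic_cst_ge0.
by rewrite /error_cst; lra.
Qed.

(** The errors relative to the tilted exponential are O(1 / z) on all of
    [M, z + delta], not only at z, because g is nondecreasing and
    g(z + delta) = O(g(z)). *)
Lemma moderate_error g delta delta1 delta2 E z w :
  setting g delta delta1 delta2 E -> M <= z -> moderate g delta delta1 delta2 z ->
  M <= w -> w <= z + delta ->
  delta1 * (g w * (g w `^ tau1 + 1)) + d0 * (k3 * delta * g w ^+ 2) +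
    delta2 * (g w `^ tau2 + 1) <= error_cst / z.
Proof.
move=> S Mz mz Mw wz; have dg := setting_drift S.
have M0 := crossover_gt0 c1; have z0 : 0 < z by apply: lt_le_trans Mz.
have gw0 := setting_drift_gt0 c1_gt0 S Mw; have gw1 := setting_drift_ge1 c1_gt0 S Mw.
have gz0 := setting_drift_gt0 c1_gt0 S Mz.
have k10 := step_growth_gt0; have k30 := tilt_step_cst_ge0.
have gwz : g w <= k1 * g z.
  have -> : w = z + (w - z) by rewrite addrC subrK.
  apply: (drift_step_growth c1_gt0 c2_gt0 S Mz).
  by have := setting_delta_le1 S; lra.
have P1 := powR_add1_le (ltW tau1_gt0) gw0 gw1 (ltW k10) (ltW gz0) gwz.
have P2 := powR_add1_le (ltW tau2_gt0) gw0 gw1 (ltW k10) (ltW gz0) gwz.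
have P3 : g w ^+ 2 <= k1 ^+ 2 * g z ^+ 2.
  by rewrite -exprMn lerXn2r ?nnegrE ?mulr_ge0 ?(ltW gw0) ?(ltW gz0) ?(ltW k10).
have P1' : g w * (g w `^ tau1 + 1) <= (1 + M `^ tau1) * k1 `^ tau1 * k1 * g z `^ (tau1 + 1).
  have -> : g z `^ (tau1 + 1) = g z `^ tau1 * g z.
    rewrite powRD; first by rewrite powRr1 // ltW.
    by rewrite (gt_eqF gz0) implybT.
  rewrite mulrC.
  have -> : (1 + M `^ tau1) * k1 `^ tau1 * k1 * (g z `^ tau1 * g z) =
    ((1 + M `^ tau1) * k1 `^ tau1 * g z `^ tau1) * (k1 * g z) by ring.
  by apply: ler_pM => //; rewrite ?addr_ge0 ?powR_ge0 ?(ltW gw0).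
set X1 := g z `^ (tau1 + 1) in P1'.
set X2 := g z `^ tau2 in P2.
have X1_ge0 : 0 <= X1 by exact: powR_ge0.
have X2_ge0 : 0 <= X2 by exact: powR_ge0.
have hd0 : 0 <= d0 by apply: le_trans d0_ge1.
have dl := ltW (setting_delta_gt0 S).
have dl1 := setting_delta1_ge0 S; have dl2 := setting_delta2_ge0 S.
apply: (@le_trans _ _ (error_cst * (delta1 * X1 + delta * g z ^+ 2 + delta2 * X2))); last first.
  rewrite ler_pM2l ?error_cst_gt0 // -[z^-1]mul1r ler_pdivlMr //.
  by move: mz; rewrite /moderate -/X1 -/X2; lra.
have Q1 := ler_wpM2l dl1 P1'.
have Q2 := ler_wpM2l dl2 P2.
have Q3 : d0 * (k3 * delta * g w ^+ 2) <= d0 * k3 * k1 ^+ 2 * (delta * g z ^+ 2).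
  have := ler_wpM2l (mulr_ge0 (mulr_ge0 hd0 k30) dl) P3.
  by lra.
have C1_ge0 : 0 <= (1 + M `^ tau1) * k1 `^ tau1 * k1.
  exact: ltW (mulr_gt0 (growth_cst_gt0 tau1) k10).
have C2_ge0 := ltW (growth_cst_gt0 tau2).
have C3_ge0 := quadratic_cst_ge0.
move: Q1 Q2 Q3 C1_ge0 C2_ge0 C3_ge0; rewrite /error_cst.
set A1 := (1 + M `^ tau1) * _ * _; set A2 := (1 + M `^ tau2) * _; set A3 := d0 * k3 * _.
set Y1 := delta1 * (g w * _); set Y2 := delta2 * (_ + 1); set Y3 := d0 * (_ * _ * _).
move=> Q1 Q2 Q3 A1_ge0 A2_ge0 A3_ge0.
have Z1 : 0 <= delta1 * X1 by exact: mulr_ge0.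
have Z2 : 0 <= delta2 * X2 by exact: mulr_ge0.
have Z3 : 0 <= delta * g z ^+ 2 by rewrite mulr_ge0 // sqr_ge0.
have := mulr_ge0 A1_ge0 Z2; have := mulr_ge0 A1_ge0 Z3.
have := mulr_ge0 A2_ge0 Z1; have := mulr_ge0 A2_ge0 Z3.
have := mulr_ge0 A3_ge0 Z1; have := mulr_ge0 A3_ge0 Z2.
by lra.
Qed.

Lemma expect_norm_le : exists2 C, 0 <= C &
  forall g delta delta1 delta2 E, setting g delta delta1 delta2 E ->
  E (fun w => `|g w|) <= C.
Proof.
have [C C0 HC] := drift_moment d1 c1 tau1 tau2 gmax d0_ge1 c2_gt0 c3_ge1 alpha01 0.
exists (1 + C) => [|g delta delta1 delta2 E S]; first by lra.
have sE := setting_expect S; have on := observable_norm (setting_observable_drift S).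
have o2 := observable_expr 2 on.
have o1 := observable_cst g delta d1 1.
apply: (@le_trans _ _ (E (fun w => 1 + `|g w| ^+ 2))); last first.
  by rewrite (expectD sE) // (expect_cst sE) lerD2l; exact: HC S.
apply: (expect_le sE) => //; first exact: observableD.
by move=> w _; have := sqr_ge0 (`|g w| - 1); have := sqr_ge0 `|g w|; lra.
Qed.

(** Test function: the tilted exponential frozen outside [M, z], minus 1 so
    that it vanishes to the left of M, where g may be negative.  The tilt is
    lam = 2 C1 / z with C1 / z the total relative error of [moderate_error], so
    that half of the gain lam f survives; Z ensures lam <= 1 / M <= g beyond
    M. *)
Lemma exponential_bound : exists2 C, 0 <= C & exists2 Z, M <= Z &
  forall g delta delta1 delta2 E, setting g delta delta1 delta2 E ->
  forall z, Z <= z -> moderate g delta delta1 delta2 z ->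
  E (fun w => (w \in `]M, z])%:R * expR (primitive0 g w)) <= C * z /\
  expR (primitive0 g z) * E (fun w => (z + delta < w)%R%:R * g w) <= C.
Proof.
have [Cm Cm0 HCm] := expect_norm_le.
have [k5 k5_ge0 Hk5] := drift_bounded gmax c2_gt0 (M + 1).
have C1_gt0 := error_cst_gt0; set C1 := error_cst in C1_gt0.
have M0 := crossover_gt0 c1; have [a0 a1] := andP alpha01.
have hd0 : 0 <= d0 by apply: le_trans d0_ge1.
have k3_ge0 := tilt_step_cst_ge0.
pose k4 := k5 * expR k5.
have k4_ge0 : 0 <= k4 by rewrite mulr_ge0 // expR_ge0.
pose k7 := expR (k5 * M + 2 * C1).
have k7_gt0 : 0 < k7 by exact: expR_gt0.
pose C' := Cm + d0 * k4.
have C'_ge0 : 0 <= C' by rewrite addr_ge0 // mulr_ge0.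
pose al := (1 - alpha) / 2.
have al_gt0 : 0 < al by rewrite /al; lra.
have B1 : 0 <= C' / C1 by apply: divr_ge0 => //; exact: ltW.
have B2 : 0 <= C' / al by apply: divr_ge0 => //; exact: ltW.
exists (k7 * (C' / C1 + C' / al)).
  by apply: mulr_ge0; [exact: ltW|exact: addr_ge0].
exists (Num.max M (2 * C1 * M)); first by rewrite le_max lexx.
move=> g delta delta1 delta2 E S z; rewrite ge_max => /andP[Mz Zz] mz.
have dg := setting_drift S; have dl0 := setting_delta_gt0 S; have dl1 := setting_delta_le1 S.
have sE := setting_expect S.
have z0 : 0 < z by apply: lt_le_trans Mz.
pose lam := 2 * C1 / z.
have lam0 : 0 <= lam by rewrite divr_ge0 // ?mulr_ge0 // ltW.
have lamM : lam <= M^-1.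
  by rewrite /lam ler_pdivrMr // [M^-1 * z]mulrC ler_pdivlMr.
pose ft w := tilt c1 g lam (clamp M z w).
have ft1 w : 1 <= ft w by exact: (tilt_clamp_ge1 c1_gt0 S lamM Mz w).
have og := setting_observable_drift S; have on := observable_norm og.
have oft : observable g delta d1 ft by exact: (observable_tilt_clamp c1_gt0 S lamM Mz).
have oc c : observable g delta d1 (fun=> c) by exact: observable_cst.
have oI : observable g delta d1 (fun w => (w \in `]M, (z + delta)])%:R) by exact: observable_itv.
have oJ : observable g delta d1 (fun w => (z + delta < w)%R%:R) by exact: observable_gt.
have oK : observable g delta d1 (fun w => (w <= M)%R%:R) by exact: observable_le.
(* h is the derivative of the test function, prolonged up to z + delta so that
   it also bounds the derivative after a step to the left; the second part of
   e serves the points w <= M from which a step can cross M. *)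
pose h w := (w \in `]M, (z + delta)])%:R * ((g w - lam) * ft w).
pose e w := k3 * delta * ((w \in `]M, (z + delta)])%:R * (g w ^+ 2 * ft w)) + k4 * (w <= M)%R%:R.
pose q w := C1 / z * ((w \in `]M, (z + delta)])%:R * ft w)
  + (al * tilt c1 g lam z * ((z + delta < w)%R%:R * g w) + (-1 * `|g w| + - (d0 * k4))).
have oh : observable g delta d1 h.
  by apply: observableM => //; apply: observableM => //; exact: observableB.
have oe : observable g delta d1 e.
  apply: observableD; last exact: observableM.
  apply: observableM => //; apply: observableM => //; apply: observableM => //.
  exact: observable_expr.
have oq1 : observable g delta d1 (fun w => (w \in `]M, (z + delta)])%:R * ft w).
  exact: observableM.
have oq2 : observable g delta d1 (fun w => (z + delta < w)%R%:R * g w).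
  exact: observableM.
have oq3 : observable g delta d1 (fun w => -1 * `|g w|) by exact: observableM.
have oq4 : observable g delta d1 (fun w => -1 * `|g w| + - (d0 * k4)) by exact: observableD.
have oq2' : observable g delta d1 (fun w => al * tilt c1 g lam z * ((z + delta < w)%R%:R * g w)).
  exact: observableM.
have oq5 := observableD oq2' oq4.
have oq1' : observable g delta d1 (fun w => C1 / z * ((w \in `]M, (z + delta)])%:R * ft w)).
  exact: observableM.
have oq : observable g delta d1 q by exact: observableD.
have ftM w : w <= M -> ft w = 1.
  by move=> wM; rewrite /ft clamp_lo // tilt_crossover.
have ftz w : z <= w -> ft w = tilt c1 g lam z.
  by move=> zw; rewrite /ft clamp_hi.
have hE : E q <= 0.
  apply: (expect_certificate sE (f := fun w => ft w - 1) (h := h) (e := e) (s := [:: M; z])) => //.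
  - apply: locally_lipschitz_add; last exact: locally_lipschitz_cst.
    exact: (tilt_clamp_lipschitz S).
  - exact: observableB.
  - move=> w _; rewrite /e; apply: addr_ge0; last by rewrite mulr_ge0.
    have F0 : 0 <= ft w by apply: le_trans (ft1 w).
    by apply: mulr_ge0; apply: mulr_ge0 => //; [exact: ltW|apply: mulr_ge0 => //; exact: sqr_ge0].
  - move=> w t sw td; rewrite !inE negb_or => /andP[xM xz].
    have td' : t <= delta by apply: le_trans td; exact: ler_norm.
    have td'' : - delta <= t by rewrite lerNl; apply: le_trans td; rewrite -normrN ler_norm.
    have he0 : 0 <= h w + e w.
      have F0 : 0 <= ft w by apply: le_trans (ft1 w).
      rewrite /h /e; apply: addr_ge0; last first.
        apply: addr_ge0; last by rewrite mulr_ge0.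
        by apply: mulr_ge0; apply: mulr_ge0 => //; [exact: ltW|apply: mulr_ge0 => //; exact: sqr_ge0].
      rewrite in_itv /=; have [Mw|] := ltP M w; last by rewrite mul0r.
      by apply: mulr_ge0 => //; apply: mulr_ge0 => //; exact: (tilt_rate_ge0 c1_gt0 S lamM (ltW Mw)).
    have [/andP[xM' xz']|out] := boolP (M < w + t < z); last first.
      rewrite (@derive1_comp_clamp_out _ (fun c => tilt c1 g lam c - 1)) //.
      move: out; rewrite negb_and -!leNgt => /orP[|]; rewrite le_eqVlt.
        by rewrite (negbTE xM) /= => ->.
      by rewrite eq_sym (negbTE xz) /= => ->; rewrite orbT.
    have Dt : is_derive (w + t) 1 (fun c => tilt c1 g lam c - 1)
        ((g (w + t) - lam) * tilt c1 g lam (w + t)).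
      by have := is_derive_sub (is_derive_tilt S lam (w + t)) (is_derive_const 1 (w + t)); rewrite subr0.
    rewrite (derive1_comp_clamp_in (f := fun c => tilt c1 g lam c - 1) _ Dt) ?xM' //.
    have gx0 := tilt_rate_ge0 c1_gt0 S lamM (ltW xM').
    have [wM|Mw] := leP w M.
      rewrite /h /e in_itv /= ltNge wM /= !mul0r mulr0 !add0r mulr1.
      have x1 : w + t <= M + 1 by lra.
      have gx : g (w + t) <= k5 by exact: (Hk5 _ _ _ dg _ x1).
      apply: ler_pM => //; first exact/ltW/tilt_gt0; first by lra.
      rewrite /tilt ler_expR.
      have := potential_increment_le dg (ltW xM').
      have := mulr_ge0 lam0 (ltW (_ : 0 < w + t - M)); rewrite subr_gt0 => /(_ xM').
      have : g (w + t) * (w + t - M) <= k5 * 1.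
        apply: ler_pM => //; [by lra|by lra|by lra].
      by lra.
    have wz : w <= z + delta by lra.
    have b1 : (w \in `]M, (z + delta)]) = true by rewrite in_itv /= Mw wz.
    have b2 : (w <= M) = false by rewrite leNgt Mw.
    rewrite /h /e b1 b2 !mul1r mulr0 addr0.
    (* A step to the left can only decrease the derivative (g - lam) f. *)
    have [t0|t0] := leP 0 t.
      have wz' : w <= z by lra.
      have -> : ft w = tilt c1 g lam w by rewrite /ft clamp_id // (ltW Mw).
      have := tilt_step d1_gt0 c1_gt0 c2_gt0 c3_ge1 S lam0 lamM (ltW Mw) t0 td'.
      move=> /(_ _); rewrite mulrA; apply.
      by move: sw; rewrite gtr0_norm //; exact: (setting_drift_gt0 c1_gt0 S (ltW Mw)).
    have xw : w + t <= w by lra.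
    have Fx : tilt c1 g lam (w + t) <= ft w.
      have -> : tilt c1 g lam (w + t) = ft (w + t) by rewrite /ft clamp_id // !ltW.
      exact: (tilt_clamp_homo c1_gt0 S lamM Mz xw).
    apply: (@le_trans _ _ ((g w - lam) * ft w)).
      apply: ler_pM => //; first exact/ltW/tilt_gt0.
      by rewrite lerD2r; exact: (drift_homo dg).
    rewrite lerDl; apply: mulr_ge0; first by rewrite mulr_ge0 // ltW.
    by apply: mulr_ge0; [exact: sqr_ge0|apply: le_trans (ft1 w)].
  - move=> w sw.
    have F1 := ft1 w; have [wM|Mw] := leP w M.
      rewrite /q /h /e in_itv /= (ltNge M) wM /= (ftM _ wM) subrr.
      have -> : (z + delta < w)%R = false by apply/negbTE; rewrite -leNgt; lra.
      by rewrite !mul0r normr0 !mulr0 mul0r !mul0r !add0r; have := normr_ge0 (g w); lra.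
    have gw0 := setting_drift_gt0 c1_gt0 S (ltW Mw).
    have [wz|zw] := leP w (z + delta).
      have b1 : (w \in `]M, (z + delta)]) = true by rewrite in_itv /= Mw wz.
      have b2 : (w <= M) = false by rewrite leNgt Mw.
      have b3 : (z + delta < w) = false by rewrite ltNge wz.
      rewrite /q /h /e b1 b2 b3.
      rewrite !mul1r !mul0r !mulr0 addr0 add0r.
      have r0 := tilt_rate_ge0 c1_gt0 S lamM (ltW Mw).
      have me := moderate_error S Mz mz (ltW Mw) wz.
      rewrite (gtr0_norm gw0) (ger0_norm (mulr_ge0 r0 (le_trans ler01 F1))).
      rewrite (ger0_norm (_ : 0 <= ft w - 1)) ?subr_ge0 //.
      have R1 : (ft w - 1) * Num.min (alpha * (g w + 1)) (delta2 * (g w `^ tau2 + 1)) <=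
          ft w * (delta2 * (g w `^ tau2 + 1)).
        apply: ler_pM; rewrite ?subr_ge0 //; last by rewrite ge_min lexx orbT.
          rewrite le_min !mulr_ge0 // ?addr_ge0 ?powR_ge0 // ?(ltW gw0) //.
          exact: (setting_delta2_ge0 S).
        by lra.
      have dl1_ge0 := setting_delta1_ge0 S.
      have R2 : delta1 * ((g w - lam) * ft w) * (g w `^ tau1 + 1) <=
          ft w * (delta1 * (g w * (g w `^ tau1 + 1))).
        have -> : delta1 * ((g w - lam) * ft w) * (g w `^ tau1 + 1) =
          ft w * (delta1 * ((g w - lam) * (g w `^ tau1 + 1))) by ring.
        apply: ler_wpM2l; first by lra.
        apply: ler_wpM2l => //; apply: ler_wpM2r; first by rewrite addr_ge0 // powR_ge0.
        by lra.
      have R3 := ler_wpM2l (le_trans ler01 F1) me.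
      have R4 : lam * ft w = 2 * (C1 / z * ft w) by rewrite /lam; ring.
      have := mulr_ge0 hd0 k4_ge0.
      move: R1 R2 R3 R4; rewrite -/C1.
      set Y1 := (ft w - 1) * Num.min _ _; set Y2 := delta1 * (_ * _) * _.
      set F := ft w; set cz := C1 / z; set p1 := g w `^ tau1; set p2 := g w `^ tau2; lra.
    have b1 : (w \in `]M, (z + delta)]) = false by rewrite in_itv /= Mw leNgt zw.
    have b2 : (w <= M) = false by rewrite leNgt Mw.
    rewrite /q /h /e b1 b2 zw /=.
    rewrite !mul0r normr0 !mulr0 mul0r mul1r !addr0 !subr0 add0r mulr0 subr0.
    have zw' : z <= w by lra.
    rewrite (ftz _ zw'); have := F1; rewrite (ftz _ zw').
    set F := tilt c1 g lam z => F1'.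
    have := remainder_lt_drift c1_gt0 tau2_gt0 alpha01 S (ltW Mw).
    rewrite (gtr0_norm gw0) (ger0_norm (_ : 0 <= F - 1)) ?subr_ge0 //.
    set rho := Num.min _ _ => hr.
    have := ler_wpM2l (_ : 0 <= F - 1) hr; rewrite subr_ge0 => /(_ F1').
    have := mulr_ge0 hd0 k4_ge0; have := mulr_ge0 a0 (ltW gw0).
    rewrite /al; set Y := (F - 1) * rho; lra.
have {}hE : C1 / z * E (fun w => (w \in `]M, (z + delta)])%:R * ft w)
  + al * tilt c1 g lam z * E (fun w => (z + delta < w)%R%:R * g w) <= C'.
  move: hE; rewrite /q (expectD sE) // (expectZ sE) // (expectD sE) // (expectZ sE) //.
  rewrite (expectD sE) // (expectZ sE) // (expect_cst sE).
  by have := HCm _ _ _ _ _ S; rewrite /C'; lra.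
have oG : observable g delta d1 (fun w => (w \in `]M, z])%:R * expR (primitive0 g w)).
  split.
    apply: measurable_funM; first by case: (observable_itv g delta d1 M z false false).
    apply: measurableT_comp => //.
    exact: continuous_measurable_fun (potential_continuous dg).
  exists (expR (primitive0 g z)) => w _; rewrite in_itv /=.
  have [/andP[Mw wz]|_] := boolP (M < w <= z); last by rewrite mul0r normr0 expR_ge0.
  have w0 : 0 <= w by lra.
  rewrite mul1r (ger0_norm (expR_ge0 _)) ler_expR; exact: (potential_homo dg w0 wz).
have X1_ge0 : 0 <= E (fun w => (w \in `]M, (z + delta)])%:R * ft w).
  rewrite -[leLHS](expect_cst sE 0); apply: (expect_le sE) => // w _.
  by apply: mulr_ge0 => //; apply: le_trans (ft1 w).
have X2_ge0 : 0 <= E (fun w => (z + delta < w)%R%:R * g w).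
  rewrite -[leLHS](expect_cst sE 0); apply: (expect_le sE) => // w _.
  have [zw|_] := ltP (z + delta) w; last by rewrite mul0r.
  by apply: mulr_ge0 => //; apply: (drift_ge0 dg); lra.
have GM : primitive0 g M <= k5 * M.
  have := potential_increment_le dg (ltW M0); rewrite potential0 !subr0 => h'.
  apply: (le_trans h'); rewrite ler_pM2r //; apply: (Hk5 _ _ _ dg); lra.
have expE w : M <= w -> w <= z -> expR (primitive0 g w) <= k7 * tilt c1 g lam w.
  move=> Mw wz; rewrite /k7 /tilt -expRD ler_expR.
  have : lam * w <= 2 * C1.
    rewrite /lam mulrAC ler_pdivrMr // ler_pM2l //; lra.
  have := mulr_ge0 lam0 (ltW M0); lra.
have T0 : 0 < tilt c1 g lam z by exact: tilt_gt0.
have P1 : 0 <= C1 / z * E (fun w => (w \in `]M, (z + delta)])%:R * ft w).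
  by apply: mulr_ge0 => //; apply: divr_ge0; exact: ltW.
have P2 : 0 <= al * tilt c1 g lam z * E (fun w => (z + delta < w)%R%:R * g w).
  by apply: mulr_ge0 => //; apply: mulr_ge0; exact: ltW.
split.
  apply: (@le_trans _ _ (k7 * E (fun w => (w \in `]M, (z + delta)])%:R * ft w))).
    rewrite -(expectZ sE) //; apply: (expect_le sE) => //; first exact: observableM.
    move=> w _; rewrite !in_itv /=; have [Mw|_] := ltP M w; last by rewrite !mul0r mulr0.
    have [wz|_] := leP w z; last first.
      by rewrite mul0r !mulr_ge0 ?(ltW k7_gt0) //; apply: le_trans (ft1 w).
    have -> : w <= z + delta by lra.
    by rewrite !mul1r /ft clamp_id ?(ltW Mw) // expE // ltW.
  rewrite -mulrA; apply: ler_wpM2l; first exact: ltW.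
  apply: (@le_trans _ _ (C' / C1 * z)); last first.
    by apply: ler_wpM2r; [exact: ltW|rewrite lerDl].
  have : C1 / z * E (fun w => (w \in `]M, (z + delta)])%:R * ft w) <= C' by lra.
  set X := E _; rewrite mulrAC ler_pdivrMr // => hX.
  by rewrite mulrAC ler_pdivlMr // mulrC.
apply: (@le_trans _ _ (k7 * tilt c1 g lam z * E (fun w => (z + delta < w)%R%:R * g w))).
  by apply: ler_wpM2r => //; exact: expE.
rewrite -mulrA; apply: ler_wpM2l; first exact: ltW.
apply: (@le_trans _ _ (C' / al)); last by rewrite lerDr.
rewrite ler_pdivlMr //.
have : al * tilt c1 g lam z * E (fun w => (z + delta < w)%R%:R * g w) <= C' by lra.
by set X := E _; lra.
Qed.

End exponential_bound.

(** * Powers of g in the tail *)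

Section weighted_moments.
Context (R : realType) (d0 d1 c1 c2 c3 tau1 tau2 alpha gmax : R).
Hypotheses (d0_ge1 : 1 <= d0) (c1_gt0 : 0 < c1).
Hypotheses (c2_gt0 : 0 < c2) (c3_ge1 : 1 <= c3).
Hypotheses (tau2_gt0 : 0 < tau2) (alpha01 : 0 <= alpha < 1).
Hypothesis gmax_ge0 : 0 <= gmax.
Local Notation M := (crossover c1).
Local Notation setting := (setting d0 d1 c1 c2 c3 tau1 tau2 alpha gmax).
Local Notation k1 := (step_growth c1 c2 gmax).

(** The test function g^(m+1) - g(u)^(m+1), frozen at 0 below u.  The remainder
    R takes a fraction less than 1 of f g, and the derivative, of order
    g^(m+1), is absorbed by g^(m+2) where g is large.  What is left is of order
    g(u)^(m+1) g, over the slightly larger tail reached by steps of length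
    delta. *)
Lemma tail_power_bound (m : nat) : exists2 C, 0 <= C &
  forall g delta delta1 delta2 E, setting g delta delta1 delta2 E ->
  forall u, M + 1 <= u ->
  E (fun w => (u < w)%R%:R * g w ^+ m.+2) <=
  C * g u ^+ m.+1 * E (fun w => (u - delta < w)%R%:R * g w).
Proof.
have M0 := crossover_gt0 c1; have [a0 a1] := andP alpha01.
have hd0 : 0 <= d0 by apply: le_trans d0_ge1.
have hc3 : 0 <= c3 by apply: le_trans c3_ge1.
have k10 := step_growth_gt0 c1 c2_gt0 gmax_ge0.
pose k := m.+1%:R * (k1 ^+ m * (c3 * (M + k1))).
have k_ge0 : 0 <= k.
  apply: mulr_ge0 => //; apply: mulr_ge0; first by rewrite exprn_ge0 // ltW.
  by rewrite mulr_ge0 // addr_ge0 // ltW.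
pose al := (1 - alpha) / 4.
have al_gt0 : 0 < al by rewrite /al; lra.
pose Y := d0 * k / al.
have Y_ge0 : 0 <= Y by apply: divr_ge0; [exact: mulr_ge0|exact: ltW].
pose C1 := d0 * k * (Y ^+ m * M ^+ m.+1).
have C1_ge0 : 0 <= C1.
  apply: mulr_ge0; first exact: mulr_ge0.
  by rewrite mulr_ge0 ?exprn_ge0 // ltW.
pose C2 := 2 * al + C1 + d0 * k * M.
have C3_ge0 : 0 <= d0 * k * M by apply: mulr_ge0; [exact: mulr_ge0|exact: ltW].
have C2_ge0 : 0 <= C2 by rewrite /C2; lra.
exists (C2 / al); first by apply: divr_ge0 => //; exact: ltW.
move=> g delta delta1 delta2 E S u Mu.
have dg := setting_drift S; have dl0 := setting_delta_gt0 S; have dl1 := setting_delta_le1 S.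
have sE := setting_expect S.
have Mu' : M <= u by lra.
have gu0 := setting_drift_gt0 c1_gt0 S Mu'; have gu1 := setting_drift_ge1 c1_gt0 S Mu'.
have og := setting_observable_drift S; have on := observable_norm og.
have oc c : observable g delta d1 (fun=> c) by exact: observable_cst.
have oJ : observable g delta d1 (fun w => (u < w)%R%:R) by exact: observable_gt.
have oK : observable g delta d1 (fun w => (u - delta < w)%R%:R) by exact: observable_gt.
pose e w := k * ((u - delta < w)%R%:R * g w ^+ m.+1).
pose q w := al * ((u < w)%R%:R * g w ^+ m.+2) +
  - (C2 * g u ^+ m.+1) * ((u - delta < w)%R%:R * g w).
have oe : observable g delta d1 e.
  by apply: observableM => //; apply: observableM => //; exact: observable_expr.
have oq1 : observable g delta d1 (fun w => (u < w)%R%:R * g w ^+ m.+2).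
  by apply: observableM => //; exact: observable_expr.
have oq2 : observable g delta d1 (fun w => (u - delta < w)%R%:R * g w).
  exact: observableM.
have oq1' : observable g delta d1 (fun w => al * ((u < w)%R%:R * g w ^+ m.+2)).
  exact: observableM.
have oq2' : observable g delta d1 (fun w => - (C2 * g u ^+ m.+1) * ((u - delta < w)%R%:R * g w)).
  exact: observableM.
have oq : observable g delta d1 q by exact: observableD.
have gpos w : u - delta < w -> M <= w by move=> uw; lra.
pose f w := g (Num.max w u) ^+ m.+1 - g u ^+ m.+1.
have lf : locally_lipschitz f.
  apply: locally_lipschitz_add; last exact: locally_lipschitz_cst.
  apply: locally_lipschitz_expr.
  exact: (locally_lipschitz_comp (drift_lipschitz c3_ge1 dg) (@locally_lipschitz_max R u)).
have fhi w : u <= w -> f w = g w ^+ m.+1 - g u ^+ m.+1 by move=> uw; rewrite /f max_l.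
have flo w : w <= u -> f w = 0 by move=> wu; rewrite /f max_r // subrr.
have of_ : observable g delta d1 f.
  split; first by apply: continuous_measurable_fun; exact: locally_lipschitz_continuous.
  have [_ [B hB]] := observable_expr m.+1 og.
  exists (B + g u ^+ m.+1) => w sw; have [uw|/ltW wu] := leP u w.
    rewrite fhi // (le_trans (ler_normB _ _)) // lerD //; first exact: hB.
    by rewrite ger0_norm // exprn_ge0 // ltW.
  rewrite flo // normr0 addr_ge0 ?exprn_ge0 ?(ltW gu0) //.
  exact: le_trans (normr_ge0 _) (hB _ sw).
have hE : E q <= 0.
  apply: (expect_certificate sE (f := f) (h := fun=> 0) (e := e) (s := [:: u])) => //.
  - move=> w _; rewrite /e; apply: mulr_ge0 => //.
    have [uw|_] := ltP (u - delta) w; last by rewrite mul0r.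
    by rewrite mul1r exprn_ge0 // ltW // (setting_drift_gt0 c1_gt0 S (gpos _ uw)).
  - move=> w t sw td; rewrite inE => xu; rewrite add0r.
    have td' : t <= delta by apply: le_trans td; exact: ler_norm.
    have e_ge0 : 0 <= e w.
      rewrite /e; apply: mulr_ge0 => //.
      have [uw|_] := ltP (u - delta) w; last by rewrite mul0r.
      by rewrite mul1r exprn_ge0 // ltW // (setting_drift_gt0 c1_gt0 S (gpos _ uw)).
    have [ux|] := ltP u (w + t); last first.
      rewrite le_eqVlt (negbTE xu) /= => ux.
      have -> // : f^`()%classic (w + t) = 0.
      apply: (near_derive1 _ (is_derive_const (0 : R) (w + t))).
      by near=> y; apply: flo; apply/ltW; near: y; exact: lt_nbhsl.
    have Df : is_derive (w + t) 1 (fun y => g y ^+ m.+1 - g u ^+ m.+1)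
        (m.+1%:R * g (w + t) ^+ m * g^`()%classic (w + t)).
      have := is_derive_sub (is_derive_expr m.+1 (drift_is_derive dg (w + t)))
        (is_derive_const (g u ^+ m.+1) (w + t)).
      by rewrite subr0.
    rewrite (near_derive1 _ Df); last first.
      by near=> y; apply: fhi; apply/ltW; near: y; exact: lt_nbhsr.
    have uw : u - delta < w by lra.
    have Mw := gpos _ uw.
    have gw0 := setting_drift_gt0 c1_gt0 S Mw; have gw1 := setting_drift_ge1 c1_gt0 S Mw.
    have gx := drift_step_growth c1_gt0 c2_gt0 S Mw (le_trans td' dl1).
    have Mx : M <= w + t by lra.
    have gx0 := setting_drift_gt0 c1_gt0 S Mx.
    rewrite /e uw mul1r /k -!mulrA ler_pM2l //.
    have -> : k1 ^+ m * (c3 * ((M + k1) * g w ^+ m.+1)) =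
      (k1 * g w) ^+ m * (c3 * (M * g w + k1 * g w)) by rewrite exprS exprMn; ring.
    apply: (@le_trans _ _ (g (w + t) ^+ m * `|g^`()%classic (w + t)|)).
      by rewrite ler_wpM2l ?exprn_ge0 ?(ltW gx0) // ler_norm.
    apply: ler_pM; rewrite ?exprn_ge0 ?(ltW gx0) //.
      by rewrite lerXn2r ?nnegrE ?mulr_ge0 ?(ltW gx0) ?(ltW gw0) ?(ltW k10).
    apply: (le_trans (drift_derive_norm_le c3_ge1 dg _)).
    by rewrite (gtr0_norm gx0); apply: ler_wpM2l => //; lra.
  - move=> w sw; rewrite normr0 mulr0 mul0r !subr0.
    have [uw|wu] := ltP (u - delta) w; last first.
      have wu' : w <= u by lra.
      rewrite /q /e (ltNge u) wu' (ltNge (u - delta)) wu flo //=.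
      by rewrite !mul0r normr0 !mulr0 mul0r !subr0 addr0.
    have Mw := gpos _ uw.
    have gw0 := setting_drift_gt0 c1_gt0 S Mw; have gw1 := setting_drift_ge1 c1_gt0 S Mw.
    have [wu|uw'] := leP w u.
      rewrite /q /e (ltNge u) wu uw flo //= !mul0r normr0 mul0r mulr0 add0r !mul1r subr0 sub0r.
      rewrite mulNr lerN2.
      have h1 : g w ^+ m.+1 <= g u ^+ m.+1 * (M * g w).
        rewrite -[leLHS]mulr1; apply: ler_pM => //; first by rewrite exprn_ge0 // ltW.
        by rewrite lerXn2r ?nnegrE ?(ltW gw0) ?(ltW gu0) //; exact: (drift_homo dg).
      have h2 := ler_wpM2l (mulr_ge0 hd0 k_ge0) h1.
      have h3 : 0 <= g u ^+ m.+1 * g w by rewrite mulr_ge0 ?exprn_ge0 ?(ltW gw0) ?(ltW gu0).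
      have h4 := mulr_ge0 (addr_ge0 (mulr_ge0 (ler0n R 2) (ltW al_gt0)) C1_ge0) h3.
      move: h2 h4; rewrite /C2; set X := g u ^+ m.+1; set Z := g w ^+ m.+1.
      by lra.
    have gu_le := drift_homo dg (ltW uw').
    rewrite /q /e uw uw' fhi ?(ltW uw') //= !mul1r.
    have pw : g u ^+ m.+1 <= g w ^+ m.+1.
      by rewrite lerXn2r ?nnegrE ?(ltW gw0) ?(ltW gu0).
    have f_ge0 : 0 <= g w ^+ m.+1 - g u ^+ m.+1 by rewrite subr_ge0.
    have hr := ler_wpM2l f_ge0 (remainder_lt_drift c1_gt0 tau2_gt0 alpha01 S Mw).
    rewrite (ger0_norm f_ge0).
    have h3 : d0 * k * g w ^+ m.+1 <= al * g w ^+ m.+2 + C1 * (g u ^+ m.+1 * g w).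
      have p0 : 0 <= g u ^+ m.+1 * g w by rewrite mulr_ge0 ?exprn_ge0 ?(ltW gw0) ?(ltW gu0).
      have p1 : 0 <= g w ^+ m.+1 by rewrite exprn_ge0 // ltW.
      have p2 : 0 <= g w ^+ m.+2 by rewrite exprn_ge0 // ltW.
      have [gY|/ltW gY] := leP Y (g w).
        have : d0 * k <= al * g w by rewrite [al * _]mulrC -ler_pdivrMr.
        move=> /(ler_wpM2r p1) hh.
        have := mulr_ge0 C1_ge0 p0; rewrite [g w ^+ m.+2]exprS; lra.
      have h5 : g w ^+ m.+1 <= Y ^+ m * g w.
        rewrite exprSr; apply: ler_wpM2r; first exact: ltW.
        by apply: lerXn2r => //; rewrite nnegrE ltW.
      have h6 : 1 <= M ^+ m.+1 * g u ^+ m.+1 by rewrite -exprMn exprn_ege1.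
      have h7 : Y ^+ m * g w <= Y ^+ m * M ^+ m.+1 * (g u ^+ m.+1 * g w).
        have := ler_wpM2l (mulr_ge0 (exprn_ge0 m Y_ge0) (ltW gw0)) h6.
        by rewrite mulr1; lra.
      have h8 := ler_wpM2l (mulr_ge0 hd0 k_ge0) (le_trans h5 h7).
      have := mulr_ge0 (ltW al_gt0) p2; rewrite /C1; lra.
    move: hr h3; rewrite (gtr0_norm gw0) /C2 [g w ^+ m.+2]exprSr.
    have := mulr_ge0 C3_ge0 (mulr_ge0 (exprn_ge0 m.+1 (ltW gu0)) (ltW gw0)).
    set rho := Num.min _ _; set X := g u ^+ m.+1; set Z := g w ^+ m.+1.
    rewrite /al; set Y1 := (Z - X) * rho; set K := d0 * k. have -> : d0 * (k * Z) = K * Z by rewrite mulrA. by lra.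
have : al * E (fun w => (u < w)%R%:R * g w ^+ m.+2) <=
    C2 * g u ^+ m.+1 * E (fun w => (u - delta < w)%R%:R * g w).
  by move: hE; rewrite /q (expectD sE) // !(expectZ sE) // mulNr subr_le0.
move=> h; rewrite -(ler_pM2l al_gt0); apply: (le_trans h).
by rewrite [C2 / al]mulrC !mulrA mulfV ?mul1r // gt_eqF.
Unshelve. all: by end_near. Qed.

End weighted_moments.

(** * Moments weighted by the exponential of G *)

Section gibbs_weighted_moments.
Context (R : realType) (d0 d1 c1 c2 c3 tau1 tau2 alpha gmax : R).
Hypotheses (d0_ge1 : 1 <= d0) (d1_gt0 : 0 < d1) (c1_gt0 : 0 < c1).
Hypotheses (c2_gt0 : 0 < c2) (c3_ge1 : 1 <= c3).
Hypotheses (tau1_gt0 : 0 < tau1) (tau2_gt0 : 0 < tau2) (alpha01 : 0 <= alpha < 1).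
Hypothesis gmax_ge0 : 0 <= gmax.
Local Notation M := (crossover c1).
Local Notation setting := (setting d0 d1 c1 c2 c3 tau1 tau2 alpha gmax).
Local Notation moderate := (moderate tau1 tau2).

(** Real exponents follow from large integer ones, since g(w) / g(u) >= 1 in
    the tail. *)
Lemma tail_powR_bound k : 0 < k -> exists2 C, 0 <= C &
  forall g delta delta1 delta2 E, setting g delta delta1 delta2 E ->
  forall u, M + 1 <= u ->
  E (fun w => (u < w)%R%:R * `|g w| `^ k) <=
  C * g u `^ (k - 1) * E (fun w => (u - delta < w)%R%:R * g w).
Proof.
move=> k0; pose m := Num.truncn k.
have [C C0 HC] := tail_power_bound d1 tau1 d0_ge1 c1_gt0 c2_gt0 c3_ge1 tau2_gt0 alpha01 gmax_ge0 m.
exists C => // g delta delta1 delta2 E S u Mu.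
have dg := setting_drift S; have dl0 := setting_delta_gt0 S; have sE := setting_expect S.
have Mu' : M <= u by lra.
have gu0 := setting_drift_gt0 c1_gt0 S Mu'.
have og := setting_observable_drift S.
have oJ : observable g delta d1 (fun w => (u < w)%R%:R) by exact: observable_gt.
have ok : observable g delta d1 (fun w => `|g w| `^ k) by exact: (setting_observable_powR S (ltW k0)).
have o1 : observable g delta d1 (fun w => (u < w)%R%:R * `|g w| `^ k) by exact: observableM.
have o2 : observable g delta d1 (fun w => (u < w)%R%:R * g w ^+ m.+2).
  by apply: observableM => //; exact: observable_expr.
pose a := g u `^ (k - 1) * (g u ^+ m.+1)^-1.
have a_ge0 : 0 <= a by rewrite mulr_ge0 ?powR_ge0 // invr_ge0 exprn_ge0 // ltW.
apply: (@le_trans _ _ (a * E (fun w => (u < w)%R%:R * g w ^+ m.+2))); last first.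
  apply: (le_trans (ler_wpM2l a_ge0 (HC _ _ _ _ _ S _ Mu))).
  have p0 : g u ^+ m.+1 != 0 by rewrite expf_neq0 // gt_eqF.
  set X := E _; move: p0; rewrite /a; set p := g u ^+ m.+1; set b := g u `^ (k - 1) => p0.
  by rewrite le_eqVlt; apply/orP; left; apply/eqP; field.
rewrite -(expectZ sE) //; apply: (expect_le sE) => //.
  by apply: observableM => //; exact: observable_cst.
move=> w _; have [uw|_] := ltP u w; last by rewrite !mul0r mulr0.
have guw := drift_homo dg (ltW uw); have gw0 : 0 < g w by lra.
rewrite !mul1r gtr0_norm // -(mulr_powRB1 (ltW gw0) k0) exprSr /a.
pose rr := g w / g u.
have rr1 : 1 <= rr by rewrite ler_pdivlMr // mul1r.
have gE : g w = g u * rr by rewrite mulrC divfK // gt_eqF.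
have rr0 : 0 <= rr by lra.
have h1 : g w `^ (k - 1) = g u `^ (k - 1) * rr `^ (k - 1) by rewrite {1}gE powRM // ltW.
have h2 : rr `^ (k - 1) <= rr ^+ m.+1.
  rewrite -powR_mulrn //; apply: ler_powR => //.
  have := truncnS_gt k; rewrite -/m; lra.
have h3 : rr ^+ m.+1 = (g u ^+ m.+1)^-1 * g w ^+ m.+1.
  by rewrite /rr expr_div_n mulrC.
rewrite h1 mulrC -mulrA mulrA -mulrA -mulrA ler_wpM2l ?powR_ge0 //.
by rewrite mulrA -h3 ler_wpM2r // ltW.
Qed.

Lemma expect_powR_le k : 0 < k -> exists2 C, 0 <= C &
  forall g delta delta1 delta2 E, setting g delta delta1 delta2 E ->
  E (fun w => 1 + `|g w| `^ k) <= C.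
Proof.
move=> k0; pose m := Num.truncn k.
have [C C0 HC] := drift_moment d1 c1 tau1 tau2 gmax d0_ge1 c2_gt0 c3_ge1 alpha01 m.
exists (2 + C) => [|g delta delta1 delta2 E S]; first by lra.
have sE := setting_expect S; have on := observable_norm (setting_observable_drift S).
have o1 := observable_cst g delta d1 1; have o2 := observable_cst g delta d1 2.
have ok := setting_observable_powR S (ltW k0).
have om := observable_expr (2 * m).+2 on.
apply: (@le_trans _ _ (E (fun w => 2 + `|g w| ^+ (2 * m).+2))); last first.
  by rewrite (expectD sE) // (expect_cst sE) lerD2l; exact: HC S.
apply: (expect_le sE); [exact: observableD|exact: observableD|move=> w _].
have : `|g w| `^ k <= 1 + `|g w| ^+ (2 * m).+2.
  apply: powR_le_1_expr => //; first exact: ltW.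
  apply: (@le_trans _ _ m.+1%:R); first exact/ltW/truncnS_gt.
  by rewrite ler_nat ltnS (leq_trans _ (leqnSn _)) // mulnC leq_pmulr.
by lra.
Qed.

Lemma moderate_le g delta delta1 delta2 E u z : setting g delta delta1 delta2 E ->
  0 <= u -> u <= z -> moderate g delta delta1 delta2 z ->
  moderate g delta delta1 delta2 u.
Proof.
move=> S u0 uz; apply: le_trans; have dg := setting_drift S.
have z0 : 0 <= z by lra.
have gu := drift_ge0 dg u0; have guz := drift_homo dg uz; have gz := drift_ge0 dg z0.
have dl := ltW (setting_delta_gt0 S).
have dl1 := setting_delta1_ge0 S; have dl2 := setting_delta2_ge0 S.
apply: lerD; [apply: lerD|]; apply: ler_pM; rewrite ?mulr_ge0 ?sqr_ge0 ?powR_ge0 ?ler_wpM2l //.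
- by rewrite lerXn2r ?nnegrE.
- by apply: ge0_ler_powR; rewrite ?nnegrE //; have := tau1_gt0; lra.
- by apply: ge0_ler_powR; rewrite ?nnegrE //; exact: ltW.
Qed.

Lemma moderate_delta_drift g delta delta1 delta2 E z : setting g delta delta1 delta2 E ->
  M <= z -> moderate g delta delta1 delta2 z -> delta * g z <= 1 /\ 1 <= z * g z.
Proof.
move=> S Mz; have dg := setting_drift S; have M0 := crossover_gt0 c1.
have gz0 := setting_drift_gt0 c1_gt0 S Mz; have gz1 := setting_drift_ge1 c1_gt0 S Mz.
have dl := setting_delta_gt0 S.
have dl1 := setting_delta1_ge0 S; have dl2 := setting_delta2_ge0 S.
have z0 : 0 < z by lra.
have zg : 1 <= z * g z by apply: (le_trans gz1); rewrite ler_pM2r.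
rewrite /moderate => mz; split => //.
have h1 : delta * z * g z ^+ 2 <= 1.
  apply: le_trans mz; rewrite -addrA lerDl; apply: addr_ge0.
    by apply: mulr_ge0 (powR_ge0 _ _); apply: mulr_ge0 => //; exact: ltW.
  by apply: mulr_ge0 (powR_ge0 _ _); apply: mulr_ge0 => //; exact: ltW.
apply: le_trans h1; rewrite -[leLHS]mulr1.
have -> : delta * z * g z ^+ 2 = delta * g z * (z * g z) by ring.
by rewrite ler_pM2l // mulr_gt0.
Qed.

Definition gibbs_weight (g : R -> R) z w := expR (primitive0 g (clamp 0 z w)).

Lemma gibbs_weight_ge1 g z w : drift c1 c2 c3 gmax g -> 1 <= gibbs_weight g z w.
Proof. by move=> dg; rewrite /gibbs_weight -expR0 ler_expR (potential_ge0 dg). Qed.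

Lemma observable_gibbs_weight g delta z : drift c1 c2 c3 gmax g -> 0 <= z ->
  observable g delta d1 (gibbs_weight g z).
Proof.
move=> dg z0; apply: (@observable_bounded _ _ _ _ _ (expR (primitive0 g z))).
  apply: locally_lipschitz_continuous.
  apply: (locally_lipschitz_comp (@locally_lipschitz_expR R)).
  exact: (locally_lipschitz_comp (potential_lipschitz dg) (@locally_lipschitz_clamp R 0 z)).
move=> w; rewrite (ger0_norm (expR_ge0 _)) ler_expR.
apply: (potential_homo dg); [exact: clamp_ge|exact: clamp_le].
Qed.

(** Splitting at M and z: below M the weight is bounded and the moments of g
    apply; on (M, z] the first half of [exponential_bound] gives C z g(z)^k;
    beyond z, [tail_power_bound] reduces to the first moment of g over
    W > z - delta, which the second half controls.  For bounded z the weight is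
    bounded everywhere. *)
Lemma gibbs_weighted_moment k : 0 < k -> exists2 C, 0 <= C &
  forall g delta delta1 delta2 E, setting g delta delta1 delta2 E ->
  forall z, 0 <= z -> moderate g delta delta1 delta2 z ->
  E (fun w => gibbs_weight g z w * (1 + `|g w| `^ k)) <= C * (1 + z * g z `^ k).
Proof.
move=> k0.
have [Cm Cm0 HCm] := expect_powR_le k0.
have [CA CA0 [Z MZ HCA]] := exponential_bound d0_ge1 d1_gt0 c1_gt0 c2_gt0 c3_ge1
  tau1_gt0 tau2_gt0 alpha01 gmax_ge0.
have [CB CB0 HCB] := tail_powR_bound k0.
have M0 := crossover_gt0 c1; have M1 := crossover_ge1 c1.
pose Z3 := Z + 3.
have [k5 k5_ge0 Hk5] := drift_bounded gmax c2_gt0 Z3.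
pose e5 := expR (k5 * Z3).
have e5_ge0 : 0 <= e5 by exact: expR_ge0.
pose Mk := 1 + M `^ k.
have Mk0 : 0 <= Mk by rewrite addr_ge0 // powR_ge0.
pose C1 := Mk * CA; pose C2 := Mk * (CB * (expR 2 * CA)).
have C1_ge0 : 0 <= C1 by exact: mulr_ge0.
have C2_ge0 : 0 <= C2 by rewrite /C2 !mulr_ge0 ?expR_ge0.
exists (e5 * Cm + C1 + C2); first by rewrite !addr_ge0 // mulr_ge0.
move=> g delta delta1 delta2 E S z z0 mz.
have dg := setting_drift S; have dl0 := setting_delta_gt0 S; have dl1 := setting_delta_le1 S.
have sE := setting_expect S; have og := setting_observable_drift S.
have ok := setting_observable_powR S (ltW k0).
have oc c : observable g delta d1 (fun=> c) by exact: observable_cst.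
have o1k : observable g delta d1 (fun w => 1 + `|g w| `^ k) by exact: observableD.
have oL := observable_gibbs_weight delta dg z0.
have oLk : observable g delta d1 (fun w => gibbs_weight g z w * (1 + `|g w| `^ k)) by exact: observableM.
have X_ge0 : 0 <= z * g z `^ k by rewrite mulr_ge0 // powR_ge0.
have GZ y : 0 <= y -> y <= Z3 -> primitive0 g y <= k5 * Z3.
  move=> y0 yZ; have := potential_increment_le dg y0; rewrite potential0 !subr0 => h.
  apply: (le_trans h); apply: ler_pM => //; first exact: (drift_ge0 dg).
  exact: (Hk5 _ _ _ dg).
have EP : e5 * E (fun w => 1 + `|g w| `^ k) <= e5 * Cm.
  by apply: ler_wpM2l => //; exact: HCm S.
have p0 w : 0 <= 1 + `|g w| `^ k by rewrite addr_ge0 // powR_ge0.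
have eCm := mulr_ge0 e5_ge0 Cm0.
have [zZ|Zz] := leP z Z3.
  apply: (@le_trans _ _ (e5 * Cm)); last first.
    have := mulr_ge0 eCm X_ge0; have := mulr_ge0 C1_ge0 X_ge0; have := mulr_ge0 C2_ge0 X_ge0.
    by lra.
  apply: le_trans EP; rewrite -(expectZ sE) //; apply: (expect_le sE) => //.
    exact: observableM.
  move=> w _; apply: ler_wpM2r => //; rewrite ler_expR; apply: GZ; first exact: clamp_ge.
  by apply: le_trans zZ; exact: clamp_le.
have Mz : M <= z by rewrite /Z3 in Zz; lra.
have gz0 := setting_drift_gt0 c1_gt0 S Mz.
have [dgz zgz] := moderate_delta_drift S Mz mz.
have zd0 : 0 <= z - delta by lra.
pose I1 w := (w \in `]M, z])%:R * expR (primitive0 g w).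
pose I2 w := (z < w)%R%:R * `|g w| `^ k.
have oI1 : observable g delta d1 I1.
  split.
    apply: measurable_funM; first by case: (observable_itv g delta d1 M z false false).
    apply: measurableT_comp => //.
    exact: continuous_measurable_fun (potential_continuous dg).
  exists (expR (primitive0 g z)) => w _; rewrite /I1 in_itv /=.
  have [/andP[Mw wz]|_] := boolP (M < w <= z); last by rewrite mul0r normr0 expR_ge0.
  have w0 : 0 <= w by lra.
  rewrite mul1r (ger0_norm (expR_ge0 _)) ler_expR; exact: (potential_homo dg w0 wz).
have oI2 : observable g delta d1 I2.
  by apply: observableM => //; exact: observable_gt.
pose b1 := Mk * g z `^ k; pose b2 := Mk * expR (primitive0 g z).
have b1_ge0 : 0 <= b1 by rewrite mulr_ge0 // powR_ge0.
have b2_ge0 : 0 <= b2 by rewrite mulr_ge0 // expR_ge0.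
have oA : observable g delta d1 (fun w => e5 * (1 + `|g w| `^ k)) by exact: (observableM (oc _) o1k).
have oB1 : observable g delta d1 (fun w => b1 * I1 w) by exact: (observableM (oc _) oI1).
have oB2 : observable g delta d1 (fun w => b2 * I2 w) by exact: (observableM (oc _) oI2).
have oB := observableD oB1 oB2.
have split3 : E (fun w => gibbs_weight g z w * (1 + `|g w| `^ k)) <=
    E (fun w => e5 * (1 + `|g w| `^ k) + (b1 * I1 w + b2 * I2 w)).
  apply: (expect_le sE) => //; first exact: observableD.
  move=> w _; have A0 := mulr_ge0 e5_ge0 (p0 w).
  have I2_ge0 : 0 <= I2 w by rewrite /I2 mulr_ge0 // powR_ge0.
  have I1_ge0 : 0 <= I1 w by rewrite /I1 mulr_ge0 // expR_ge0.
  have B1 := mulr_ge0 b1_ge0 I1_ge0; have B2 := mulr_ge0 b2_ge0 I2_ge0.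
  have [wM|Mw] := leP w M.
    apply: (@le_trans _ _ (e5 * (1 + `|g w| `^ k))); last by rewrite lerDl addr_ge0.
    apply: ler_wpM2r => //; rewrite ler_expR; apply: GZ; first exact: clamp_ge.
    apply: (@le_trans _ _ (clamp 0 z M)); first exact: clamp_homo.
    rewrite clamp_id ?Mz ?(ltW M0) //; rewrite /Z3; lra.
  have gw0 := setting_drift_gt0 c1_gt0 S (ltW Mw).
  have gw1 := setting_drift_ge1 c1_gt0 S (ltW Mw).
  have h1 : 1 + `|g w| `^ k <= Mk * `|g w| `^ k.
    have h2 : 1 <= M `^ k * `|g w| `^ k.
      rewrite -powRM ?(ltW M0) // (gtr0_norm gw0) -[leLHS](_ : 1 `^ k = 1); last by rewrite powR1.
      by apply: ge0_ler_powR; rewrite ?nnegrE ?(ltW k0) //; lra.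
    by rewrite /Mk; lra.
  have [wz|zw] := leP w z.
    apply: (@le_trans _ _ (b1 * I1 w)); last by lra.
    have w0 : 0 <= w by lra.
    have -> : I1 w = gibbs_weight g z w.
      by rewrite /I1 /gibbs_weight in_itv /= Mw wz mul1r clamp_id // w0.
    rewrite mulrC; apply: ler_wpM2r; first exact: expR_ge0.
    apply: (le_trans h1); apply: ler_wpM2l => //.
    by rewrite (gtr0_norm gw0); apply: ge0_ler_powR; rewrite ?nnegrE ?(ltW k0) ?(ltW gw0) ?(ltW gz0) //; exact: (drift_homo dg).
  apply: (@le_trans _ _ (b2 * I2 w)); last by lra.
  rewrite /I2 zw mul1r /gibbs_weight clamp_hi ?(ltW zw) // /b2 mulrAC mulrC.
  by apply: ler_wpM2r => //; exact: expR_ge0.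
apply: (le_trans split3); rewrite (expectD sE oA oB) (expectD sE oB1 oB2).
rewrite (expectZ sE _ o1k) (expectZ sE _ oI1) (expectZ sE _ oI2).
(* With this u the tail W > u + delta of the second half is W > z - delta.  As
   delta g(z) <= 1, G(z) exceeds G(u) by at most 2. *)
pose u := z - 2 * delta.
have Zu : Z <= u by rewrite /u; rewrite /Z3 in Zz; lra.
have u0 : 0 <= u by lra.
have uz : u <= z by rewrite /u; lra.
have mu := moderate_le S u0 uz mz.
have [_ Hu] := HCA _ _ _ _ _ S _ Zu mu.
have Zz' : Z <= z by rewrite /Z3 in Zz; lra.
have [Hz _] := HCA _ _ _ _ _ S _ Zz' mz.
have PB1 : b1 * E I1 <= C1 * (z * g z `^ k).
  have := ler_wpM2l b1_ge0 Hz; rewrite -/(I1) /b1 /C1; lra.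
have ud : u + delta = z - delta by rewrite /u; lra.
rewrite ud in Hu.
have Mz1 : M + 1 <= z by rewrite /Z3 in Zz; lra.
have PB2 : b2 * E I2 <= C2 * (z * g z `^ k).
  have HB := HCB _ _ _ _ _ S _ Mz1; rewrite -/(I2) in HB.
  set T := E (fun w => (z - delta < w)%R%:R * g w) in Hu HB.
  have Gzu : expR (primitive0 g z) <= expR 2 * expR (primitive0 g u).
    rewrite -expRD ler_expR; have := potential_increment_le dg uz.
    by rewrite /u; lra.
  have T_ge0 : 0 <= T.
    rewrite -[leLHS](expect_cst sE 0); apply: (expect_le sE) => //.
      by apply: observableM => //; exact: observable_gt.
    move=> w _; have [zw|_] := ltP (z - delta) w; last by rewrite mul0r.
    by rewrite mul1r; apply: (drift_ge0 dg); exact: le_trans zd0 (ltW zw).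
  have ET : expR (primitive0 g z) * T <= expR 2 * CA.
    apply: (le_trans (ler_wpM2r T_ge0 Gzu)); rewrite -mulrA.
    by apply: ler_wpM2l; [exact: expR_ge0|exact: Hu].
  have gk : g z `^ (k - 1) <= z * g z `^ k.
    rewrite -(mulr_powRB1 (ltW gz0) k0) mulrA -[leLHS]mul1r.
    by apply: ler_wpM2r => //; exact: powR_ge0.
  have eT0 : 0 <= expR (primitive0 g z) * T by apply: mulr_ge0 => //; exact: expR_ge0.
  have F := ler_pM eT0 (powR_ge0 (g z) (k - 1)) ET gk.
  have F' := ler_wpM2l Mk0 (ler_wpM2l CB0 F).
  have H' := ler_wpM2l b2_ge0 HB.
  move: F' H'; rewrite /b2 /C2; clear.
  set a1 := Mk; set a2 := expR _; set a3 := expR 2; set a4 := E _; set a5 := T.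
  set a6 := g z `^ (k - 1); set a7 := g z `^ k.
  move=> F' H'; apply: (le_trans H').
  have -> : a1 * a2 * (CB * a6 * a5) = a1 * (CB * (a2 * a5 * a6)) by ring.
  by apply: (le_trans F'); rewrite !mulrA.
have := mulr_ge0 eCm X_ge0; lra.
Qed.

End gibbs_weighted_moments.

#[local] Opaque lower_mass.

(** * The solution of the Stein equation *)

Section stein_solution.
Context (R : realType) (c1 c2 c3 gmax : R).
Hypotheses (c1_gt0 : 0 < c1) (c2_gt0 : 0 < c2) (c3_ge1 : 1 <= c3).
Variables (g : R -> R) (dg : drift c1 c2 c3 gmax g) (z : R).
Hypothesis z_ge0 : 0 <= z.
Local Notation G := (primitive0 g).
Local Notation A := (lower_mass c1 g).

Definition inv_density w := expR (G w) / c1.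
Definition lower_ratio w := A w * inv_density w.
Definition upper_ratio w := (1 - A w) * inv_density w.

(** The solution is b A / p on the left of z and A(z) (1 - A) / p on the right.
    In this form, with the variable truncated by min and max, its Lipschitz
    continuity needs no case distinction. *)
Definition stein_solution w := (1 - A z) * lower_ratio (Num.min w z) +
  A z * (upper_ratio (Num.max w z) - upper_ratio z).

(** The derivative of the solution except at z, where it is left-continuous and
    jumps by -1. *)
Definition stein_solution_derive w := g w * stein_solution w + (w <= z)%R%:R - A z.

Lemma inv_density_gt0 w : 0 < inv_density w.
Proof. by apply: divr_gt0 => //; exact: expR_gt0. Qed.

Lemma mul_inv_density w : density c1 g w * inv_density w = 1.
Proof.
rewrite /density /inv_density expRN; field.
by rewrite gt_eqF // gt_eqF // expR_gt0.
Qed.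

Lemma is_derive_inv_density (w : R) : is_derive w 1 inv_density (g w * inv_density w).
Proof.
have h := is_derive_mulc c1^-1 (is_derive_expR_comp (is_derive_potential dg w)).
rewrite /inv_density mulrA mulrC.
by apply: is_derive_eqf h => t; rewrite mulrC.
Qed.

Lemma is_derive_lower_ratio (w : R) : is_derive w 1 lower_ratio (1 + g w * lower_ratio w).
Proof.
have := is_derive_mul (is_derive_lower_mass c1_gt0 dg w) (is_derive_inv_density w).
by rewrite mul_inv_density mulrCA.
Qed.

Lemma is_derive_upper_ratio (w : R) : is_derive w 1 upper_ratio (g w * upper_ratio w - 1).
Proof.
have h : is_derive w 1 (fun t => 1 - A t) (- density c1 g w).
  by have := is_derive_sub (is_derive_const 1 w) (is_derive_lower_mass c1_gt0 dg w); rewrite sub0r.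
have := is_derive_mul h (is_derive_inv_density w).
by rewrite mulNr mul_inv_density mulrCA addrC.
Qed.

Lemma lower_ratio_ge0 w : 0 <= lower_ratio w.
Proof. by apply: mulr_ge0; [exact: lower_mass_ge0|exact/ltW/inv_density_gt0]. Qed.

Lemma upper_ratio_ge0 w : 0 <= upper_ratio w.
Proof.
apply: mulr_ge0; last exact/ltW/inv_density_gt0.
by rewrite subr_ge0; exact: (lower_mass_le1 c1_gt0 dg).
Qed.

Lemma lower_ratio_slope w : 0 <= 1 + g w * lower_ratio w.
Proof.
have [w0|/ltW w0] := leP 0 w.
  by rewrite addr_ge0 // mulr_ge0 ?lower_ratio_ge0 // (drift_ge0 dg).
have := lower_mass_drift_le c1_gt0 dg w0; rewrite (ler0_norm (drift_le0 dg w0)).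
move=> /(ler_wpM2r (ltW (inv_density_gt0 w))); rewrite mul_inv_density.
by rewrite /lower_ratio; lra.
Qed.

Lemma upper_ratio_slope w : 0 <= w -> 0 <= g w * upper_ratio w <= 1.
Proof.
move=> w0; rewrite mulr_ge0 ?upper_ratio_ge0 ?(drift_ge0 dg) //=.
have := upper_mass_drift_le c1_gt0 dg w0.
move=> /(ler_wpM2r (ltW (inv_density_gt0 w))); rewrite mul_inv_density.
by rewrite /upper_ratio; lra.
Qed.

Lemma lower_ratio_homo a b : a <= b -> lower_ratio a <= lower_ratio b.
Proof.
move=> ab; rewrite -subr_ge0 -[leLHS](mul0r (b - a)).
apply: (mvt_ge (f := lower_ratio) (df := fun w => 1 + g w * lower_ratio w) ab).
- by move=> x _; exact: is_derive_continuous (is_derive_lower_ratio x).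
- by move=> x _; exact: is_derive_lower_ratio.
- by move=> x _; exact: lower_ratio_slope.
Qed.

Lemma upper_ratio_anti a b : 0 <= a -> a <= b -> upper_ratio b <= upper_ratio a.
Proof.
move=> a0 ab; rewrite -subr_le0 -[leRHS](mul0r (b - a)).
apply: (mvt_le (f := upper_ratio) (df := fun w => g w * upper_ratio w - 1) ab).
- by move=> x _; exact: is_derive_continuous (is_derive_upper_ratio x).
- by move=> x _; exact: is_derive_upper_ratio.
- move=> x /andP[/ltW ax _]; rewrite subr_le0.
  by have /andP[] := upper_ratio_slope (le_trans a0 ax).
Qed.

Lemma inv_density_lipschitz : locally_lipschitz inv_density.
Proof.
apply: locally_lipschitz_mul; last exact: locally_lipschitz_cst.
apply: (locally_lipschitz_comp (@locally_lipschitz_expR R)).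
exact: (potential_lipschitz dg).
Qed.

Lemma density_le y : density c1 g y <= c1.
Proof.
rewrite /density -[leRHS]mulr1 (ler_pM2l c1_gt0) -expR0 ler_expR oppr_le0.
exact: (potential_ge0 dg).
Qed.

Lemma lower_mass_lipschitz : locally_lipschitz A.
Proof.
apply: locally_lipschitz_derive; first exact: (is_derive_lower_mass c1_gt0 dg).
move=> a b; exists c1 => x _; rewrite ger0_norm; last exact: density_ge0.
exact: density_le.
Qed.

Lemma stein_solution_lipschitz : locally_lipschitz stein_solution.
Proof.
apply: locally_lipschitz_add.
  apply: locally_lipschitz_mul; first exact: locally_lipschitz_cst.
  apply: (locally_lipschitz_comp (f := lower_ratio) _ (@locally_lipschitz_min R z)).
  apply: locally_lipschitz_mul; last exact: inv_density_lipschitz.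
  exact: lower_mass_lipschitz.
apply: locally_lipschitz_mul; first exact: locally_lipschitz_cst.
apply: locally_lipschitz_add; last exact: locally_lipschitz_cst.
apply: (locally_lipschitz_comp (f := upper_ratio) _ (@locally_lipschitz_max R z)).
apply: locally_lipschitz_mul; last exact: inv_density_lipschitz.
apply: locally_lipschitz_add; first exact: locally_lipschitz_cst.
by apply: locally_lipschitz_opp; exact: lower_mass_lipschitz.
Qed.

Lemma ratio_balance : A z * upper_ratio z = (1 - A z) * lower_ratio z.
Proof. by rewrite /upper_ratio /lower_ratio mulrCA. Qed.

#[local] Opaque lower_ratio upper_ratio.

Lemma stein_solution_lo w : w <= z -> stein_solution w = (1 - A z) * lower_ratio w.
Proof. by move=> wz; rewrite /stein_solution min_l // max_r // subrr mulr0 addr0. Qed.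

Lemma stein_solution_hi w : z <= w -> stein_solution w = A z * upper_ratio w.
Proof.
move=> zw; rewrite /stein_solution (min_r zw) (max_l zw) -ratio_balance -mulrDr.
by congr (_ * _); rewrite addrC subrK.
Qed.

Lemma is_derive_stein_solution (x : R) : x != z ->
  is_derive x 1 stein_solution (stein_solution_derive x).
Proof.
rewrite neq_lt /stein_solution_derive => /orP[xz|zx].
  rewrite (ltW xz) stein_solution_lo ?(ltW xz) //.
  have -> : g x * ((1 - A z) * lower_ratio x) + 1%:R - A z =
    (1 - A z) * (1 + g x * lower_ratio x) by ring.
  apply: is_derive_near (is_derive_mulc (1 - A z) (is_derive_lower_ratio x)).
  by near=> t; apply: stein_solution_lo; apply/ltW; near: t; exact: lt_nbhsl.
rewrite leNgt zx stein_solution_hi ?(ltW zx) //=.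
have -> : g x * (A z * upper_ratio x) + 0 - A z =
  A z * (g x * upper_ratio x - 1) by ring.
apply: is_derive_near (is_derive_mulc (A z) (is_derive_upper_ratio x)).
by near=> t; apply: stein_solution_hi; apply/ltW; near: t; exact: lt_nbhsr.
Unshelve. all: by end_near. Qed.

Lemma stein_solution_ge0 w : 0 <= stein_solution w.
Proof.
have A0 : 0 <= A z by exact: lower_mass_ge0.
have A1 : 0 <= 1 - A z by rewrite subr_ge0; exact: (lower_mass_le1 c1_gt0 dg).
have [wz|/ltW zw] := leP w z.
  by rewrite stein_solution_lo // mulr_ge0 ?lower_ratio_ge0.
by rewrite stein_solution_hi // mulr_ge0 ?upper_ratio_ge0.
Qed.

#[local] Transparent lower_ratio upper_ratio.

(** Both A / p and (1 - A) / p are monotone on the sides where they are used: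
    to the left of 0, respectively to the right of z, the value at the endpoint
    dominates, hence the frozen weight. *)
Lemma stein_solution_le w :
  stein_solution w <= (1 - A z) / c1 * gibbs_weight g z w.
Proof.
have A0 : 0 <= A z by exact: lower_mass_ge0.
have A1 : A z <= 1 by exact: (lower_mass_le1 c1_gt0 dg).
have A1' : 0 <= 1 - A z by rewrite subr_ge0.
have [wz|/ltW zw] := leP w z.
  rewrite stein_solution_lo // -mulrA; apply: ler_wpM2l => //.
  rewrite /gibbs_weight; have -> : clamp 0 z w = Num.max w 0.
    by rewrite /clamp min_l // ge_max wz.
  apply: (@le_trans _ _ (lower_ratio (Num.max w 0))).
    by apply: lower_ratio_homo; rewrite le_max lexx.
  rewrite /lower_ratio /inv_density mulrC [c1^-1 * _]mulrC -[leRHS]mulr1.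
  apply: ler_wpM2l; first exact/ltW/inv_density_gt0.
  exact: (lower_mass_le1 c1_gt0 dg).
rewrite stein_solution_hi // /gibbs_weight clamp_hi //.
apply: (@le_trans _ _ (upper_ratio w)).
  by rewrite -[leRHS]mul1r; apply: ler_wpM2r => //; exact: upper_ratio_ge0.
apply: (le_trans (upper_ratio_anti z_ge0 zw)).
by rewrite /upper_ratio /inv_density mulrA mulrAC.
Qed.

Definition mills_cst := c1 * expR (- (c2 * (gmax + 1))).

Lemma mills_cst_gt0 : 0 < mills_cst.
Proof. by apply: mulr_gt0 => //; exact: expR_gt0. Qed.

Lemma upper_mass_weight : mills_cst <= (1 - A z) * expR (G z) * (1 + g z).
Proof.
have g0 : 0 < 1 + g z by rewrite ltr_pwDl // (drift_ge0 dg).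
have := upper_mass_ge c1_gt0 c2_gt0 dg z_ge0; rewrite -/mills_cst.
rewrite expRN -invfM => h.
by rewrite -mulrA -ler_pdivrMr // mulr_gt0 // expR_gt0.
Qed.

Definition stein_derive_cst := 1 + c1^-1 + mills_cst^-1.

Lemma stein_derive_cst_ge0 : 0 <= stein_derive_cst.
Proof. by rewrite /stein_derive_cst !addr_ge0 // invr_ge0 ltW // mills_cst_gt0. Qed.

(** To the left of z the factor b is explicit.  To the right |f'| <= 1 only, and
    b reappears through the lower bound b e^(G(z)) (1 + g(z)) >= const. *)
Lemma stein_solution_derive_le w : `|stein_solution_derive w| <=
  stein_derive_cst * (1 - A z) * gibbs_weight g z w * (1 + `|g w|).
Proof.
have A0 : 0 <= A z by exact: lower_mass_ge0.
have A1 : A z <= 1 by exact: (lower_mass_le1 c1_gt0 dg).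
have A1' : 0 <= 1 - A z by rewrite subr_ge0.
have L1 : 1 <= gibbs_weight g z w by exact: (gibbs_weight_ge1 z w dg).
have ic1 : 0 <= c1^-1 by rewrite invr_ge0 ltW.
have im : 0 <= mills_cst^-1 by rewrite invr_ge0 ltW // mills_cst_gt0.
have y0 := normr_ge0 (g w).
have [wz|zw] := leP w z.
  have -> : stein_solution_derive w = (1 - A z) * (1 + g w * lower_ratio w).
    by rewrite /stein_solution_derive wz (stein_solution_lo wz) /=; ring.
  rewrite normrM (ger0_norm A1') (ger0_norm (lower_ratio_slope w)).
  have -> : stein_derive_cst * (1 - A z) * gibbs_weight g z w * (1 + `|g w|) =
    (1 - A z) * (stein_derive_cst * gibbs_weight g z w * (1 + `|g w|)) by ring.
  apply: ler_wpM2l => //.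
  have h1 : g w * lower_ratio w <= `|g w| * (c1^-1 * gibbs_weight g z w).
    have [w0|/ltW w0] := leP 0 w; last first.
      apply: (@le_trans _ _ 0).
        by rewrite mulr_le0_ge0 ?lower_ratio_ge0 // (drift_le0 dg).
      by rewrite !mulr_ge0 //; lra.
    rewrite (ger0_norm (drift_ge0 dg w0)); apply: ler_wpM2l; first exact: (drift_ge0 dg).
    rewrite /gibbs_weight clamp_id ?w0 // /lower_ratio /inv_density mulrC [c1^-1 * _]mulrC -[leRHS]mulr1.
    apply: ler_wpM2l; first exact/ltW/inv_density_gt0.
    exact: (lower_mass_le1 c1_gt0 dg).
  set L := gibbs_weight g z w in L1 h1 *; rewrite /stein_derive_cst.
  have L0 : 0 <= L by lra.
  have := mulr_ge0 (mulr_ge0 ic1 L0) y0; have := mulr_ge0 (mulr_ge0 im L0) y0.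
  have := mulr_ge0 ic1 L0; have := mulr_ge0 im L0; have := mulr_ge0 L0 y0; lra.
have -> : stein_solution_derive w = A z * (g w * upper_ratio w - 1).
  by rewrite /stein_solution_derive leNgt zw (stein_solution_hi (ltW zw)) /=; ring.
have w0 : 0 <= w by apply: le_trans (ltW zw).
have /andP[u0 u1] := upper_ratio_slope w0.
apply: (@le_trans _ _ 1).
  rewrite normrM (ger0_norm A0) -[leRHS]mulr1; apply: ler_pM => //.
  by rewrite ler_norml; apply/andP; split; lra.
have g_le : 1 + g z <= 1 + `|g w|.
  by rewrite lerD2l (ger0_norm (drift_ge0 dg w0)); exact/(drift_homo dg)/ltW.
have E0 : 0 <= (1 - A z) * expR (G z) by exact: (mulr_ge0 A1' (expR_ge0 _)).
have h : mills_cst <= (1 - A z) * expR (G z) * (1 + `|g w|).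
  exact: (le_trans upper_mass_weight (ler_wpM2l E0 g_le)).
rewrite /gibbs_weight (clamp_hi z_ge0 (ltW zw)).
have -> : stein_derive_cst * (1 - A z) * expR (G z) * (1 + `|g w|) =
   stein_derive_cst * ((1 - A z) * expR (G z) * (1 + `|g w|)) by ring.
have : 1 <= mills_cst^-1 * ((1 - A z) * expR (G z) * (1 + `|g w|)).
  by rewrite mulrC ler_pdivlMr ?mills_cst_gt0 // mul1r.
set X := _ * (1 + `|g w|); have X0 : 0 <= X by apply: (mulr_ge0 E0); rewrite addr_ge0.
move=> /le_trans; apply; apply: (ler_wpM2r X0).
by rewrite /stein_derive_cst lerDr addr_ge0.
Qed.

End stein_solution.

(** * Local regularity of the weight and of the Stein solution *)

Section comparison.
Context (R : realType) (d1 c1 c2 c3 gmax : R).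
Hypotheses (d1_gt0 : 0 < d1) (c1_gt0 : 0 < c1) (c2_gt0 : 0 < c2) (c3_ge1 : 1 <= c3).
Hypothesis gmax_ge0 : 0 <= gmax.

Lemma affine_le_square (y : R) :
  (1 + y) * y <= 2 * (1 + y ^+ 2) /\ 1 + y <= 2 * (1 + y ^+ 2).
Proof. by have := sqr_ge0 (y - 1); have := sqr_ge0 y; split; lra. Qed.

Lemma product_rule_bound (D k B y F1 F2 : R) : 0 <= D * B -> 0 <= k * B ->
  F1 <= D * B * (1 + y) * y -> F2 <= k * B * (1 + y) ->
  F1 + F2 <= (2 * D + 2 * k) * (B * (1 + y ^+ 2)).
Proof.
move=> DB kB h1 h2; have [Q1 Q2] := affine_le_square y.
by have := ler_wpM2l DB Q1; have := ler_wpM2l kB Q2; lra.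
Qed.

Lemma reassociate_factors (x1 x2 x3 x4 x5 : R) :
  x1 * x2 * x3 * (x4 * x5) = x4 * x2 * (x1 * x3) * x5.
Proof. by ring. Qed.

Lemma reassociate_bound (x1 x2 x3 x4 x5 x6 x7 : R) :
  x1 * x2 * x3 * x4 * x5 * (x6 * x7) = x1 * x5 * (x2 * x6 * (x3 * x7)) * x4.
Proof. by ring. Qed.

Section local_regularity.
Variables (g : R -> R) (dg : drift c1 c2 c3 gmax g) (z delta : R).
Hypotheses (z_ge0 : 0 <= z) (delta_ge0 : 0 <= delta) (delta_le1 : delta <= 1).
Local Notation G := (primitive0 g).
Local Notation L := (gibbs_weight g z).
Local Notation b := (1 - lower_mass c1 g z).
Local Notation f := (stein_solution c1 g z).

Definition weight_step_cst := expR (c2 * (d1 + gmax + 1)).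

(** G increases by at most delta g(w + t) = O(delta (|g(w)| + 1)) = O(1). *)
Lemma gibbs_weight_step w t : `|t| <= delta -> delta * `|g w| <= d1 ->
  L (w + t) <= weight_step_cst * L w.
Proof.
move=> td sw; have t1 := le_trans td delta_le1.
have gx := drift_shift_le c2_gt0 dg w t1.
have [|ltc] := leP (clamp 0 z (w + t)) (clamp 0 z w).
  move=> lec; apply: (@le_trans _ _ (L w)).
    rewrite /gibbs_weight ler_expR; apply: (potential_homo dg) => //; exact: clamp_ge.
  rewrite -[leLHS]mul1r; apply: ler_wpM2r; first exact: expR_ge0.
  rewrite /weight_step_cst -expR0 ler_expR; have hd1 := ltW d1_gt0; have hg := gmax_ge0.
  by rewrite mulr_ge0 ?(ltW c2_gt0) // !addr_ge0.
rewrite /gibbs_weight /weight_step_cst -expRD ler_expR.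
have := potential_increment_le dg (ltW ltc).
set cx := clamp 0 z (w + t) in ltc *; set cw := clamp 0 z w in ltc *.
have cw0 : 0 <= cw by exact: clamp_ge.
have cx_gt0 : 0 < cx by lra.
have cxle : cx <= w + t.
  rewrite leNgt; apply/negP => xc; move: cx_gt0; rewrite /cx /clamp lt_min => /andP[+ _].
  rewrite lt_max ltxx orbF => x0; move: xc; rewrite /cx /clamp.
  by rewrite max_l ?(ltW x0) // lt_min ltxx.
have cwle : w <= cw \/ z <= cw.
  rewrite /cw /clamp; have [|] := leP (Num.max w 0) z => _; first by left; rewrite le_max lexx.
  by right.
have step : cx - cw <= delta.
  have tle := le_trans (ler_norm t) td; case: cwle => h; first by lra.
  have : cx <= z by exact: clamp_le.
  by move: ltc; lra.
have g1 : g cx <= c2 * (`|g w| + gmax + 1).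
  apply: le_trans gx; apply: le_trans (ler_norm _); exact: (drift_homo dg).
have gc0 : 0 <= g cx by apply: (drift_ge0 dg); exact: ltW.
have P1 : g cx * (cx - cw) <= c2 * (`|g w| + gmax + 1) * delta.
  by apply: ler_pM => //; rewrite subr_ge0 ltW.
have hc2 := ltW c2_gt0; have hg := gmax_ge0.
have P2 : c2 * (`|g w| + gmax + 1) * delta <= c2 * (d1 + gmax + 1).
  rewrite -mulrA; apply: ler_wpM2l => //.
  have dle := delta_le1; have := ler_wpM2l hg dle; rewrite mulr1; lra.
by lra.
Qed.

Definition square_step_cst := 1 + 2 * (c2 * (gmax + 1)) ^+ 2.

Lemma drift_square_step w t : `|t| <= delta ->
  1 + `|g (w + t)| ^+ 2 <= square_step_cst * (1 + `|g w| ^+ 2).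
Proof.
move=> td; have t1 := le_trans td delta_le1.
have gx := drift_shift_le c2_gt0 dg w t1.
have hg := gmax_ge0; have y0 := normr_ge0 (g w).
rewrite /square_step_cst; set kk := c2 * (gmax + 1).
have kk0 : 0 <= kk by rewrite mulr_ge0 ?(ltW c2_gt0) // addr_ge0.
have h1 : `|g (w + t)| <= kk * (1 + `|g w|).
  apply: (le_trans gx); rewrite /kk -mulrA ler_pM2l //.
  by have := mulr_ge0 hg y0; lra.
have h2 : `|g (w + t)| ^+ 2 <= kk ^+ 2 * (1 + `|g w|) ^+ 2.
  rewrite -exprMn; apply: lerXn2r => //.
  by rewrite nnegrE; apply: mulr_ge0 => //; rewrite addr_ge0.
have h3 : (1 + `|g w|) ^+ 2 <= 2 * (1 + `|g w| ^+ 2).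
  by have := sqr_ge0 (1 - `|g w|); lra.
have := ler_wpM2l (sqr_ge0 kk) h3; have := sqr_ge0 `|g w|; lra.
Qed.

Definition product_derive_cst := 2 * stein_derive_cst c1 c2 gmax + 2 * c3 / c1.

Lemma product_derive_cst_ge0 : 0 <= product_derive_cst.
Proof.
apply: addr_ge0; first by rewrite mulr_ge0 // stein_derive_cst_ge0.
have hc3 : 0 <= c3 by apply: le_trans c3_ge1.
by rewrite divr_ge0 ?mulr_ge0 // ltW.
Qed.

Let b_ge0 : 0 <= b.
Proof. by rewrite subr_ge0; exact: (lower_mass_le1 c1_gt0 dg). Qed.

(** Away from z, f' - f g is locally constant, so the variation of f' over a
    step is that of the continuous function f g, whose derivative is bounded by
    a multiple of b L (1 + g^2). *)
Lemma stein_product_step w t : `|t| <= delta -> delta * `|g w| <= d1 ->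
  `|f (w + t) * g (w + t) - f w * g w| <=
  product_derive_cst * weight_step_cst * square_step_cst * delta * b * (L w * (1 + `|g w| ^+ 2)).
Proof.
move=> td sw.
pose df x := stein_solution_derive c1 g z x * g x + f x * g^`()%classic x.
set B := product_derive_cst * b * (weight_step_cst * L w * (square_step_cst * (1 + `|g w| ^+ 2))).
have B0 : 0 <= B.
  rewrite /B; apply: mulr_ge0; first exact: (mulr_ge0 product_derive_cst_ge0 b_ge0).
  apply: mulr_ge0; first by apply: mulr_ge0; exact: expR_ge0.
  apply: mulr_ge0; last by rewrite addr_ge0 // sqr_ge0.
  by rewrite /square_step_cst addr_ge0 // mulr_ge0 // sqr_ge0.
have key x : `|x - w| <= delta -> `|df x| <= B.
  move=> xw; have xE : x = w + (x - w) by rewrite addrC subrK.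
  have Lx := gibbs_weight_step xw sw; have gx := drift_square_step w xw.
  rewrite -xE in Lx gx.
  have L0 : 0 <= L x by exact: expR_ge0.
  have fx0 := stein_solution_ge0 c1_gt0 dg z x.
  have fx := stein_solution_le c1_gt0 dg z_ge0 x.
  have Fx := stein_solution_derive_le c1_gt0 c2_gt0 dg z_ge0 x.
  have g'x := drift_derive_norm_le c3_ge1 dg x.
  have y0 := normr_ge0 (g x).
  apply: (@le_trans _ _ (product_derive_cst * b * (L x * (1 + `|g x| ^+ 2)))); last first.
    rewrite /B; apply: ler_wpM2l; first exact: (mulr_ge0 product_derive_cst_ge0 b_ge0).
    by apply: (ler_pM L0 _ Lx gx); rewrite addr_ge0 // sqr_ge0.
  apply: (le_trans (ler_normD _ _)); rewrite !normrM (ger0_norm fx0).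
  have D0 := stein_derive_cst_ge0 c2 gmax c1_gt0.
  have hc3 : 0 <= c3 by apply: le_trans c3_ge1.
  have bL : 0 <= b * L x by exact: mulr_ge0.
  have ic : 0 <= c3 / c1 by rewrite divr_ge0 // ltW.
  have -> : product_derive_cst * b * (L x * (1 + `|g x| ^+ 2)) =
      (2 * stein_derive_cst c1 c2 gmax + 2 * (c3 / c1)) * (b * L x * (1 + `|g x| ^+ 2)).
    by rewrite /product_derive_cst mulrA -!mulrA.
  apply: (product_rule_bound (mulr_ge0 D0 bL) (mulr_ge0 ic bL)).
    by rewrite [stein_derive_cst _ _ _ * _]mulrA; exact: (ler_wpM2r y0 Fx).
  apply: (le_trans (ler_pM fx0 (normr_ge0 _) fx (drift_derive_norm_le c3_ge1 dg x))).
  by rewrite reassociate_factors.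
have cfg : continuous (fun x => f x * g x).
  apply: locally_lipschitz_continuous; apply: locally_lipschitz_mul.
    exact: (stein_solution_lipschitz c1_gt0 dg).
  exact: (drift_lipschitz c3_ge1 dg).
have dfg x : x != z -> is_derive x 1 (fun x => f x * g x) (df x).
  move=> xz; apply: is_derive_mul; first exact: (is_derive_stein_solution c1_gt0 dg xz).
  exact: (drift_is_derive dg x).
have E : product_derive_cst * weight_step_cst * square_step_cst * delta * b * (L w * (1 + `|g w| ^+ 2)) = B * delta.
  by rewrite /B reassociate_bound.
rewrite E; have [t0|/ltW t0] := leP 0 t.
  have wt : w <= w + t by rewrite lerDl.
  apply: (@le_trans _ _ (B * (w + t - w))).
    apply: (mvt_norm_le_except (f := fun x => f x * g x) (df := df) (c := z) wt cfg (fun x _ => @dfg x)).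
    move=> x /andP[wx xt] _; apply: key; move: td.
    by rewrite (ger0_norm t0) ger0_norm ?subr_ge0 ?(ltW wx) // => td; lra.
  by apply: ler_wpM2l => //; rewrite addrAC subrr add0r (le_trans (ler_norm t)).
have wt : w + t <= w by rewrite gerDl.
rewrite distrC; apply: (@le_trans _ _ (B * (w - (w + t)))).
  apply: (mvt_norm_le_except (f := fun x => f x * g x) (df := df) (c := z) wt cfg (fun x _ => @dfg x)).
  move=> x /andP[wx xt] _; apply: key; move: td.
  by rewrite (ler0_norm t0) ler0_norm ?subr_le0 ?(ltW xt) // => td; lra.
by apply: ler_wpM2l => //; move: td; rewrite ler0_norm // => td; lra.
Qed.

End local_regularity.

End comparison.

(** * Comparison of the tails of W and Y *)

Section comparison_theorem.
Context (R : realType) (d0 d1 c1 c2 c3 tau1 tau2 alpha gmax : R).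
Hypotheses (d0_ge1 : 1 <= d0) (d1_gt0 : 0 < d1) (c1_gt0 : 0 < c1).
Hypotheses (c2_gt0 : 0 < c2) (c3_ge1 : 1 <= c3).
Hypotheses (tau1_gt0 : 0 < tau1) (tau2_gt0 : 0 < tau2) (alpha01 : 0 <= alpha < 1).
Hypothesis gmax_ge0 : 0 <= gmax.
Local Notation M := (crossover c1).
Local Notation setting := (setting d0 d1 c1 c2 c3 tau1 tau2 alpha gmax).
Local Notation moderate := (moderate tau1 tau2).

Local Notation PS := (product_derive_cst c1 c2 c3 gmax * weight_step_cst d1 c2 gmax *
  square_step_cst c2 gmax).
Local Notation D := (stein_derive_cst c1 c2 gmax).

(** Its slope is 1 within 3 delta of z and its height is 6 delta; a step of
    length delta across z starts and ends well inside the sloped part. *)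
Definition ramp (delta z w : R) := clamp (z - 3 * delta) (z + 3 * delta) w - (z - 3 * delta).

Lemma one_sided_pointwise (sg i b f r g F e d0' d1' p rho T1 T2 T3 T4 : R) :
  `|sg| = 1 -> f * g - F = i - b -> 0 <= f -> 0 <= r -> 0 <= rho ->
  d1' * `|F| * (p + 1) <= T1 -> d0' * e = T2 -> f * rho <= T3 -> r * (`|g| + rho) <= T4 ->
  sg * (i - b) + - (T1 + T2 + T3 + T4) <=
  (sg * f - r) * g - sg * F - d1' * `|sg * F| * (p + 1) - d0' * e - `|sg * f - r| * rho.
Proof.
move=> s1 fgF f0 r0 rho0 h1 h2 h3 h4.
rewrite (normrM sg) s1 mul1r h2 -fgF.
have h5 : `|sg * f - r| * rho <= f * rho + r * rho.
  rewrite -mulrDl; apply: ler_wpM2r => //; apply: (le_trans (ler_normB _ _)).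
  by rewrite normrM s1 mul1r !ger0_norm.
have h6 : r * g <= r * `|g| by apply: ler_wpM2l => //; exact: ler_norm.
by move: h4; rewrite mulrDr; lra.
Qed.

Lemma powR_affine_le (y k : R) : 0 <= y -> 0 < k ->
  (1 + y) * (y `^ k + 1) <= 4 * (1 + y `^ (k + 1)).
Proof.
move=> y0 k0; have p0 := powR_ge0 y k; have p1 := powR_ge0 y (k + 1).
have [y1|/ltW y1] := leP y 1.
  have h : y `^ k <= 1.
    rewrite -[leRHS](_ : 1 `^ k = 1); last by rewrite powR1.
    by apply: ge0_ler_powR; rewrite ?nnegrE ?(ltW k0).
  apply: (@le_trans _ _ (2 * 2)); last by lra.
  by apply: ler_pM; lra.
have y_gt0 : 0 < y by lra.
have -> : y `^ (k + 1) = y `^ k * y.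
  rewrite powRD; first by rewrite powRr1.
  by rewrite (gt_eqF y_gt0) implybT.
have h : 1 <= y `^ k.
  rewrite -[leLHS](_ : 1 `^ k = 1); last by rewrite powR1.
  by apply: ge0_ler_powR; rewrite ?nnegrE ?(ltW k0).
apply: (@le_trans _ _ ((2 * y) * (2 * y `^ k))); last by lra.
by apply: ler_pM; lra.
Qed.

Lemma derivative_term_le (dd F A L y p q : R) : 0 <= dd -> 0 <= A -> 0 <= L -> 0 <= p ->
  F <= A * L * (1 + y) -> (1 + y) * (p + 1) <= 4 * q ->
  dd * F * (p + 1) <= 4 * dd * A * (L * q).
Proof.
move=> dd0 A0 L0 p0 h1 h2.
have h3 : F * (p + 1) <= A * L * (1 + y) * (p + 1).
  by apply: ler_wpM2r h1; lra.
have h4 := ler_wpM2l (mulr_ge0 A0 L0) h2.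
have := ler_wpM2l dd0 (le_trans h3 (_ : _ <= A * L * (4 * q))).
by rewrite -mulrA => /(_ h4); rewrite mulrA; lra.
Qed.

(** The slope of the ramp dominates the change of the indicator of w <= z over a
    step. *)
Lemma indicator_jump (sg w t z delta : R) : `|sg| = 1 -> - delta <= t -> t <= delta ->
  0 < delta -> sg * ((w + t <= z)%R%:R - (w <= z)%R%:R) <=
    (z - 3 * delta < w + t < z + 3 * delta)%R%:R.
Proof.
move=> sg1 t1 t2 dl0.
have hs : sg <= 1 by rewrite -sg1 ler_norm.
have hs' : - sg <= 1 by rewrite -sg1 -normrN ler_norm.
have [xz|zx] := leP (w + t) z; have [wz|zw] := leP w z; rewrite /=.
- by rewrite subrr mulr0.
- have -> : (z - 3 * delta < w + t < z + 3 * delta) by apply/andP; split; lra.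
  by rewrite /=; lra.
- have -> : (z - 3 * delta < w + t < z + 3 * delta) by apply/andP; split; lra.
  by rewrite /=; lra.
- by rewrite subrr mulr0.
Qed.

Lemma jump_combine (sg f1 g1 f0 g0 i1 i2 i3 a e : R) :
  sg * (f1 * g1 - f0 * g0) <= e -> sg * (i2 - i3) <= i1 ->
  sg * (g1 * f1 + i2 - a) - i1 <= sg * (g0 * f0 + i3 - a) + e.
Proof. by move=> h1 h2; lra. Qed.

Lemma remainder_term_le (f rho B L d p : R) : 0 <= f -> 0 <= rho ->
  f <= B * L -> rho <= d * (p + 1) -> f * rho <= d * B * (L * (1 + p)).
Proof. by move=> f0 r0 h1 h2; have := ler_pM f0 r0 h1 h2; lra. Qed.

Lemma ramp_term_le (y r rho dl X L : R) : 0 <= y -> 0 <= r ->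
  r <= 6 * dl * (X * L) -> rho <= y + 1 ->
  r * (y + rho) <= 12 * dl * X * (L * (1 + y)).
Proof.
move=> y0 r0 h1 h2.
have h3 : r * (y + rho) <= r * (2 * (1 + y)) by apply: ler_wpM2l => //; lra.
apply: (le_trans h3).
have y2 : 0 <= 2 * (1 + y) by lra.
by have := ler_wpM2r y2 h1; lra.
Qed.

Section one_sided.
Variables (g : R -> R) (delta delta1 delta2 : R) (E : (R -> R) -> R).
Hypothesis S : setting g delta delta1 delta2 E.
Variables (z : R) (z_ge0 : 0 <= z) (mz : moderate g delta delta1 delta2 z).
Let dg := setting_drift S.
Local Notation G := (primitive0 g).
Local Notation L := (gibbs_weight g z).
Local Notation b := (1 - lower_mass c1 g z).
Local Notation f := (stein_solution c1 g z).
Local Notation F' := (stein_solution_derive c1 g z).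
Local Notation obs := (observable g delta d1).

Lemma ramp_ge0 w : 0 <= ramp delta z w.
Proof.
by rewrite subr_ge0; apply: clamp_ge; have := setting_delta_gt0 S; lra.
Qed.

(** The ramp vanishes to the left of z - 3 delta, and to the right of it the
    weight is e^(G(z)) up to a constant, since delta g(z) = O(1). *)
Lemma ramp_le (k5 : R) w : 0 <= k5 -> (forall y, y <= M -> g y <= k5) ->
  ramp delta z w <= 6 * delta * (expR (3 * (1 + k5)) * expR (- G z) * L w).
Proof.
move=> k50 Hk5; have dl0 := setting_delta_gt0 S; have dl1 := setting_delta_le1 S.
have [wz|zw] := leP w (z - 3 * delta).
  rewrite /ramp clamp_lo //; last by lra.
  rewrite subrr; apply: mulr_ge0; first by rewrite mulr_ge0 // ltW.
  by apply: mulr_ge0; [apply: mulr_ge0; exact: expR_ge0|exact: expR_ge0].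
have h6 : ramp delta z w <= 6 * delta.
  by rewrite /ramp; have := clamp_le (z - 3 * delta) (z + 3 * delta) w; lra.
apply: (le_trans h6); rewrite -[leLHS]mulr1; apply: ler_wpM2l.
  by rewrite mulr_ge0 // ltW.
rewrite /gibbs_weight -!expRD -[leLHS]expR0 ler_expR.
set c := clamp 0 z w; have cz : c <= z by exact: clamp_le.
have c0 : 0 <= c by exact: clamp_ge.
have zc : z - c <= 3 * delta.
  suff : z - 3 * delta <= c by lra.
  rewrite /c /clamp le_min; apply/andP; split; last by lra.
  by rewrite le_max (ltW zw).
have gz0 := drift_ge0 dg z_ge0.
have dgz : delta * g z <= 1 + k5.
  have [Mz|/ltW zM] := leP M z.
    by have [h _] := moderate_delta_drift c1_gt0 S Mz mz; lra.
  have h := Hk5 _ zM.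
  apply: (@le_trans _ _ (1 * k5)); last by lra.
  by apply: ler_pM => //; exact: ltW.
have := potential_increment_le dg cz.
have h2 : g z * (z - c) <= 3 * (1 + k5).
  apply: (@le_trans _ _ (g z * (3 * delta))); first by apply: ler_wpM2l.
  by lra.
by lra.
Qed.

Lemma upper_mass_ge0 : 0 <= b.
Proof. by rewrite subr_ge0; exact: (lower_mass_le1 c1_gt0 dg). Qed.

Lemma product_step_cst_ge0 : 0 <= PS.
Proof.
apply: mulr_ge0; first apply: mulr_ge0.
- exact: product_derive_cst_ge0.
- exact: expR_ge0.
- by rewrite /square_step_cst addr_ge0 // mulr_ge0 // sqr_ge0.
Qed.

Lemma indicator_jump_le sg w t e : `|sg| = 1 -> `|t| <= delta -> 0 < delta ->
  `|f (w + t) * g (w + t) - f w * g w| <= e ->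
  sg * F' (w + t) - (z - 3 * delta < w + t < z + 3 * delta)%R%:R <= sg * F' w + e.
Proof.
move=> sg1; rewrite ler_norml => /andP[t1 t2] dl0 he.
have h : sg * (f (w + t) * g (w + t) - f w * g w) <= e.
  by apply: le_trans he; rewrite -[leRHS]mul1r -sg1 -normrM ler_norm.
exact: (jump_combine _ h (indicator_jump w z sg1 t1 t2 dl0)).
Qed.

(** The test function sg f - ramp, for each sign sg.  The approximation of its
    derivative is sg f'(w); both the variation of f g and the jump of the
    indicator then fit into e, the latter because the slope of the ramp enters
    with a minus sign.  The ramp itself only contributes terms of order
    delta (1 + |g|) e^(-G(z)) L. *)
Lemma one_sided_certificate (k5 sg : R) : 0 <= k5 -> (forall y, y <= M -> g y <= k5) ->
  `|sg| = 1 ->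
  E (fun w => sg * ((z < w)%R%:R - b) +
    - (4 * delta1 * (D * b) * (L w * (1 + `|g w| `^ (tau1 + 1)))
      + d0 * PS * delta * b * (L w * (1 + `|g w| `^ 2))
      + delta2 * (b / c1) * (L w * (1 + `|g w| `^ tau2))
      + 12 * delta * (expR (3 * (1 + k5)) * expR (- G z)) * (L w * (1 + `|g w| `^ 1)))) <= 0.
Proof.
move=> k50 Hk5 sg1.
have dl0 := setting_delta_gt0 S; have dl1 := setting_delta_le1 S.
have sE := setting_expect S; have og := setting_observable_drift S.
have oL := observable_gibbs_weight d1 delta dg z_ge0.
have oc c : obs (fun=> c) by exact: observable_cst.
have op k : 0 < k -> obs (fun w => L w * (1 + `|g w| `^ k)).
  move=> k0; apply: (observableM oL); apply: (observableD (oc 1)).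
  exact: (setting_observable_powR S (ltW k0)).
have t1 : 0 < tau1 + 1 by have := tau1_gt0; lra.
have oT := observable_gt g delta d1 z.
have of_ : obs f.
  split.
    apply: continuous_measurable_fun; apply: locally_lipschitz_continuous.
    exact: (stein_solution_lipschitz c1_gt0 dg).
  have [_ [B hB]] := observableM (oc (b / c1)) oL.
  exists B => w sw; apply: le_trans (hB _ sw).
  rewrite (ger0_norm (stein_solution_ge0 c1_gt0 dg z w)); apply: le_trans (ler_norm _).
  exact: (stein_solution_le c1_gt0 dg z_ge0 w).
have or_ : obs (ramp delta z).
  apply: (@observable_bounded _ _ _ _ _ (6 * delta)).
    apply: locally_lipschitz_continuous; apply: locally_lipschitz_add.
      exact: locally_lipschitz_clamp.
    exact: locally_lipschitz_cst.
  move=> w; rewrite (ger0_norm (ramp_ge0 w)) /ramp.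
  by have := clamp_le (z - 3 * delta) (z + 3 * delta) w; lra.
have oF : obs F'.
  apply: observableB; last exact: oc.
  apply: observableD; first exact: (observableM og of_).
  exact: observable_le.
apply: (expect_certificate sE (f := fun w => sg * f w - ramp delta z w) (h := fun w => sg * F' w)
   (e := fun w => PS * delta * b * (L w * (1 + `|g w| `^ 2))) (s := [:: z; z - 3 * delta; z + 3 * delta])).
- apply: locally_lipschitz_add.
    apply: locally_lipschitz_mul; first exact: locally_lipschitz_cst.
    exact: (stein_solution_lipschitz c1_gt0 dg).
  apply: locally_lipschitz_opp; apply: locally_lipschitz_add.
    exact: locally_lipschitz_clamp.
  exact: locally_lipschitz_cst.
- exact: (observableB (observableM (oc sg) of_) or_).
- exact: (observableM (oc sg) oF).
- exact: (observableM (oc _) (op 2 (ltr0n R 2))).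
- apply: observableD; first exact: (observableM (oc sg) (observableB oT (oc b))).
  apply: observableN; apply: observableD; last exact: (observableM (oc _) (op 1 ltr01)).
  apply: observableD; last exact: (observableM (oc _) (op tau2 tau2_gt0)).
  apply: observableD; last exact: (observableM (oc _) (op 2 (ltr0n R 2))).
  exact: (observableM (oc _) (op _ t1)).
- move=> w _; apply: mulr_ge0.
    apply: mulr_ge0; last exact: upper_mass_ge0.
    apply: mulr_ge0; last exact: ltW.
    exact: product_step_cst_ge0.
  by apply: mulr_ge0; [exact: expR_ge0|rewrite addr_ge0 // powR_ge0].
- move=> w t sw td; rewrite !inE !negb_or => /and3P[xz xl xr].
  have lr : z - 3 * delta <= z + 3 * delta by lra.
  have df := is_derive_stein_solution c1_gt0 dg xz.
  have dr : is_derive (w + t) 1 (ramp delta z)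
      (z - 3 * delta < w + t < z + 3 * delta)%R%:R.
    by have := is_derive_sub (is_derive_clamp lr xl xr) (is_derive_const (z - 3 * delta) (w + t)); rewrite subr0.
  have dF := is_derive_sub (is_derive_mulc sg df) dr.
  rewrite derive1E; have [_ ->] := dF.
  have := stein_product_step d1_gt0 c1_gt0 c2_gt0 c3_ge1 gmax_ge0 dg z_ge0 dl1 td sw.
  rewrite (_ : `|g w| `^ 2 = `|g w| ^+ 2); last by rewrite -powR_mulrn.
  set e := _ * (L w * _) => he.
  apply: (indicator_jump_le sg1 td dl0 he).
- move=> w sw.
  have y0 := normr_ge0 (g w).
  have L0 : 0 <= L w by exact: expR_ge0.
  have f0 := stein_solution_ge0 c1_gt0 dg z w.
  have p0 := powR_ge0 `|g w| tau2.
  have rho0 : 0 <= Num.min (alpha * (`|g w| + 1)) (delta2 * (`|g w| `^ tau2 + 1)).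
    have [a0 _] := andP alpha01.
    rewrite le_min; apply/andP; split.
      by apply: (mulr_ge0 a0); rewrite addr_ge0.
    by apply: (mulr_ge0 (setting_delta2_ge0 S)); rewrite addr_ge0.
  apply: one_sided_pointwise => //.
  + by rewrite /stein_solution_derive leNgt; case: (z < w) => /=; ring.
  + exact: ramp_ge0.
  + apply: (derivative_term_le (setting_delta1_ge0 S) _ L0 (powR_ge0 _ _) _ (powR_affine_le y0 tau1_gt0)).
      apply: mulr_ge0; [exact: stein_derive_cst_ge0|exact: upper_mass_ge0].
    exact: (stein_solution_derive_le c1_gt0 c2_gt0 dg z_ge0 w).
  + by rewrite !mulrA.
  + apply: (remainder_term_le f0 rho0 (stein_solution_le c1_gt0 dg z_ge0 w)).
    by rewrite ge_min lexx orbT.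
  + rewrite (powRr1 y0); apply: (ramp_term_le y0 (ramp_ge0 w) (ramp_le w k50 Hk5)).
    have [a0 a1] := andP alpha01; rewrite ge_min; apply/orP; left.
    by rewrite -[leRHS]mul1r; apply: ler_wpM2r; [rewrite addr_ge0|exact: ltW].
Qed.

End one_sided.

(** The ramp contributes e^(-G(z)) (1 + z g(z)) with e^(-G(z)) = O(b (1 + g(z)));
    the product is O(b (1 + z g(z)^2)) because 1 = O(g) beyond M. *)
Lemma mixed_growth_le (k5 z gz : R) : 0 <= k5 -> 0 <= z -> 0 <= gz ->
  (z <= M -> gz <= k5) -> (M <= z -> 1 <= M * gz) ->
  (1 + gz) * (1 + z * gz) <= ((1 + k5) * (1 + M * k5) + (2 * M + 1)) * (1 + z * gz ^+ 2).
Proof.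
move=> k50 z0 gz0 hlo hhi; have M1 := crossover_ge1 c1; have M0 := crossover_gt0 c1.
have q0 : 0 <= z * gz ^+ 2 by rewrite mulr_ge0 // sqr_ge0.
have c0 : 0 <= (1 + k5) * (1 + M * k5).
  by apply: mulr_ge0; [lra|rewrite addr_ge0 // mulr_ge0 // ltW].
have [Mz|/ltW zM] := leP M z.
  have g1 := hhi Mz.
  have zg : 0 <= z * gz by rewrite mulr_ge0.
  have h1 : gz <= z * gz by rewrite -[leLHS]mul1r; apply: ler_wpM2r => //; lra.
  have h2 : z * gz <= M * (z * gz ^+ 2).
    have -> : M * (z * gz ^+ 2) = z * gz * (M * gz) by ring.
    by rewrite -[leLHS]mulr1; apply: ler_wpM2l.
  apply: (@le_trans _ _ ((2 * M + 1) * (1 + z * gz ^+ 2))); last first.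
    by apply: ler_wpM2r; [lra|rewrite lerDr].
  by lra.
have h := hlo zM.
have zgk : z * gz <= M * k5 by apply: ler_pM.
apply: (@le_trans _ _ ((1 + k5) * (1 + M * k5))).
  by apply: ler_pM; rewrite ?addr_ge0 ?mulr_ge0 // lerD2l.
rewrite -[leLHS]mulr1; apply: ler_pM => //; last by lra.
by rewrite lerDl; lra.
Qed.

Lemma error_sum_le (b e1 e2 e3 K1 K2 K3 K4 T1 T2 T3 T4 : R) :
  0 <= b -> 0 <= e1 -> 0 <= e2 -> 0 <= e3 -> 0 <= K1 -> 0 <= K2 -> 0 <= K3 -> 0 <= K4 ->
  T1 <= K1 * (b * e2) -> T2 <= K2 * (b * e1) -> T3 <= K3 * (b * e3) -> T4 <= K4 * (b * e1) ->
  T1 + T2 + T3 + T4 <= (K1 + K2 + K3 + K4) * (b * (e1 + e2 + e3)).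
Proof.
move=> b0 e10 e20 e30 K10 K20 K30 K40 h1 h2 h3 h4.
have be1 := mulr_ge0 b0 e10; have be2 := mulr_ge0 b0 e20; have be3 := mulr_ge0 b0 e30.
have := mulr_ge0 K10 be1; have := mulr_ge0 K10 be3.
have := mulr_ge0 K20 be2; have := mulr_ge0 K20 be3.
have := mulr_ge0 K30 be1; have := mulr_ge0 K30 be2.
have := mulr_ge0 K40 be2; have := mulr_ge0 K40 be3.
by lra.
Qed.

Definition error_rate (g : R -> R) delta delta1 delta2 z :=
  delta * (1 + z * g z ^+ 2) + delta1 * (1 + z * g z `^ (tau1 + 1)) +
  delta2 * (1 + z * g z `^ tau2).

Lemma derivative_error_le (d D' b e C X : R) : 0 <= d -> 0 <= D' -> 0 <= b -> e <= C * X ->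
  4 * d * (D' * b) * e <= 4 * D' * C * (b * (d * X)).
Proof.
move=> d_ge0 D0 b0 h; have k0 : 0 <= 4 * d * (D' * b).
  by apply: mulr_ge0; [rewrite mulr_ge0|rewrite mulr_ge0].
by have := ler_wpM2l k0 h; lra.
Qed.

Lemma step_error_le (k d b e C X : R) : 0 <= k -> 0 <= d -> 0 <= b -> e <= C * X ->
  k * d * b * e <= k * C * (b * (d * X)).
Proof.
move=> k0 d_ge0 b0 h; have k0' := mulr_ge0 (mulr_ge0 k0 d_ge0) b0.
by have := ler_wpM2l k0' h; lra.
Qed.

Lemma remainder_error_le (i d b e C X : R) : 0 <= i -> 0 <= d -> 0 <= b -> e <= C * X ->
  d * (b * i) * e <= i * C * (b * (d * X)).
Proof.
move=> i0 d_ge0 b0 h; have k0' := mulr_ge0 d_ge0 (mulr_ge0 b0 i0).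
by have := ler_wpM2l k0' h; lra.
Qed.

Lemma ramp_error_le (d Y eG b kap e C4 C1 y X Q : R) : 0 <= d -> 0 <= Y -> 0 <= b ->
  0 < kap -> 0 <= C1 -> 0 <= X -> 0 <= eG -> e <= C1 * X -> eG <= b * y / kap -> y * X <= C4 * Q ->
  12 * d * (Y * eG) * e <= 12 * Y / kap * C1 * C4 * (b * (d * Q)).
Proof.
move=> d_ge0 Y0 b0 kap0 C10 X0 eG0 h1 h2 h3.
have k0 : 0 <= 12 * d * (Y * eG) by apply: mulr_ge0; rewrite mulr_ge0.
have s1 := ler_wpM2l k0 h1.
have k1' : 0 <= 12 * d * Y * (C1 * X) by rewrite !mulr_ge0.
have s2 := ler_wpM2l k1' h2.
have ik : 0 <= kap^-1 by rewrite invr_ge0 ltW.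
have k2' : 0 <= 12 * d * Y * C1 * b * kap^-1 by rewrite !mulr_ge0.
have s3 := ler_wpM2l k2' h3.
apply: (le_trans s1).
have -> : 12 * d * (Y * eG) * (C1 * X) = 12 * d * Y * (C1 * X) * eG by ring.
apply: (le_trans s2).
have -> : 12 * d * Y * (C1 * X) * (b * y / kap) = 12 * d * Y * C1 * b * kap^-1 * (y * X) by ring.
by apply: (le_trans s3); rewrite le_eqVlt; apply/orP; left; apply/eqP; ring.
Qed.

(** The two signs in [one_sided_certificate] give the two inequalities, each
    of its four error terms being a weighted moment. *)
Lemma tail_comparison : exists2 C, 0 <= C &
  forall g delta delta1 delta2 E, setting g delta delta1 delta2 E ->
  forall z, 0 <= z -> moderate g delta delta1 delta2 z ->
  `|E (fun w => (z < w)%R%:R) - (1 - lower_mass c1 g z)| <=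
    C * ((1 - lower_mass c1 g z) * error_rate g delta delta1 delta2 z).
Proof.
have t1 : 0 < tau1 + 1 by have := tau1_gt0; lra.
pose GM := gibbs_weighted_moment d0_ge1 d1_gt0 c1_gt0 c2_gt0 c3_ge1 tau1_gt0 tau2_gt0 alpha01 gmax_ge0.
have [Ca Ca0 HCa] := GM _ t1.
have [C2 C20 HC2] := GM 2 (ltr0n R 2).
have [Ct Ct0 HCt] := GM _ tau2_gt0.
have [C1 C10 HC1] := GM 1 ltr01.
have [k5 k50 Hk5] := drift_bounded gmax c2_gt0 M.
have M0 := crossover_gt0 c1.
pose C4 := (1 + k5) * (1 + M * k5) + (2 * M + 1).
have C40 : 0 <= C4.
  apply: addr_ge0; last by lra.
  by apply: mulr_ge0; [lra|rewrite addr_ge0 // mulr_ge0 // ltW].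
pose kap := mills_cst c1 c2 gmax.
have kap0 : 0 < kap by exact: mills_cst_gt0.
pose eY := expR (3 * (1 + k5)).
have eY0 : 0 <= eY by exact: expR_ge0.
have D0 := stein_derive_cst_ge0 c2 gmax c1_gt0.
have hd0 : 0 <= d0 by apply: le_trans d0_ge1.
have K10 : 0 <= 4 * D * Ca by apply: mulr_ge0 => //; apply: mulr_ge0.
have PS0 : 0 <= PS by exact: product_step_cst_ge0.
have K20 : 0 <= d0 * PS * C2 by apply: mulr_ge0 => //; exact: mulr_ge0.
have K30 : 0 <= c1^-1 * Ct by apply: mulr_ge0 => //; rewrite invr_ge0 ltW.
have K40 : 0 <= 12 * eY / kap * C1 * C4.
  apply: mulr_ge0 => //; apply: mulr_ge0 => //; apply: divr_ge0; last exact: ltW.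
  exact: mulr_ge0.
exists (4 * D * Ca + d0 * PS * C2 + c1^-1 * Ct + 12 * eY / kap * C1 * C4).
  by rewrite !addr_ge0.
move=> g delta delta1 delta2 E S z z0 mz.
have dg := setting_drift S; have sE := setting_expect S.
have gz0 := drift_ge0 dg z0.
have b0 : 0 <= 1 - lower_mass c1 g z by rewrite subr_ge0; exact: (lower_mass_le1 c1_gt0 dg).
have dl0 := ltW (setting_delta_gt0 S).
have dl10 := setting_delta1_ge0 S; have dl20 := setting_delta2_ge0 S.
have pe X : 0 <= X -> 0 <= 1 + z * X by move=> X0; rewrite addr_ge0 // mulr_ge0.
have e10 : 0 <= delta * (1 + z * g z ^+ 2) by apply: mulr_ge0 => //; apply: pe; exact: sqr_ge0.
have e20 : 0 <= delta1 * (1 + z * g z `^ (tau1 + 1)).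
  by apply: mulr_ge0 => //; apply: pe; exact: powR_ge0.
have e30 : 0 <= delta2 * (1 + z * g z `^ tau2).
  by apply: mulr_ge0 => //; apply: pe; exact: powR_ge0.
have Hk5' y : y <= M -> g y <= k5 by exact: (Hk5 _ _ _ dg).
have Hhi : M <= z -> 1 <= M * g z by exact: (setting_drift_ge1 c1_gt0 S).
have mg := mixed_growth_le k50 z0 gz0 (Hk5' z) Hhi.
have HA := HCa _ _ _ _ _ S z z0 mz.
have HB := HC2 _ _ _ _ _ S z z0 mz.
have HT := HCt _ _ _ _ _ S z z0 mz.
have H1 := HC1 _ _ _ _ _ S z z0 mz.
rewrite (_ : g z `^ 2 = g z ^+ 2) in HB; last by rewrite -powR_mulrn.
rewrite (powRr1 gz0) in H1.
pose L := gibbs_weight g z.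
have oL : observable g delta d1 L := observable_gibbs_weight d1 delta dg z0.
have oc c : observable g delta d1 (fun=> c) by exact: observable_cst.
have op k : 0 < k -> observable g delta d1 (fun w => L w * (1 + `|g w| `^ k)).
  move=> k0; apply: (observableM oL); apply: (observableD (oc 1)).
  exact: (setting_observable_powR S (ltW k0)).
have oT := observable_gt g delta d1 z.
have main sg : `|sg| = 1 ->
    sg * (E (fun w => (z < w)%R%:R) - (1 - lower_mass c1 g z)) <=
    (4 * D * Ca + d0 * PS * C2 + c1^-1 * Ct + 12 * eY / kap * C1 * C4) *
    ((1 - lower_mass c1 g z) * error_rate g delta delta1 delta2 z).
  move=> sg1; have := one_sided_certificate S z0 mz k50 Hk5' sg1.
  have oA := op _ t1; have oB := op 2 (ltr0n R 2); have oC := op _ tau2_gt0; have oD := op 1 ltr01.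
  set a1 := 4 * delta1 * _; set a2 := d0 * _ * delta * _; set a3 := delta2 * _; set a4 := 12 * delta * _.
  have o1 := observableM (oc a1) oA; have o2 := observableM (oc a2) oB.
  have o3 := observableM (oc a3) oC; have o4 := observableM (oc a4) oD.
  have o12 := observableD o1 o2; have o123 := observableD o12 o3.
  have o1234 := observableD o123 o4.
  have oTb := observableB oT (oc (1 - lower_mass c1 g z)).
  rewrite (expectD sE (observableM (oc sg) oTb) (observableN o1234)).
  rewrite (expectZ sE sg oTb) (expectD sE oT (oc _)) (expect_cst sE).
  have EN h : observable g delta d1 h -> E (fun w => - h w) = - E h.
    move=> oh; rewrite -[RHS]mulN1r -(expectZ sE _ oh); congr E; apply/funext => w.
    by rewrite mulN1r.
  rewrite (EN _ o1234) (expectD sE o123 o4) (expectD sE o12 o3) (expectD sE o1 o2).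
  rewrite (expectZ sE a1 oA) (expectZ sE a2 oB) (expectZ sE a3 oC) (expectZ sE a4 oD).
  rewrite subr_le0 => h; apply: (le_trans h); rewrite /error_rate.
  apply: (error_sum_le b0 e10 e20 e30 K10 K20 K30 K40).
  - exact: (derivative_error_le dl10 D0 b0 HA).
  - exact: (step_error_le (mulr_ge0 hd0 PS0) dl0 b0 HB).
  - by apply: (remainder_error_le _ dl20 b0 HT); rewrite invr_ge0 ltW.
  - apply: (ramp_error_le dl0 eY0 b0 kap0 C10 _ (expR_ge0 _) H1 _ mg).
      by rewrite addr_ge0 // mulr_ge0.
    rewrite ler_pdivlMr // expRN mulrC ler_pdivrMr ?expR_gt0 //.
    by have := upper_mass_weight c1_gt0 c2_gt0 dg z0; rewrite mulrAC.
have [h0|h0] := leP 0 (E (fun w => (z < w)%R%:R) - (1 - lower_mass c1 g z)).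
  by have := main 1 (normr1 _); rewrite mul1r ger0_norm.
by have := main (-1) (normrN1 _); rewrite mulN1r ltr0_norm.
Qed.

End comparison_theorem.

(** * Large errors and conclusion *)

Section large_errors.
Context (R : realType) (c1 c2 c3 tau1 tau2 alpha gmax : R).
Hypotheses (c1_gt0 : 0 < c1) (c2_gt0 : 0 < c2).
Hypotheses (tau2_gt0 : 0 < tau2) (alpha01 : 0 <= alpha < 1).
Local Notation M := (crossover c1).
Local Notation moderate := (moderate tau1 tau2).
Local Notation s0 := (small_error c1 tau2 alpha).
Local Notation error_rate := (error_rate tau1 tau2).

Lemma small_error_gt0 : 0 < s0.
Proof.
have [a0 a1] := andP alpha01.
rewrite lt_min ltr01 /=; apply: divr_gt0; last by rewrite ltr_wpDl // powR_ge0.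
by apply: divr_gt0; [lra|exact: crossover_gt0].
Qed.

(** If delta > 1 then z g(z)^2 <= 1, and if delta2 exceeds the threshold then
    z g(z)^tau2 is bounded.  Since g >= 1 / M beyond M, either way z is bounded
    in terms of the constants; then b and the error rate are bounded below, and
    any two probabilities differ by at most 1. *)
Lemma large_error_comparison : exists2 C, 0 <= C &
  forall g delta delta1 delta2, drift c1 c2 c3 gmax g ->
  0 <= delta -> 0 <= delta1 -> 0 <= delta2 -> (1 < delta \/ s0 < delta2) ->
  forall z p, 0 <= z -> moderate g delta delta1 delta2 z -> 0 <= p <= 1 ->
  `|p - (1 - lower_mass c1 g z)| <=
    C * ((1 - lower_mass c1 g z) * error_rate g delta delta1 delta2 z).
Proof.
have s0_gt0 := small_error_gt0; have s0_le1 : s0 <= 1 by rewrite ge_min lexx.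
have M0 := crossover_gt0 c1; have M1 := crossover_ge1 c1.
pose Zm := M + M ^+ 2 + M `^ tau2 / s0.
have Mp : 0 <= M `^ tau2 / s0 by rewrite divr_ge0 ?powR_ge0 // ltW.
have [k5 k50 Hk5] := drift_bounded gmax c2_gt0 Zm.
pose kap := mills_cst c1 c2 gmax.
have kap0 : 0 < kap by exact: mills_cst_gt0.
pose W0 := expR (k5 * Zm) * (1 + k5).
have W0_gt0 : 0 < W0 by rewrite mulr_gt0 ?expR_gt0 // ltr_pwDl.
have C0 : 0 <= W0 / (kap * s0) by apply: divr_ge0; [exact: ltW|rewrite ltW // mulr_gt0].
exists (W0 / (kap * s0)) => //.
move=> g delta delta1 delta2 dg dl0 dl10 dl20 large z p z0 mz /andP[p0 p1].
have gz0 := drift_ge0 dg z0.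
have T1 : 0 <= delta * z * g z ^+ 2 by rewrite !mulr_ge0 ?sqr_ge0.
have T2 : 0 <= delta1 * z * g z `^ (tau1 + 1) by rewrite !mulr_ge0 ?powR_ge0.
have T3 : 0 <= delta2 * z * g z `^ tau2 by rewrite !mulr_ge0 ?powR_ge0.
have zZ : z <= Zm.
  have [Mz|/ltW zM] := leP M z; last by apply: (le_trans zM); rewrite /Zm -addrA lerDl addr_ge0 // sqr_ge0.
  have g1 : 1 <= M * g z.
    by rewrite mulrC -ler_pdivrMr // mul1r; exact: (drift_ge_crossover c1_gt0 dg).
  move: mz; rewrite /moderate => mz; case: large => [dl1|dl2].
    have q0 : 0 <= z * g z ^+ 2 by rewrite mulr_ge0 // sqr_ge0.
    have q1 : z * g z ^+ 2 <= 1.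
      have : 1 * (z * g z ^+ 2) <= delta * (z * g z ^+ 2) by apply: ler_wpM2r => //; exact: ltW.
      by rewrite mul1r; lra.
    have q2 : z <= M ^+ 2 * (z * g z ^+ 2).
      have -> : M ^+ 2 * (z * g z ^+ 2) = z * (M * g z) ^+ 2 by ring.
      by rewrite -[leLHS]mulr1; apply: ler_wpM2l => //; exact: exprn_ege1.
    have q3 := ler_wpM2l (sqr_ge0 M) q1.
    by rewrite /Zm; lra.
  set P2 := g z `^ tau2 in T3 mz.
  have P20 : 0 <= P2 by exact: powR_ge0.
  have q1 : z * P2 <= s0^-1.
    rewrite -[leRHS]mul1r ler_pdivlMr //.
    have : z * P2 * s0 <= z * P2 * delta2 by apply: ler_wpM2l; [exact: mulr_ge0|exact: ltW].
    by lra.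
  have q2 : 1 <= M `^ tau2 * P2.
    rewrite -powRM ?(ltW M0) // -[leLHS](_ : 1 `^ tau2 = 1); last by rewrite powR1.
    by apply: ge0_ler_powR; rewrite ?nnegrE ?(ltW tau2_gt0) // (le_trans ler01).
  have q3 := ler_wpM2l z0 q2.
  have q4 := ler_wpM2l (powR_ge0 M tau2) q1.
  have : 0 <= M ^+ 2 by exact: sqr_ge0.
  by rewrite /Zm; lra.
set b := 1 - lower_mass c1 g z.
have b0 : 0 <= b by rewrite subr_ge0; exact: (lower_mass_le1 c1_gt0 dg).
have b1 : b <= 1 by rewrite gerBl; exact: lower_mass_ge0.
have err : s0 <= error_rate g delta delta1 delta2 z.
  rewrite /error_rate; case: large => h; lra.
have gk : g z <= k5 by exact: (Hk5 _ _ _ dg).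
have bW : kap <= b * W0.
  apply: (le_trans (upper_mass_weight c1_gt0 c2_gt0 dg z0)); rewrite -mulrA.
  apply: ler_wpM2l => //; apply: ler_pM; [exact: expR_ge0|by rewrite addr_ge0| |by rewrite lerD2l].
  rewrite ler_expR; have := potential_increment_le dg z0; rewrite potential0 !subr0.
  by move=> /le_trans; apply; apply: ler_pM.
apply: (@le_trans _ _ 1); first by rewrite ler_norml; apply/andP; split; lra.
have -> : W0 / (kap * s0) * (b * error_rate g delta delta1 delta2 z) =
  (b * W0 * error_rate g delta delta1 delta2 z) / (kap * s0) by ring.
rewrite ler_pdivlMr ?mul1r; last by rewrite mulr_gt0.
by apply: ler_pM => //; exact: ltW.
Qed.

End large_errors.

Section stein_expectation_of_law.
Context (d : measure_display) (T : measurableType d) (R : realType).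
Variables (P : probability T R) (W : {RV P >-> R}) (delta : R).
Variables (K : T -> R -> R) (g r : R -> R) (EK1 : T -> \bar R).
Variables (d0 d1 tau1 tau2 alpha delta1 delta2 : R).

Let measurable_gt z : measurable [set w | z < W w].
Proof.
rewrite (_ : mkset _ = W @^-1` `]z, +oo[); first exact: measurable_funPTI.
by apply/seteqP; split => w /=; rewrite in_itv /= andbT.
Qed.

Lemma expect_gt z : expect W (fun w => (z < w)%R%:R) = fine (P [set w | z < W w]).
Proof.
rewrite /expect /Rintegral; congr fine; set A := [set w | z < W w].
have mA : measurable A by exact: measurable_gt.
transitivity (\int[P]_w (\1_A w)%:E)%E; last by rewrite integral_indic // setIT.
apply: eq_integral => w _; rewrite indicE.
by have -> // : (w \in A) = (z < W w) by apply/idP/idP; rewrite inE.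
Qed.

Lemma fine_gt01 z : 0 <= fine (P [set w | z < W w]) <= 1.
Proof.
apply/andP; split; first exact: fine_ge0.
by rewrite -lee_fin fineK ?probability_le1 // fin_num_measure.
Qed.

Lemma stein_expectation_law : continuous g -> 0 < delta -> 0 <= tau1 ->
  measurable_fun ([set: T] `*` `[- delta, delta]) (fun x : T * R => K x.1 x.2) ->
  {ae P, forall w, forall t, t \in `[- delta, delta] -> 0 <= K w t} ->
  stein_identity W delta K g r ->
  is_cond_expectation W (khat1 delta K) EK1 ->
  {ae P, forall w, (`|EK1 w - 1| <= (delta1 * (`|g (W w)| `^ tau1 + 1))%:E)%E} ->
  {ae P, forall w, `|r (W w)| <= delta2 * (`|g (W w)| `^ tau2 + 1)} ->
  {ae P, forall w, (EK1 w <= d0%:E)%E} ->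
  {ae P, forall w, delta * `|g (W w)| <= d1} ->
  {ae P, forall w, `|r (W w)| <= alpha * (`|g (W w)| + 1)} ->
  stein_expectation d0 d1 tau1 tau2 alpha delta delta1 delta2 g (expect W).
Proof.
move=> cg dl t1 mK K0 id cond near1 rs Kd0 dgd1 rb.
have int h : observable g delta d1 h ->
    P.-integrable setT (EFin \o (fun w => h (W w))) by exact: observable_integrable.
split => [h k oh ok hk|h k oh ok|c h oh|c|f h e q s lf of_ oh oe oq].
- apply: ae_le_Rintegral => //; [exact: int|exact: int|].
  by apply: ae_imp dgd1 => w sw _; exact: hk.
- by rewrite /expect RintegralD //; exact: int.
- by rewrite /expect RintegralZl //; exact: int.
- by rewrite /expect Rintegral_cst //= probability_setT mulr1.
- exact: (stein_certificate cg mK K0 id cond near1 rs Kd0 dgd1 rb dl t1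
    lf of_ oh oe oq).
Qed.

End stein_expectation_of_law.

Lemma density_tail (d : measure_display) (T : measurableType d) (R : realType)
    (Q : probability T R) (Y : {RV Q >-> R}) (c1 c2 c3 gmax : R) (g : R -> R) z :
  0 < c1 -> drift c1 c2 c3 gmax g ->
  has_density Y (fun y => c1 * expR (- primitive0 g y)) ->
  fine (Q [set w | z < Y w]) = 1 - lower_mass c1 g z.
Proof.
move=> c1_gt0 dg [_ _ hY].
have -> : [set w | z < Y w] = Y @^-1` `]z, +oo[.
  by apply/seteqP; split => w /=; rewrite in_itv /= andbT.
have := hY `]z, +oo[%classic (measurable_itv _).
by rewrite /distribution /pushforward => ->; rewrite (upper_massE c1_gt0 dg).
Qed.

Lemma relative_error_of_bound (R : realType) (C p b e : R) : 0 < b -> 0 < e ->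
  `|p - b| <= C * (b * e) -> exists2 theta, `|theta| <= C & p / b = 1 + theta * e.
Proof.
move=> b0 e0 h; exists ((p / b - 1) / e).
  rewrite normrM normfV (gtr0_norm e0) ler_pdivrMr //.
  have -> : p / b - 1 = (p - b) / b by field; exact: lt0r_neq0.
  by rewrite normrM normfV (gtr0_norm b0) ler_pdivrMr //; lra.
by rewrite divfK ?lt0r_neq0 // addrCA subrr addr0.
Qed.

Theorem theorem2p1 (R : realType)
    (d0 d1 c1 c2 c3 tau1 tau2 alpha gmax : R)
    (hd0 : 1 <= d0) (hd1 : 0 < d1) (hc2 : 0 < c2) (hc3 : 1 <= c3)
    (htau1 : 0 < tau1) (htau2 : 0 < tau2) (halpha : 0 <= alpha < 1) :
  (* C is the constant hidden in O(1): it is chosen before g, W, delta, ... *)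
  exists C : R,
  forall (g : R -> R)
    (g_derivable : forall y, derivable g y 1)
    (g_nondecreasing : {homo g : x y / x <= y})
    (g0 : g 0 = 0)
    (g_sign : forall y, y != 0 -> 0 < y * g y)
    (g_quasi_additive : forall x y, `|g (x + y)| <= c2 * (`|g x| + `|g y| + 1))
    (g_derive_bound : forall y, `|g^`()%classic y| <= c3 * ((1 + `|g y|) / (1 + `|y|)))
    (g_max : Num.max (g 1) `|g (- 1)| = gmax)
    (c1_normalizing :
      (\int[@lebesgue_measure R]_y (c1 * expR (- primitive0 g y))%:E = 1)%E)
    (d : measure_display) (T : measurableType d) (P : probability T R)
    (W : {RV P >-> R}) (delta : R) (hdelta : 0 < delta)
    (K : T -> R -> R)
    (K_measurable :
      measurable_fun ([set: T] `*` `[- delta, delta]) (fun x : T * R => K x.1 x.2))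
    (K_ge0 : {ae P, forall w, forall t, t \in `[- delta, delta] -> 0 <= K w t})
    (r : R -> R) (r_measurable : measurable_fun setT r)
    (W_identity : stein_identity W delta K g r)
    (EK1 : T -> \bar R)
    (EK1_cond : is_cond_expectation W (khat1 delta K) EK1)
    (delta1 delta2 : R) (hdelta1 : 0 < delta1) (hdelta2 : 0 <= delta2)
    (EK1_near1 : {ae P, forall w,
      (`|EK1 w - 1| <= (delta1 * (`|g (W w)| `^ tau1 + 1))%:E)%E})
    (r_small : {ae P, forall w,
      `|r (W w)| <= delta2 * (`|g (W w)| `^ tau2 + 1)})
    (EK1_bound : {ae P, forall w, (EK1 w <= d0%:E)%E})
    (delta_g_bound : {ae P, forall w, delta * `|g (W w)| <= d1})
    (r_bound : {ae P, forall w, `|r (W w)| <= alpha * (`|g (W w)| + 1)})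
    (d' : measure_display) (T' : measurableType d') (Q : probability T' R)
    (Y : {RV Q >-> R})
    (Y_density : has_density Y (fun y => c1 * expR (- primitive0 g y)))
    (z : R) (hz : 0 <= z)
    (z_range : delta * z * g z ^+ 2 + delta1 * z * g z `^ (tau1 + 1)
               + delta2 * z * g z `^ tau2 <= 1),
  exists2 theta : R, `|theta| <= C &
    fine (P [set w | z < W w]) / fine (Q [set w | z < Y w])
    = 1 + theta * (delta * (1 + z * g z ^+ 2)
                   + delta1 * (1 + z * g z `^ (tau1 + 1))
                   + delta2 * (1 + z * g z `^ tau2)).

Proof.
(* For c1 <= 0 or gmax < 0 there is no g, and any constant will do. *)
have [c1_gt0|c1_le0] := ltP 0 c1; last first.
  exists 0 => g _ _ _ _ _ _ _ norm; exfalso; move: norm.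
  set I := (\int[_]_y _)%E => I1.
  have : (I <= 0)%E.
    rewrite /I integralE (eq_integral (cst 0%E)); last first.
      move=> y _; rewrite funeposE; apply/max_idPr.
      by rewrite lee_fin mulr_le0_ge0 // expR_ge0.
    by rewrite integral0 sub0e oppe_le0; apply: integral_ge0.
  by rewrite I1 lee_fin ler10.
have [gmax_ge0|gmax_lt0] := leP 0 gmax; last first.
  exists 0 => g _ _ _ _ _ _ gm; exfalso; move: gmax_lt0; rewrite -gm.
  by rewrite gt_max normr_lt0 andbF.
have [Cs Cs0 small] := tail_comparison hd0 hd1 c1_gt0 hc2 hc3 htau1 htau2 halpha gmax_ge0.
have [Cl Cl0 large] := large_error_comparison c3 tau1 gmax c1_gt0 hc2 htau2 halpha.
exists (Cs + Cl) => g g1 g2 g3 _ g5 g6 g7 g8 d T P W delta dl K mK K0 r mr id EK1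
  cond delta1 delta2 dl1 dl2 near1 rs Kd0 dgd1 rb d' T' Q Y hY z z0 mz.
have dg := Drift g1 g2 g3 g5 g6 g7 g8.
have W_expect := stein_expectation_law (drift_continuous dg) dl (ltW htau1)
  mK K0 id cond near1 rs Kd0 dgd1 rb.
rewrite (density_tail _ c1_gt0 dg hY).
set b := 1 - lower_mass c1 g z; set p := fine _.
have b_gt0 : 0 < b.
  have := lt_le_trans (mills_cst_gt0 _ _ c1_gt0) (upper_mass_weight c1_gt0 hc2 dg z0).
  rewrite -mulrA pmulr_lgt0 //.
  by apply: mulr_gt0; [exact: expR_gt0|rewrite ltr_pwDl // (drift_ge0 dg)].
pose e := error_rate tau1 tau2 g delta delta1 delta2 z.
have pow_ge0 k : 0 <= 1 + z * g z `^ k by rewrite addr_ge0 // mulr_ge0 // powR_ge0.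
have e_gt0 : 0 < e.
  rewrite /e /error_rate; apply: ltr_wpDr; last apply: ltr_wpDr.
  - by rewrite mulr_ge0.
  - by rewrite mulr_ge0 // ltW.
  - by rewrite mulr_gt0 // ltr_pwDl // mulr_ge0 // sqr_ge0.
have be0 : 0 <= b * e by rewrite ltW // mulr_gt0.
apply: relative_error_of_bound => //.
have [good|large_errors] : (delta <= 1 /\ delta2 <= small_error c1 tau2 alpha) \/
    (1 < delta \/ small_error c1 tau2 alpha < delta2).
  case: (leP delta 1) => _; last by right; left.
  by case: leP => _; [left|right; right].
- apply: (@le_trans _ _ (Cs * (b * e))); last by rewrite ler_wpM2r // lerDl.
  rewrite /p -expect_gt.
  apply: small z0 mz; case: good => delta_le1 delta2_small.
  exact: Setting dg dl delta_le1 (ltW dl1) dl2 delta2_small W_expect.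
- apply: (@le_trans _ _ (Cl * (b * e))); last by rewrite ler_wpM2r // lerDr.
  apply: (large _ _ _ _ dg (ltW dl) (ltW dl1) dl2 large_errors _ _ z0 mz).
  exact: fine_gt01.
Qed.
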